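(* Let $\mathcal M$ be a 4-dimensional oriented manifold with a (real) metric $g$ of Riemannian signature, whose selfdual part of the Weyl tensor is nonvanishing (nowhere zero). Let $J$ be a metric compatible almost complex structure on $\mathcal M$ such that its holomorphic distribution $\mathcal N={\rm T}^{(1,0)}\mathcal M\subset {\rm T}^{\mathbb C}\mathcal M$ is selfdual. Then any two of the following imply the third: (0) The Cotton tensor $A$ of $g$ is degenerate on $\mathcal N$, $A_{|\mathcal N}\equiv 0$. (i) $J$ has vanishing Nijenhuis tensor on $\mathcal M$, meaning that $(\mathcal M,g,J)$ is a hermitian manifold. (ii) The selfdual part of the Weyl tensor is algebraically special on $\mathcal M$ with $\mathcal N$ as a field of multiple principal selfdual totally null 2-planes.
   Context: All objects are smooth; $g$ and all tensors are extended complex-multilinearly to ${\rm T}^{\mathbb C}\mathcal M$. 'Metric compatible' means $g(JX,JY)=g(X,Y)$; then $\mathcal N={\rm T}^{(1,0)}\mathcal M$ (the $+i$ eigenbundle of $J$) is a field of totally null complex 2-planes, i.e. $g_{|\mathcal N}\equiv 0$. Every totally null 2-plane is selfdual or antiselfdual, i.e. $*(n_1\wedge n_2)=n_1\wedge n_2$ for all $n_1,n_2\in\mathcal N$, or $*(n_1\wedge n_2)=-n_1\wedge n_2$ for all $n_1,n_2\in \mathcal N$. Curvature conventions: $R_{ab}=R^c{}_{acb}$ is the Ricci tensor, $R$ its trace, $\mathsf P_{ab}=\tfrac12R_{ab}-\tfrac1{12}Rg_{ab}$ the Schouten tensor, $C_{abcd}=R_{abcd}+g_{ad}\mathsf P_{cb}-g_{ac}\mathsf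 P_{db}+g_{bc}\mathsf P_{da}-g_{bd}\mathsf P_{ca}$ the Weyl tensor, and $A_{abc}=\nabla_b\mathsf P_{ca}-\nabla_c\mathsf P_{ba}$ the Cotton tensor. $A_{|\mathcal N}\equiv0$ means $A(Z_1,Z_2,Z_3)=0$ for all $Z_1,Z_2,Z_3\in\mathcal N$. A null frame is a local frame $(e_1,e_2,e_3,e_4)=(m,p,n,k)$ of ${\rm T}^{\mathbb C}\mathcal M$ with $g(m,p)=g(n,k)=1$ and all other products of frame vectors zero. It is adapted to $\mathcal N$ if $\mathcal N={\rm Span}_{\mathbb C}(m,k)$. In a null frame with ${\rm Span}_{\mathbb C}(m,k)$ selfdual, put $\Psi_0=C(m,k,m,k)$, $\Psi_1=C(m,k,n,k)$, $\Psi_2=C(m,k,p,n)$, $\Psi_3=C(p,n,m,p)$, $\Psi_4=C(p,n,p,n)$; these are the components of the selfdual part of the Weyl tensor. The selfdual totally null planes at a point are $\mathcal N_z={\rm Span}_{\mathbb C}(m+zn,k-zp)$, $z\in\mathbb C$, and $\mathcal N_\infty={\rm Span}_{\mathbb C}(n,p)$. $\mathcal N_z$ is principal if $z$ is a root in $\mathbb C\cup\{\infty\}$ of the quartic $\Psi_4z^4-4\Psi_3z^3+6\Psi_2z^2+4\Psi_1z+\Psi_0$, and multiple principal if $z$ is a multiple root. The selfdual part of the Weyl tensor is algebraically special where a multiple principal plane exists. In a frame adapted to $\mathcal N$, $\mathcal N$ is a field of multiple principal planes iff $\Psi_0\equiv\Psi_1\equiv0$. *)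

(* Defs.v *)
From HB Require Import structures.
From mathcomp Require Import all_boot all_order all_algebra.
From mathcomp Require Import all_classical all_reals all_analysis.
From mathcomp Require Import complex.
Set Implicit Arguments.
Unset Strict Implicit.
Unset Printing Implicit Defensive.
Import Order.TTheory GRing.Theory Num.Theory.
Import numFieldNormedType.Exports.
Local Open Scope classical_set_scope.
Local Open Scope ring_scope.

(* Vectors are rows, so an endomorphism with matrix [J] sends [v] to [v *m J],
   and ['d f x v = v *m jacobian f x]. *)

Definition partial (R : realType) n (W : normedModType R) (a : 'I_n)
    (f : 'rV[R]_n -> W) : 'rV[R]_n -> W :=
  fun x => 'D_(delta_mx 0 a) f x.

(* C^oo on the open set [U]: every iterated partial derivative exists and is
   differentiable at every point of [U]. *)
Definition smooth_on (R : realType) n (W : normedModType R)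
    (U : set 'rV[R]_n) (f : 'rV[R]_n -> W) : Prop :=
  forall (s : seq 'I_n) x, U x ->
    differentiable (foldr (fun a h => partial a h) f s) x.

(* The orientation is carried by the atlas: all transition maps preserve the
   standard orientation of R^n. The values of [chart i] outside of [dom i] and
   of [chart_inv i] outside of [chart i @` dom i] are irrelevant. *)
Record oriented_manifold (R : realType) (n : nat) := OrientedManifold {
  carrier :> topologicalType;
  carrier_hausdorff : hausdorff_space carrier;
  carrier_second_countable : @second_countable carrier;
  chart_index : Type;
  dom : chart_index -> set carrier;
  chart : chart_index -> carrier -> 'rV[R]_n;
  chart_inv : chart_index -> 'rV[R]_n -> carrier;
  dom_open : forall i, open (dom i);
  image_open : forall i, open (chart i @` dom i);
  chartK : forall i p, dom i p -> chart_inv i (chart i p) = p;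
  chart_continuous : forall i, {within dom i, continuous (chart i)};
  chart_inv_continuous :
    forall i, {within chart i @` dom i, continuous (chart_inv i)};
  dom_cover : forall p, exists i, dom i p;
  transition_smooth : forall i j,
    smooth_on (chart i @` (dom i `&` dom j)) (chart j \o chart_inv i);
  transition_oriented : forall i j x, (chart i @` (dom i `&` dom j)) x ->
    0 < \det (jacobian (chart j \o chart_inv i) x) }.

Section OnManifold.
Context (R : realType) (n : nat) (M : oriented_manifold R n).

Definition chart_image (i : chart_index M) : set 'rV[R]_n :=
  chart i @` dom i.

Definition chart_overlap (i j : chart_index M) : set 'rV[R]_n :=
  chart i @` (dom i `&` dom j).

Definition transition (i j : chart_index M) : 'rV[R]_n -> 'rV[R]_n :=
  chart j \o chart_inv i.

(* Tensor fields are given by their components in each chart, as functions of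
   the coordinates, subject to the transformation law on chart overlaps. *)

Record riemannian_metric := RiemannianMetric {
  metric :> chart_index M -> 'rV[R]_n -> 'M[R]_n;
  metric_smooth : forall i, smooth_on (chart_image i) (metric i);
  metric_sym : forall i x, chart_image i x -> (metric i x)^T = metric i x;
  metric_posdef : forall i x (v : 'rV[R]_n), chart_image i x -> v != 0 ->
    0 < (v *m metric i x *m v^T) 0 0;
  metric_transition : forall i j x, chart_overlap i j x ->
    metric i x = jacobian (transition i j) x *m metric j (transition i j x)
                   *m (jacobian (transition i j) x)^T }.

Record almost_complex_structure := AlmostComplexStructure {
  acs :> chart_index M -> 'rV[R]_n -> 'M[R]_n;
  acs_smooth : forall i, smooth_on (chart_image i) (acs i);
  acs_square : forall i x, chart_image i x -> acs i x *m acs i x = - 1%:M;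
  acs_transition : forall i j x, chart_overlap i j x ->
    acs i x *m jacobian (transition i j) x =
    jacobian (transition i j) x *m acs j (transition i j x) }.

Definition metric_compatible (g : riemannian_metric)
    (J : almost_complex_structure) : Prop :=
  forall i x (v w : 'rV[R]_n), chart_image i x ->
    ((v *m J i x) *m g i x *m (w *m J i x)^T) 0 0 = (v *m g i x *m w^T) 0 0.

End OnManifold.

Section Nijenhuis.
Context (R : realType) (n : nat).
Implicit Types (X Y : 'rV[R]_n -> 'rV[R]_n) (J : 'rV[R]_n -> 'M[R]_n).

Definition lie_bracket X Y : 'rV[R]_n -> 'rV[R]_n :=
  fun x => 'D_(X x) Y x - 'D_(Y x) X x.

Definition apply_end J X : 'rV[R]_n -> 'rV[R]_n := fun x => X x *m J x.

Definition nijenhuis J X Y : 'rV[R]_n -> 'rV[R]_n := fun x =>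
  lie_bracket X Y x
  + (lie_bracket (apply_end J X) Y x + lie_bracket X (apply_end J Y) x) *m J x
  - lie_bracket (apply_end J X) (apply_end J Y) x.

End Nijenhuis.

Definition nijenhuis_vanishes (R : realType) n (M : oriented_manifold R n)
    (J : almost_complex_structure M) : Prop :=
  forall i (X Y : 'rV[R]_n -> 'rV[R]_n),
    smooth_on (chart_image i) X -> smooth_on (chart_image i) Y ->
    forall x, chart_image i x -> nijenhuis (J i) X Y x = 0.

Section Curvature.
Context (R : realType) (n : nat) (g : 'rV[R]_n -> 'M[R]_n).
Implicit Types (x : 'rV[R]_n) (a b c d e : 'I_n).

Definition ginv x : 'M[R]_n := invmx (g x).

(* [christoffel c a b] is Gamma^c_{ab}. *)
Definition christoffel c a b x : R :=
  2^-1 * \sum_d ginv x c d *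
    (partial a (fun y => g y d b) x + partial b (fun y => g y d a) x
     - partial d (fun y => g y a b) x).

(* [riemann a b c d] is R^a_{bcd}, with
   (nabla_c nabla_d - nabla_d nabla_c) X^a = R^a_{bcd} X^b. *)
Definition riemann a b c d x : R :=
  partial c (christoffel a d b) x - partial d (christoffel a c b) x
  + \sum_e (christoffel a c e x * christoffel e d b x
            - christoffel a d e x * christoffel e c b x).

Definition riemann_low a b c d x : R := \sum_e g x a e * riemann e b c d x.

Definition ricci a b x : R := \sum_c riemann c a c b x.

Definition scalar_curvature x : R := \sum_a \sum_b ginv x a b * ricci a b x.

End Curvature.

Section Dimension4.
Context (R : realType) (g : 'rV[R]_4 -> 'M[R]_4).
Implicit Types (x : 'rV[R]_4) (a b c d e f : 'I_4) (u v w t : 'rV[R[i]]_4).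

Definition schouten a b x : R :=
  2^-1 * ricci g a b x - 12^-1 * scalar_curvature g x * g x a b.

Definition weyl a b c d x : R :=
  riemann_low g a b c d x
  + g x a d * schouten c b x - g x a c * schouten d b x
  + g x b c * schouten d a x - g x b d * schouten c a x.

(* [nabla_schouten b c a] is nabla_b P_{ca}. *)
Definition nabla_schouten b c a x : R :=
  partial b (schouten c a) x
  - \sum_e christoffel g e b c x * schouten e a x
  - \sum_e christoffel g e b a x * schouten c e x.

Definition cotton a b c x : R := nabla_schouten b c a x - nabla_schouten c b a x.

Definition levi_civita a b c d : R :=
  \det (\matrix_(r < 4, s < 4) (tnth [tuple a; b; c; d] r == s)%:R).

Definition volume_form a b c d x : R :=
  Num.sqrt (\det (g x)) * levi_civita a b c d.

(* [hodge a b c d] is (1/2) eps^{ab}_{cd}. *)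
Definition hodge a b c d x : R :=
  2^-1 * \sum_e \sum_f ginv g x a e * ginv g x b f * volume_form e f c d x.

Definition wedge u v : 'M[R[i]]_4 := u^T *m v - v^T *m u.

Definition star x (B : 'M[R[i]]_4) : 'M[R[i]]_4 :=
  \matrix_(a, b) \sum_c \sum_d (hodge a b c d x)%:C%C * B c d.

Definition selfdual_plane x (P : set 'rV[R[i]]_4) : Prop :=
  forall n1 n2, P n1 -> P n2 -> star x (wedge n1 n2) = wedge n1 n2.

(* The projection of the Weyl tensor to its selfdual part in the first pair of
   indices; it is then selfdual in the second pair too. *)
Definition weyl_selfdual a b c d x : R :=
  2^-1 * (weyl a b c d x + \sum_e \sum_f weyl e f c d x * hodge e f a b x).

Definition cmetric x u v : R[i] :=
  (u *m map_mx (real_complex R) (g x) *m v^T) 0 0.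

Definition ccotton x u v w : R[i] :=
  \sum_a \sum_b \sum_c (cotton a b c x)%:C%C * u 0 a * v 0 b * w 0 c.

Definition cweyl x u v w t : R[i] :=
  \sum_a \sum_b \sum_c \sum_d
    (weyl a b c d x)%:C%C * u 0 a * v 0 b * w 0 c * t 0 d.

Definition null_frame x (m p n k : 'rV[R[i]]_4) : Prop :=
  [/\ cmetric x m p = 1 & cmetric x n k = 1] /\
  [/\ cmetric x m m = 0, cmetric x p p = 0,
      cmetric x n n = 0 & cmetric x k k = 0] /\
  [/\ cmetric x m n = 0, cmetric x m k = 0,
      cmetric x p n = 0 & cmetric x p k = 0].

Definition span2 u v : set 'rV[R[i]]_4 :=
  [set w | exists s t : R[i], w = s *: u + t *: v].

Definition Psi0 x (m p n k : 'rV[R[i]]_4) := cweyl x m k m k.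
Definition Psi1 x (m p n k : 'rV[R[i]]_4) := cweyl x m k n k.
Definition Psi2 x (m p n k : 'rV[R[i]]_4) := cweyl x m k p n.
Definition Psi3 x (m p n k : 'rV[R[i]]_4) := cweyl x p n m p.
Definition Psi4 x (m p n k : 'rV[R[i]]_4) := cweyl x p n p n.

Definition weyl_quartic x (m p n k : 'rV[R[i]]_4) : {poly R[i]} :=
  Psi4 x m p n k *: 'X^4 - (4 * Psi3 x m p n k) *: 'X^3
  + (6 * Psi2 x m p n k) *: 'X^2 + (4 * Psi1 x m p n k) *: 'X
  + (Psi0 x m p n k)%:P.

(* [None] is the point at infinity. *)
Definition selfdual_null_plane (m p n k : 'rV[R[i]]_4) (z : option R[i]) :
    set 'rV[R[i]]_4 :=
  if z is Some z then span2 (m + z *: n) (k - z *: p) else span2 n p.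

(* A quartic of actual degree d has infinity as a root of multiplicity 4 - d. *)
Definition quartic_multiple_root (q : {poly R[i]}) (z : option R[i]) : Prop :=
  if z is Some z then ('X - z%:P) ^+ 2 %| q else (size q <= 3)%N.

(* The notion does not depend on the choice of the null frame. *)
Definition multiple_principal_plane x (P : set 'rV[R[i]]_4) : Prop :=
  exists (m p n k : 'rV[R[i]]_4) (z : option R[i]),
    [/\ null_frame x m p n k, selfdual_plane x (span2 m k),
        P = selfdual_null_plane m p n k z &
        quartic_multiple_root (weyl_quartic x m p n k) z].

Definition weyl_algebraically_special x : Prop :=
  exists P : set 'rV[R[i]]_4, multiple_principal_plane x P.

End Dimension4.

Section Hypotheses.
Context (R : realType) (M : oriented_manifold R 4).
Context (g : riemannian_metric M) (J : almost_complex_structure M).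

Definition holomorphic_distribution (i : chart_index M) (x : 'rV[R]_4) :
    set 'rV[R[i]]_4 :=
  [set v | v *m map_mx (real_complex R) (J i x) = 'i%C *: v].

Definition holomorphic_selfdual : Prop :=
  forall i x, chart_image i x ->
    selfdual_plane (g i) x (holomorphic_distribution i x).

Definition weyl_selfdual_nonvanishing : Prop :=
  forall i x, chart_image i x ->
    exists a b c d, weyl_selfdual (g i) a b c d x != 0.

Definition cotton_degenerate : Prop :=
  forall i x, chart_image i x ->
    forall Z1 Z2 Z3, holomorphic_distribution i x Z1 ->
      holomorphic_distribution i x Z2 -> holomorphic_distribution i x Z3 ->
      ccotton (g i) x Z1 Z2 Z3 = 0.

Definition weyl_special_along_holomorphic : Prop :=
  forall i x, chart_image i x ->
    weyl_algebraically_special (g i) x /\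
    multiple_principal_plane (g i) x (holomorphic_distribution i x).

End Hypotheses.

(* Main.v *)
From HB Require Import structures.
Require Import Defs.
From mathcomp Require Import all_boot all_order all_algebra.
From mathcomp Require Import all_classical all_reals all_analysis.
From mathcomp Require Import perm complex ring lra.

(** Near each point there is a null frame m = v - i Jv, k = w - i Jw, p ~ conj m,
    n ~ conj k with v, w real and span(m, k) = N. Put s(X) = g(nabla_X m, k); then
    J is integrable iff s(m) = s(k) = 0, which amounts to [m, k] lying in N. The
    Bianchi identity gives, when Psi0 = 0,
      A(m, m, k) = m(Psi1) + c Psi1 - 3 s(m) Psi2,
      A(k, m, k) = k(Psi1) + c' Psi1 - 3 s(k) Psi2
    for some functions c, c'. If Psi0 = Psi1 = 0, then Psi2 <> 0, since Psi3 and
    Psi4 are conjugate to Psi1 and Psi0 up to factors and the selfdual Weyl tensor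
    does not vanish; so A vanishes on N iff s(m) = s(k) = 0. If s(m) = s(k) = 0,
    then Psi0 = C(m, k, m, k) = 0 directly from the definition of the curvature;
    if moreover A vanishes on N, then m(Psi1) = - c Psi1 and k(Psi1) = - c' Psi1,
    and evaluating [m, k] on Psi1 yields 10 Psi1^2 = 0.

    The identities are proved over a commutative ring K with commuting
    derivations, and applied to the complex-valued smooth functions on an open
    set of a chart, so that complex vector fields are rows over K. *)

Set Implicit Arguments.
Unset Strict Implicit.
Unset Printing Implicit Defensive.
Import Order.TTheory GRing.Theory Num.Theory.
Import numFieldNormedType.Exports.
Local Open Scope classical_set_scope.
Local Open Scope ring_scope.

(** * Levi-Civita calculus *)

(** The frame starts from the coordinate vector e_0 and needs a second one, e_a, outside the span of
    e_0 and J e_0; the index a can change from point to point. The argument therefore runs on a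
    small open set on which one a works, which is harmless since the hypotheses and conclusions are
    local. A single point would be too small: the Bianchi identity differentiates Psi1, so A = 0,
    Psi0 = Psi1 = 0 and s(m) = s(k) = 0 enter as equations between functions. Conversely, K has zero
    divisors, so the division by Psi2 and the conclusion from 10 Psi1^2 = 0 take place after
    evaluation at a point, in the complex numbers. Over K itself one divides only by nowhere
    vanishing functions: 2, 12, det g, g(v, v) and g(w, w). Linear algebra over K avoids dimension
    counts: a null frame is used through the explicit expansion X = g(X, p) m + g(X, m) p + g(X, k)
    n + g(X, n) k, and tensor identities become polynomial identities between components. *)

Record sym_form (K : comNzRingType) (V : lmodType K) := SymForm {
  form :> V -> V -> K;
  formC : forall X Y, form X Y = form Y X;
  formDl : forall X Y Z, form (X + Y) Z = form X Z + form Y Z;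
  formZl : forall a X Z, form (a *: X) Z = a * form X Z }.

Section SymForm.
Context (K : comNzRingType) (V : lmodType K) (g : sym_form V).
Implicit Types (X Y Z : V) (a : K).

Lemma formNl X Z : g (- X) Z = - g X Z.
Proof. by rewrite -scaleN1r formZl mulN1r. Qed.

Lemma form0l Z : g 0 Z = 0.
Proof. by have := formZl g 0 0 Z; rewrite scale0r mul0r. Qed.

Lemma formDr X Y Z : g Z (X + Y) = g Z X + g Z Y.
Proof. by rewrite formC formDl !(formC _ _ Z). Qed.

Lemma formZr a X Z : g Z (a *: X) = a * g Z X.
Proof. by rewrite formC formZl (formC _ _ Z). Qed.

Lemma formNr X Z : g Z (- X) = - g Z X.
Proof. by rewrite formC formNl (formC _ _ Z). Qed.
End SymForm.

(* [V] plays the role of the vector fields over the ring [K] of functions. The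
   connection is torsion-free because the Lie bracket is taken to be
   [nab X Y - nab Y X]; that it acts on functions as a commutator and satisfies
   the Jacobi identity is all that is left of the bracket. *)
Record levi_civita_calculus (K : comNzRingType) (V : lmodType K) := LeviCivita {
  act : V -> K -> K;
  nab : V -> V -> V;
  gm : sym_form V;
  double_eq0 : forall a : K, a + a = 0 -> a = 0;
  actDl : forall X Y f, act (X + Y) f = act X f + act Y f;
  actZl : forall a X f, act (a *: X) f = a * act X f;
  actD : forall X f h, act X (f + h) = act X f + act X h;
  actM : forall X f h, act X (f * h) = act X f * h + f * act X h;
  nabDl : forall X Y Z, nab (X + Y) Z = nab X Z + nab Y Z;
  nabZl : forall a X Z, nab (a *: X) Z = a *: nab X Z;
  nabDr : forall X Y Z, nab X (Y + Z) = nab X Y + nab X Z;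
  nabZr : forall X a Z, nab X (a *: Z) = act X a *: Z + a *: nab X Z;
  act_gm : forall X Y Z, act X (gm Y Z) = gm (nab X Y) Z + gm Y (nab X Z);
  act_lie : forall X Y f,
    act (nab X Y - nab Y X) f = act X (act Y f) - act Y (act X f);
  lie_jacobi : forall X Y Z,
    let lie U W := nab U W - nab W U in
    lie X (lie Y Z) + lie Y (lie Z X) + lie Z (lie X Y) = 0 }.

Section Calculus.
Context (K : comNzRingType) (V : lmodType K) (L : levi_civita_calculus V).
Implicit Types (X Y Z U A B : V) (a f h : K).
Local Notation "X ∙ f" := (act L X f) (at level 35, right associativity).
Local Notation "∇" := (nab L).
Local Notation g := (gm L).

Definition lie X Y := ∇ X Y - ∇ Y X.

Lemma actNl X f : (- X) ∙ f = - (X ∙ f).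
Proof. by rewrite -scaleN1r actZl mulN1r. Qed.

Lemma act0 X : X ∙ 0 = 0.
Proof. by apply: (addrI (X ∙ 0)); rewrite -actD !addr0. Qed.

Lemma actN X f : X ∙ (- f) = - (X ∙ f).
Proof. by apply: (addrI (X ∙ f)); rewrite -actD !subrr act0. Qed.

Lemma nabNl X Z : ∇ (- X) Z = - ∇ X Z.
Proof. by rewrite -scaleN1r nabZl scaleN1r. Qed.

Lemma act1 X : X ∙ 1 = 0.
Proof. by apply: (addrI (X ∙ 1)); rewrite -{3}(mul1r 1) actM mulr1 mul1r addr0. Qed.

Lemma nab0l Z : ∇ 0 Z = 0.
Proof. by have := nabZl L 0 0 Z; rewrite !scale0r. Qed.

Lemma nab0r X : ∇ X 0 = 0.
Proof. by apply: (addrI (∇ X 0)); rewrite -nabDr !addr0. Qed.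

Lemma nabNr X Z : ∇ X (- Z) = - ∇ X Z.
Proof. by apply: (addrI (∇ X Z)); rewrite -nabDr !subrr nab0r. Qed.

Definition curv X Y Z := ∇ X (∇ Y Z) - ∇ Y (∇ X Z) - ∇ (lie X Y) Z.

Definition riem A B X Y := g (curv X Y B) A.

(** Lets [ring] finish modulo a known equation c = d: it is enough that a - b and c - d are the same
    polynomial. *)
Lemma eq_of_subr_eq (R : zmodType) (a b c d : R) : c = d -> a - b = c - d -> a = b.
Proof. by move=> -> /eqP; rewrite subrr subr_eq0 => /eqP. Qed.

Definition linE := (actDl, actNl, actZl, actD, actN, actM, nabDl, nabNl, nabZl,
  nabDr, nabNr, nabZr, formDl, formNl, formZl, formDr, formNr, formZr).

Lemma riemDl A A' B X Y : riem (A + A') B X Y = riem A B X Y + riem A' B X Y.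
Proof. exact: formDr. Qed.

Lemma riemZl a A B X Y : riem (a *: A) B X Y = a * riem A B X Y.
Proof. exact: formZr. Qed.

Lemma riem_anti A B X Y : riem A B Y X = - riem A B X Y.
Proof. rewrite /riem /curv /lie !linE; ring. Qed.

(** The bracket of X and Y acts on the function g(A, B) as a commutator; expanding both sides by
    metric compatibility leaves the two curvature terms. *)
Lemma riem_antil A B X Y : riem B A X Y = - riem A B X Y.
Proof.
have := act_lie L X Y (g A B); rewrite !act_gm !actD !act_gm => h.
apply: (eq_of_subr_eq (esym h)); rewrite /riem /curv /lie !linE.
rewrite !(formC g A (∇ _ _)); ring.
Qed.

Lemma riemDr A B B' X Y : riem A (B + B') X Y = riem A B X Y + riem A B' X Y.
Proof. by rewrite riem_antil riemDl opprD -!riem_antil. Qed.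

Lemma riemZr a A B X Y : riem A (a *: B) X Y = a * riem A B X Y.
Proof. by rewrite riem_antil riemZl -mulrN -riem_antil. Qed.

Lemma riemD3 A B X X' Y : riem A B (X + X') Y = riem A B X Y + riem A B X' Y.
Proof. rewrite /riem /curv /lie !linE; ring. Qed.

Lemma riemZ3 a A B X Y : riem A B (a *: X) Y = a * riem A B X Y.
Proof. rewrite /riem /curv /lie !linE; ring. Qed.

Lemma riemD4 A B X Y Y' : riem A B X (Y + Y') = riem A B X Y + riem A B X Y'.
Proof. by rewrite riem_anti riemD3 opprD -!riem_anti. Qed.

Lemma riemZ4 a A B X Y : riem A B X (a *: Y) = a * riem A B X Y.
Proof. by rewrite riem_anti riemZ3 -mulrN -riem_anti. Qed.

(** The Jacobi identity paired with A, the brackets being expanded in covariant derivatives. *)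
Lemma riem_bianchi1 A X Y Z : riem A X Y Z + riem A Y Z X + riem A Z X Y = 0.
Proof.
have /(congr1 (fun W => g W A)) := lie_jacobi L X Y Z; rewrite form0l => h.
apply: (eq_of_subr_eq h); rewrite /riem /curv /lie !linE; ring.
Qed.

(** The octahedron argument: the first Bianchi identity with each of the four vectors in first
    place, combined with signs, leaves twice the difference of the two sides. *)
Lemma riem_pair A B X Y :
  riem A B X Y = riem X Y A B.
Proof.
apply/eqP; rewrite -subr_eq0; apply/eqP/(double_eq0 L).
have h1 := riem_bianchi1 A B X Y; have h2 := riem_bianchi1 B X Y A.
have h3 := riem_bianchi1 X Y A B; have h4 := riem_bianchi1 Y A B X.
have e1 : riem X A B Y = riem A X Y B by rewrite riem_antil riem_anti opprK.
have e2 : riem Y B X A = riem B Y A X by rewrite riem_antil riem_anti opprK.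
rewrite (riem_antil B X Y A) e1 in h3; rewrite (riem_antil A Y B X) e2 in h4.
rewrite (riem_antil A B X Y) in h2; rewrite (riem_antil X Y A B) in h4.
have h : riem A B X Y + riem A X Y B + riem A Y B X
  - (riem B X Y A + riem B Y A X - riem A B X Y)
  - (riem X Y A B + riem A X Y B - riem B X Y A)
  + (- riem A Y B X + riem B Y A X - riem X Y A B) = 0.
  by rewrite h1 h2 h3 h4; ring.
by apply: (eq_of_subr_eq h); ring.
Qed.

Definition nab_riem U A B X Y := U ∙ riem A B X Y - riem (∇ U A) B X Y
  - riem A (∇ U B) X Y - riem A B (∇ U X) Y - riem A B X (∇ U Y).

(** Commutators of covariant derivatives satisfy the Jacobi identity by themselves; the brackets
    contribute the derivative of B along the Jacobi sum of U, X, Y, which is zero. *)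
Lemma riem_bianchi2 U X Y A B :
  nab_riem U A B X Y + nab_riem X A B Y U + nab_riem Y A B U X = 0.
Proof.
have /(congr1 (fun W => g (∇ W B) A)) := lie_jacobi L U X Y.
rewrite nab0l form0l => h.
apply: (eq_of_subr_eq (esym h)); rewrite /nab_riem /riem !act_gm /curv /lie !linE; ring.
Qed.

Record null_basis m p n k : Prop := NullBasis {
  nb_mp : g m p = 1; nb_nk : g n k = 1;
  nb_mm : g m m = 0; nb_pp : g p p = 0; nb_nn : g n n = 0; nb_kk : g k k = 0;
  nb_mn : g m n = 0; nb_mk : g m k = 0; nb_pn : g p n = 0; nb_pk : g p k = 0;
  nb_decomp : forall X, X = g X p *: m + g X m *: p + g X k *: n + g X n *: k }.

Lemma null_basis_swap m p n k : null_basis m p n k -> null_basis k n p m.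
Proof.
case=> h1 h2 h3 h4 h5 h6 h7 h8 h9 h10 h; split=> //; try by rewrite formC.
by move=> X; rewrite {1}[X]h (ACl (4*3*2*1)).
Qed.

End Calculus.

(** * Traceless curvature tensors in a null frame *)

(** Abstract because it has two instances: the Weyl tensor over the ring of functions, [weylK], and
    its value at a point, [cweyl_tensor]. *)
Record curvature_tensor (K : comNzRingType) (V : lmodType K) := CurvatureTensor {
  ct :> V -> V -> V -> V -> K;
  ctDl : forall A A' B X Y, ct (A + A') B X Y = ct A B X Y + ct A' B X Y;
  ctZl : forall a A B X Y, ct (a *: A) B X Y = a * ct A B X Y;
  ct_antil : forall A B X Y, ct B A X Y = - ct A B X Y;
  ct_anti : forall A B X Y, ct A B Y X = - ct A B X Y;
  ct_pair : forall A B X Y, ct A B X Y = ct X Y A B;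
  ct_bianchi1 : forall A X Y Z, ct A X Y Z + ct A Y Z X + ct A Z X Y = 0 }.

Definition ct_traceless (K : comNzRingType) (V : lmodType K)
    (W : curvature_tensor V) m p n k :=
  forall X Y, W m X p Y + W p X m Y + W n X k Y + W k X n Y = 0.

Section CurvatureTensor.
Context (K : comNzRingType) (V : lmodType K) (W : curvature_tensor V).
Hypothesis dbl0 : forall a : K, a + a = 0 -> a = 0.
Implicit Types (X Y Z A B : V) (a b z : K).

Lemma ctD2 A B B' X Y : W A (B + B') X Y = W A B X Y + W A B' X Y.
Proof. by rewrite ct_antil ctDl opprD -!ct_antil. Qed.

Lemma ctZ2 a A B X Y : W A (a *: B) X Y = a * W A B X Y.
Proof. by rewrite ct_antil ctZl -mulrN -ct_antil. Qed.

Lemma ctD3 A B X X' Y : W A B (X + X') Y = W A B X Y + W A B X' Y.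
Proof. by rewrite ct_pair ctDl -!(ct_pair W A B). Qed.

Lemma ctZ3 a A B X Y : W A B (a *: X) Y = a * W A B X Y.
Proof. by rewrite ct_pair ctZl -(ct_pair W A B). Qed.

Lemma ctD4 A B X Y Y' : W A B X (Y + Y') = W A B X Y + W A B X Y'.
Proof. by rewrite ct_pair ctD2 -!(ct_pair W A B). Qed.

Lemma ctZ4 a A B X Y : W A B X (a *: Y) = a * W A B X Y.
Proof. by rewrite ct_pair ctZ2 -(ct_pair W A B). Qed.

Definition ctE := (ctDl, ctZl, ctD2, ctZ2, ctD3, ctZ3, ctD4, ctZ4).

Lemma ct_self A X Y : W A A X Y = 0.
Proof. by apply: dbl0; rewrite {1}ct_antil addNr. Qed.

Lemma ct_self2 A X Y : W X Y A A = 0.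
Proof. by rewrite ct_pair ct_self. Qed.

Lemma ct_traceless_swap m p n k : ct_traceless W m p n k -> ct_traceless W k n p m.
Proof. by move=> tr X Y; rewrite -(tr X Y); ring. Qed.

Lemma ct_traceless_dual m p n k : ct_traceless W m p n k -> ct_traceless W p m k n.
Proof. by move=> tr X Y; rewrite -(tr X Y); ring. Qed.

Section Frame.
Context (m p n k : V).
Hypothesis tr : ct_traceless W m p n k.
Local Notation wP := (ct_pair W).
Local Notation wr := (ct_anti W).
Local Notation wl := (ct_antil W).

(** Tracelessness makes W vanish between the selfdual bivectors m∧k, p∧n, n∧k - m∧p and the
    antiselfdual ones m∧n, p∧k, n∧k + m∧p; most lemmas of this section are instances. The exception
    is [ct_knmp], which uses the first Bianchi identity too and says W(n∧k, n∧k - m∧p) = 2 Psi2. *)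
Lemma ct_pkmk : W p k m k = 0.
Proof.
apply: dbl0; have := tr k k.
by rewrite !ct_self !ct_self2 (wP m k) !addr0.
Qed.

Lemma ct_nmmk : W n m m k = 0.
Proof.
apply: dbl0; have := tr m m.
rewrite !ct_self !ct_self2 !add0r (wr n m m k) (wP k m) (wr n m m k) => h.
by apply: (eq_of_subr_eq (esym h)); ring.
Qed.

Lemma ct_mkpm : W m k p m = W m k n k.
Proof.
have := tr k m; rewrite !ct_self !ct_self2 (wP n k) (wl m k) => h.
by apply: (eq_of_subr_eq h); ring.
Qed.

Lemma ct_nmmp : W n m m p = W n m n k.
Proof.
have := tr m n; rewrite !ct_self !ct_self2 (wr n m n k) (wP p m) => h.
rewrite (wl n m) (wr n m m p) in h.
by apply: (eq_of_subr_eq h); ring.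
Qed.

Lemma ct_knmp : W k n m p = 2 * W m k p n - W n k n k.
Proof.
have h := tr n k; have h' := ct_bianchi1 W m p n k.
rewrite !ct_self (wP p n) (wl n k n k) in h.
rewrite (wr m n p k) in h'.
have e : W m n p k + W m k p n + 0 + - W n k n k
  + (W m p n k - W m n p k + W m k p n) = 0 by rewrite h h' add0r.
rewrite (wP k n) (wr m p n k).
by apply: (eq_of_subr_eq (esym e)); ring.
Qed.

Lemma ct_mkmn : W m k m n = 0.
Proof. by rewrite wP (wl n m m k) ct_nmmk oppr0. Qed.

Lemma ct_mkpk : W m k p k = 0.
Proof. by rewrite wP ct_pkmk. Qed.
End Frame.

Section Quartic.
Context (m p n k : V).
Hypothesis tr : ct_traceless W m p n k.
Local Notation wP := (ct_pair W).
Local Notation wr := (ct_anti W).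
Local Notation wl := (ct_antil W).

Let mkmp : W m k m p = - W m k n k.
Proof. by rewrite wr (ct_mkpm tr). Qed.
Let mknp : W m k n p = - W m k p n. Proof. exact: wr. Qed.
Let mpmk : W m p m k = - W m k n k. Proof. by rewrite wP mkmp. Qed.
Let npmk : W n p m k = - W m k p n. Proof. by rewrite wP mknp. Qed.
Let nkmk : W n k m k = W m k n k. Proof. by rewrite wP. Qed.
Let mpnk : W m p n k = W n k n k - 2 * W m k p n.
Proof. by rewrite wP wl (ct_knmp tr); ring. Qed.
Let nkmp : W n k m p = W n k n k - 2 * W m k p n.
Proof. by rewrite wP mpnk. Qed.
Let mpmp : W m p m p = W n k n k.
Proof.
have := ct_knmp (ct_traceless_swap tr); rewrite (wP m p k n) (ct_knmp tr).
rewrite (wl m k) (wr m k p n) (wl m p p m) (wr m p m p) => h.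
by apply: (eq_of_subr_eq h); ring.
Qed.
Let mpnp : W m p n p = - W p n m p. Proof. by rewrite wP wl. Qed.
Let npmp : W n p m p = - W p n m p. Proof. exact: wl. Qed.
Let npnk : W n p n k = W p n m p.
Proof. by rewrite wl wr opprK (ct_mkpm (ct_traceless_dual tr)). Qed.
Let nknp : W n k n p = W p n m p. Proof. by rewrite wP npnk. Qed.
Let npnp : W n p n p = W p n p n. Proof. by rewrite wl wr opprK. Qed.

(** The bivector of the plane N_z is m∧k + z (n∧k - m∧p) + z^2 p∧n. The 6 is 2 + 4: twice W(m∧k,
    p∧n), plus W(n∧k - m∧p, n∧k - m∧p) = 4 Psi2. *)
Lemma ct_quartic z :
  W (m + z *: n) (k - z *: p) (m + z *: n) (k - z *: p) =
  W p n p n * z ^+ 4 - 4 * W p n m p * z ^+ 3 + 6 * W m k p n * z ^+ 2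
  + 4 * W m k n k * z + W m k m k.
Proof.
rewrite -!scaleNr !ctE mkmp mknp mpmk npmk nkmk mpnk nkmp mpmp mpnp npmp npnk nknp npnp.
ring.
Qed.

(** A quarter of the z-derivative of the quartic is Psi1 of the frame shifted by z, so a multiple
    root z means Psi0 = Psi1 = 0 in that frame. *)
Lemma ct_quartic_deriv z :
  W (m + z *: n) (k - z *: p) n (k - z *: p) =
  W p n p n * z ^+ 3 - 3 * W p n m p * z ^+ 2 + 3 * W m k p n * z + W m k n k.
Proof.
rewrite -!scaleNr !ctE mknp mpnk mpnp npnk nknp npnp; ring.
Qed.
End Quartic.

Section Principal.
Context (m p n k : V).
Hypothesis tr : ct_traceless W m p n k.
Hypotheses (psi0 : W m k m k = 0) (psi1 : W m k n k = 0).

(** One argument ranges over all vectors, the other three over span(m, k): this makes the condition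
    Psi0 = Psi1 = 0 one on the plane, independent of the frame. *)
Lemma ct_principal (a b c d x1 x2 x3 x4 e f : K) :
  W (a *: m + b *: k) (c *: m + d *: k)
    (x1 *: m + x2 *: p + x3 *: n + x4 *: k) (e *: m + f *: k) = 0.
Proof.
rewrite !ctDl !ctZl !ctD2 !ctZ2 !ct_self (ct_antil W m k) !ctD3 !ctZ3 !ctD4 !ctZ4.
rewrite !ct_self2 (ct_anti W m k m k) (ct_mkpm tr) psi0 psi1 (ct_mkpk tr).
rewrite (ct_anti W m k m n) (ct_mkmn tr); ring.
Qed.
End Principal.

Section SelfdualPart.
Context (m p n k : V).
Hypothesis tr : ct_traceless W m p n k.
Hypothesis span : forall Z, exists a b c d,
  Z = a *: m + b *: p + c *: n + d *: k.
Hypotheses (psi0 : W m k m k = 0) (psi1 : W m k n k = 0) (psi2 : W m k p n = 0).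
Hypotheses (psi3 : W p n m p = 0) (psi4 : W p n p n = 0).
Local Notation wP := (ct_pair W).
Local Notation wr := (ct_anti W).
Local Notation wl := (ct_antil W).
Let trd := ct_traceless_dual tr.
Let trs := ct_traceless_swap tr.

Let ct_dec A B (Z T : V) : W A B m k = 0 -> W A B m p = 0 -> W A B m n = 0 ->
  W A B p k = 0 -> W A B p n = 0 -> W A B n k = 0 -> W A B Z T = 0.
Proof.
move=> h1 h2 h3 h4 h5 h6.
have [a [b [c [d ->]]]] := span Z; have [a' [b' [c' [d' ->]]]] := span T.
rewrite !(ctD3, ctZ3, ctD4, ctZ4) !ct_self2 (wr _ _ m k) (wr _ _ m p) (wr _ _ m n).
rewrite (wr _ _ p k) (wr _ _ p n) (wr _ _ n k) h1 h2 h3 h4 h5 h6; ring.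
Qed.

Lemma ct_mk_eq0 Z T : W m k Z T = 0.
Proof.
apply: ct_dec => //.
- by rewrite wr (ct_mkpm tr) psi1 oppr0.
- exact: ct_mkmn tr.
- exact: ct_mkpk tr.
Qed.

Lemma ct_pn_eq0 Z T : W p n Z T = 0.
Proof.
apply: ct_dec => //.
- by rewrite wP.
- by rewrite (ct_mkpk trd).
- by rewrite (ct_mkmn trd).
- by rewrite wr -(ct_mkpm trd) psi3 oppr0.
Qed.

(** Together with [ct_mk_eq0] and [ct_pn_eq0] this puts the whole space of selfdual bivectors into
    the kernel of W. *)
Lemma ct_nk_mp Z T : W n k Z T = W m p Z T.
Proof.
have [a [b [c [d ->]]]] := span Z; have [a' [b' [c' [d' ->]]]] := span T.
have e0 A B : W A B m k = 0 by rewrite wP ct_mk_eq0.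
have e1 A B : W A B p n = 0 by rewrite wP ct_pn_eq0.
have kn : W k n m p = - W n k n k by rewrite (ct_knmp tr) psi2 mulr0 sub0r.
have e2 : W n k m p = W n k n k by rewrite wl kn opprK.
have e3 : W m p n k = W n k n k by rewrite wP e2.
have e4 : W m p m p = W n k n k.
  have := ct_knmp trs; rewrite (wP m p k n) kn (wl m k) (wr m k p n) psi2.
  by rewrite (wl m p p m) (wr m p m p) !opprK mulr0 sub0r => /oppr_inj.
have e5 : W n k m n = W m p m n.
  by rewrite (wP n k) (wP m p) (wl n m n k) (wl n m m p) (ct_nmmp tr).
have e6 : W n k p k = W m p p k.
  have := ct_nmmp trs; rewrite (wr p k n k) (wr p k m p) (wP p k n k) (wP p k m p).
  by move=> /oppr_inj.
rewrite !(ctD3, ctZ3, ctD4, ctZ4) !ct_self2.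
rewrite !(wr _ _ m k) !(wr _ _ m p) !(wr _ _ m n).
rewrite !(wr _ _ p k) !(wr _ _ p n) !(wr _ _ n k) !e0 !e1 e2 e3 e4 e5 e6; ring.
Qed.
End SelfdualPart.
End CurvatureTensor.

(** * Traceless curvature tensors with vanishing selfdual components are antiselfdual *)

Section SelfdualWeyl.
Context (K : comNzRingType) (V : lmodType K) (W : curvature_tensor V).
Hypothesis dbl0 : forall a : K, a + a = 0 -> a = 0.
Context (E : V -> V -> V -> V -> K).
Hypothesis ED : forall A B X Y Y', E A B X (Y + Y') = E A B X Y + E A B X Y'.
Hypothesis EZ : forall a A B X Y, E A B X (a *: Y) = a * E A B X Y.
Hypothesis E12 : forall A B X Y, E B A X Y = - E A B X Y.
Hypothesis E23 : forall A B X Y, E A X B Y = - E A B X Y.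
Hypothesis E34 : forall A B X Y, E A B Y X = - E A B X Y.
Context (m p n k : V) (s : K).
Hypothesis tr : ct_traceless W m p n k.
Hypothesis span : forall Z, exists a b c d,
  Z = a *: m + b *: p + c *: n + d *: k.

(* [E] plays the role of the volume form, and [alt_contract A B F] is
   E^{ef}_{ab} A^a B^b F_{ef} with indices raised in the null frame. *)
Definition alt_contract A B (F : V -> V -> K) :=
  E p m A B * F m p + E m p A B * F p m + E p k A B * F m n + E k p A B * F n m
  + E p n A B * F m k + E n p A B * F k m + E m k A B * F p n + E k m A B * F n p
  + E m n A B * F p k + E n m A B * F k p + E k n A B * F n k + E n k A B * F k n.

Let ED3 A B X X' Y : E A B (X + X') Y = E A B X Y + E A B X' Y.
Proof. by rewrite E34 ED opprD -!E34. Qed.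
Let EZ3 a A B X Y : E A B (a *: X) Y = a * E A B X Y.
Proof. by rewrite E34 EZ -mulrN -E34. Qed.
Let E0_34 A B X : E A B X X = 0. Proof. by apply: dbl0; rewrite {1}E34 addNr. Qed.
Let E0_23 A B X : E A X X B = 0. Proof. by apply: dbl0; rewrite {1}E23 addNr. Qed.
Let E0_24 A B X : E A X B X = 0. Proof. by rewrite E34 E0_23 oppr0. Qed.
Let E0_13 A B X : E X A X B = 0. Proof. by rewrite E12 E0_23 oppr0. Qed.
Let E0_14 A B X : E X A B X = 0. Proof. by rewrite E12 E0_24 oppr0. Qed.

Lemma alt_contract_mk F : (forall A B, F B A = - F A B) ->
  alt_contract m k F = 2 * E p n m k * F m k.
Proof.
move=> Fa; rewrite /alt_contract !(E0_13, E0_14, E0_23, E0_24).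
rewrite (E12 p n) (Fa m k); ring.
Qed.

Lemma alt_contract_antisym A B (F : V -> V -> K) :
  alt_contract A B (fun X Y => F X Y - F Y X) = 2 * alt_contract A B F.
Proof.
rewrite /alt_contract (E12 p m) (E12 p k) (E12 p n) (E12 m k) (E12 m n) (E12 k n); ring.
Qed.

Lemma alt_contractZ A B a (F : V -> V -> K) :
  alt_contract A B (fun X Y => a * F X Y) = a * alt_contract A B F.
Proof. rewrite /alt_contract; ring. Qed.

Lemma alt_contractDr A B B' (F : V -> V -> K) :
  alt_contract A (B + B') F = alt_contract A B F + alt_contract A B' F.
Proof. rewrite /alt_contract !ED; ring. Qed.

Lemma alt_contractZr a A B (F : V -> V -> K) :
  alt_contract A (a *: B) F = a * alt_contract A B F.
Proof. rewrite /alt_contract !EZ; ring. Qed.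

Lemma alt_contractDl A A' B (F : V -> V -> K) :
  alt_contract (A + A') B F = alt_contract A B F + alt_contract A' B F.
Proof. rewrite /alt_contract !ED3; ring. Qed.

Lemma alt_contractZl a A B (F : V -> V -> K) :
  alt_contract (a *: A) B F = a * alt_contract A B F.
Proof. rewrite /alt_contract !EZ3; ring. Qed.

Hypothesis psi0 : W m k m k = 0.
Hypothesis psi1 : W m k n k = 0.
Hypothesis psi2 : W m k p n = 0.
Hypothesis psi3 : W p n m p = 0.
Hypothesis psi4 : W p n p n = 0.
Hypothesis sE : s * E p n m k = 1.

(** The star operator acts as -1 on W in its first pair. Modulo the selfdual bivectors, which W
    kills, a bivector is a combination of m∧p, m∧n and p∧k, and each of these is checked against
    E. *)
Lemma alt_contract_antiselfdual X Y Z T :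
  2 * W X Y Z T + s * alt_contract X Y (fun A B => W A B Z T) = 0.
Proof.
have mk0 := ct_mk_eq0 dbl0 tr span psi0 psi1 psi2.
have pn0 := ct_pn_eq0 dbl0 tr span psi2 psi3 psi4.
have nk := ct_nk_mp dbl0 tr span psi0 psi1 psi2 psi3 psi4.
have e1 : E p m n k = - E p n m k by rewrite E23.
have e2 : E p k m n = - E p n m k by rewrite E34 E23 E34 opprK.
have e3 : E m n p k = - E p n m k by rewrite E23 E12 E23 opprK.
have e4 : E k n m p = - E p n m k.
  by rewrite E34 E23 E12 E34 E23 E34 !opprK.
have e5 : E p n m k * s = 1 by rewrite mulrC.
have Ws A B : W B A Z T = - W A B Z T := ct_antil W A B Z T.
rewrite /alt_contract (E12 p m) (E12 p k) (E12 p n) (E12 m k) (E12 m n) (E12 k n).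
have [a [b [c [d ->]]]] := span X; have [a' [b' [c' [d' ->]]]] := span Y.
rewrite !(ctDl, ctZl, ctD2, ctZ2, ct_self _ dbl0).
rewrite !(ED, EZ, ED3, EZ3, E0_34, E0_13, E0_14, E0_23, E0_24).
rewrite (Ws m p) (Ws m n) (Ws m k) (Ws p n) (Ws p k) (Ws n k) !nk !mk0 !pn0.
rewrite (E34 p m k n) (E34 p k n m) (E34 m n k p) (E34 k n p m) !(E34 p n k m).
rewrite (E34 p m n k) ?e1 (E34 p k m n) ?e2 (E34 m n p k) ?e3 (E34 k n m p) ?e4.
rewrite !opprK; move: (W m p Z T) (W m n Z T) (W p k Z T) => x y z.
(* [ring] cannot use [sE], so the sum is displayed as a multiple of 1 - s E(p, n, m, k). *)
transitivity ((1 - s * E p n m k) * (2 * ((a * b' - b * a' + c * d' - d * c') * x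
  + (a * c' - c * a') * y + (b * d' - d * b') * z))); first by ring.
by rewrite sE subrr mul0r.
Qed.
End SelfdualWeyl.

(** * Weyl and Cotton tensors *)

Section Weyl.
Context (K : comNzRingType) (V : lmodType K) (L : levi_civita_calculus V).
Context (P : sym_form V).
Implicit Types (X Y Z U A B : V) (a f h : K).
Local Notation "X ∙ f" := (act L X f) (at level 35, right associativity).
Local Notation "∇" := (nab L).
Local Notation g := (gm L).
Local Notation riem := (riem L).
Local Notation nab_riem := (nab_riem L).
(** [P] is any symmetric form here: the curvature symmetries follow from those of [riem], and the
    choice of the Schouten tensor enters later, as tracelessness. *)
Definition weyl_fun A B X Y := riem A B X Y
  + g A Y * P X B - g A X * P Y B + g B X * P Y A - g B Y * P X A.

Definition nabP U X Y := U ∙ P X Y - P (∇ U X) Y - P X (∇ U Y).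

Definition cottonK X Y Z := nabP Y Z X - nabP Z Y X.

Lemma nabP_Dl U U' X Y : nabP (U + U') X Y = nabP U X Y + nabP U' X Y.
Proof. rewrite /nabP !linE; ring. Qed.
Lemma nabP_Zl f U X Y : nabP (f *: U) X Y = f * nabP U X Y.
Proof. rewrite /nabP !linE; ring. Qed.
Lemma nabP_D2 U X X' Y : nabP U (X + X') Y = nabP U X Y + nabP U X' Y.
Proof. rewrite /nabP !linE; ring. Qed.
Lemma nabP_Z2 f U X Y : nabP U (f *: X) Y = f * nabP U X Y.
Proof. rewrite /nabP !linE; ring. Qed.
Lemma nabP_C U X Y : nabP U X Y = nabP U Y X.
Proof. by rewrite /nabP (formC P X Y) (formC P (∇ U X)) (formC P X) addrAC. Qed.

Lemma weyl_anti A B X Y : weyl_fun A B Y X = - weyl_fun A B X Y.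
Proof. rewrite /weyl_fun riem_anti; ring. Qed.

Lemma weyl_antil A B X Y : weyl_fun B A X Y = - weyl_fun A B X Y.
Proof. rewrite /weyl_fun riem_antil; ring. Qed.

Lemma weyl_pair A B X Y : weyl_fun A B X Y = weyl_fun X Y A B.
Proof.
rewrite /weyl_fun riem_pair (formC P X B) (formC P Y B) (formC P Y A) (formC P X A).
rewrite (formC g A Y) (formC g A X) (formC g B X) (formC g B Y); ring.
Qed.

Lemma weyl_bianchi1 A X Y Z : weyl_fun A X Y Z + weyl_fun A Y Z X + weyl_fun A Z X Y = 0.
Proof.
have h := riem_bianchi1 L A X Y Z; apply: (eq_of_subr_eq h); rewrite /weyl_fun.
rewrite (formC P Z X) (formC P Y X) (formC P Z Y) (formC g Z X) (formC g Z Y) (formC g Y X); ring.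
Qed.

Lemma weylDl A A' B X Y : weyl_fun (A + A') B X Y = weyl_fun A B X Y + weyl_fun A' B X Y.
Proof. rewrite /weyl_fun riemDl !formDl !formDr; ring. Qed.

Lemma weylZl a A B X Y : weyl_fun (a *: A) B X Y = a * weyl_fun A B X Y.
Proof. rewrite /weyl_fun riemZl !formZl !formZr; ring. Qed.

Definition weylK : curvature_tensor V := CurvatureTensor weylDl weylZl
  weyl_antil weyl_anti weyl_pair weyl_bianchi1.

Lemma weylKE A B X Y : weylK A B X Y = riem A B X Y
  + g A Y * P X B - g A X * P Y B + g B X * P Y A - g B Y * P X A.
Proof. by []. Qed.

Definition nab_weyl U A B X Y := U ∙ weylK A B X Y - weylK (∇ U A) B X Y
  - weylK A (∇ U B) X Y - weylK A B (∇ U X) Y - weylK A B X (∇ U Y).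

(** The metric is parallel, so only [P] is differentiated in the trace terms; this is how the Cotton
    tensor appears in the Bianchi identity. *)
Lemma nab_weylE U A B X Y : nab_weyl U A B X Y = nab_riem U A B X Y
  + g A Y * nabP U X B - g A X * nabP U Y B + g B X * nabP U Y A
  - g B Y * nabP U X A.
Proof. rewrite /nab_weyl /nab_riem /nabP !weylKE !linE !act_gm; ring. Qed.


Lemma nabP_D3 U X Y Y' : nabP U X (Y + Y') = nabP U X Y + nabP U X Y'.
Proof. by rewrite nabP_C nabP_D2 !(nabP_C U X). Qed.
Lemma nabP_Z3 f U X Y : nabP U X (f *: Y) = f * nabP U X Y.
Proof. by rewrite nabP_C nabP_Z2 (nabP_C U X). Qed.

(** Antisymmetry in the last two arguments produces the determinant. On N the Cotton tensor is thus
    given by A(m, m, k) and A(k, m, k). *)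
Lemma cottonK_span (a b c d e f : K) (m k : V) :
  cottonK (a *: m + b *: k) (c *: m + d *: k) (e *: m + f *: k) =
  (c * f - d * e) * (a * cottonK m m k + b * cottonK k m k).
Proof.
rewrite /cottonK !(nabP_Dl, nabP_Zl, nabP_D2, nabP_Z2, nabP_D3, nabP_Z3).
rewrite (nabP_C m k m) (nabP_C k k m); ring.
Qed.
End Weyl.

(** * The Goldberg-Sachs identities *)

Section Frame.
Context (K : comNzRingType) (V : lmodType K) (L : levi_civita_calculus V).
Context (P : sym_form V).
Implicit Types (X Y Z U A B : V) (a f h : K).
Local Notation "X ∙ f" := (act L X f) (at level 35, right associativity).
Local Notation "∇" := (nab L).
Local Notation g := (gm L).
Local Notation weylK := (weylK L P).
Context (m p n k : V).
Hypothesis fr : null_basis L m p n k.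
Hypothesis tr : ct_traceless weylK m p n k.

Local Notation wP := (ct_pair weylK).
Local Notation wr := (ct_anti weylK).

Let dbl0 := double_eq0 L.

Lemma weyl_dec1 X A B Y : weylK X A B Y =
  g X p * weylK m A B Y + g X m * weylK p A B Y
  + g X k * weylK n A B Y + g X n * weylK k A B Y.
Proof. by rewrite {1}(nb_decomp fr X) !ctE. Qed.

Lemma weyl_dec2 A X B Y : weylK A X B Y =
  g X p * weylK A m B Y + g X m * weylK A p B Y
  + g X k * weylK A n B Y + g X n * weylK A k B Y.
Proof. by rewrite {1}(nb_decomp fr X) !ctE. Qed.

Lemma weyl_dec3 A B X Y : weylK A B X Y =
  g X p * weylK A B m Y + g X m * weylK A B p Y
  + g X k * weylK A B n Y + g X n * weylK A B k Y.
Proof. by rewrite {1}(nb_decomp fr X) !ctE. Qed.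

Lemma weyl_dec4 A B Y X : weylK A B Y X =
  g X p * weylK A B Y m + g X m * weylK A B Y p
  + g X k * weylK A B Y n + g X n * weylK A B Y k.
Proof. by rewrite {1}(nb_decomp fr X) !ctE. Qed.

Lemma skew_nab U A B : U ∙ g A B = 0 -> g (∇ U A) B = - g (∇ U B) A.
Proof. by rewrite act_gm => /eqP; rewrite addr_eq0 (formC g A) => /eqP. Qed.

Lemma skew_nab0 U A : g A A = 0 -> g (∇ U A) A = 0.
Proof.
move=> h; apply: (double_eq0 L).
by rewrite {1}skew_nab ?addNr // h act0.
Qed.

(* The second Bianchi identity in the directions (m, k, n), evaluated on (m, k):
   the trace terms in which Weyl and Riemann tensors differ add up to -A(m, m, k). *)
Lemma cotton_mmk : weylK m k m k = 0 ->
  cottonK L P m m k = m ∙ weylK m k n k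
    + (4 * g (∇ n m) k - (g (∇ m m) p + g (∇ m k) n)) * weylK m k n k
    - 3 * g (∇ m m) k * weylK m k p n.
Proof.
move=> psi0; have h := riem_bianchi2 L m k n m k.
have e1 := nab_weylE L P m m k k n; have e2 := nab_weylE L P k m k n m.
have e3 := nab_weylE L P n m k m k.
have [h1 h2 h3 h4 h5 h6 h7 h8 h9 h10 _] := fr.
rewrite (formC g k n) h2 h7 h8 h6 in e1; rewrite h3 h7 (formC g k n) h2 (formC g k m) h8 in e2.
rewrite h3 h6 h8 (formC g k m) h8 in e3.
have e : cottonK L P m m k = - (nab_weyl L P m m k k n + nab_weyl L P k m k n m
  + nab_weyl L P n m k m k).
  rewrite e1 e2 e3 /cottonK; apply: (eq_of_subr_eq h); ring.
rewrite {}e /nab_weyl.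
rewrite !(weyl_dec1 (∇ _ _)) !(weyl_dec2 _ (∇ _ _)) !(weyl_dec3 _ _ (∇ _ _)).
rewrite !(weyl_dec4 _ _ _ (∇ _ _)).
rewrite !(ct_self _ dbl0) !(ct_self2 _ dbl0) psi0.
have s0 A B U c : g A B = c -> (U ∙ c = 0) -> g (∇ U A) B = - g (∇ U B) A.
  by move=> gc c0; rewrite skew_nab // gc.
have h8' : g k m = 0 by rewrite formC.
have h7' : g n m = 0 by rewrite formC.
rewrite !(skew_nab0 _ h3) !(skew_nab0 _ h6) !(s0 k m _ 0) ?act0 //.
rewrite !(s0 n k _ 1) ?act1 // !(s0 n m _ 0) ?act0 //.
(* The components left by the expansion: tracelessness turns them into Psi1, Psi2 and terms that
   cancel in [ring]. *)
have nul : weylK m k m n = 0 := ct_mkmn dbl0 tr.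
have z1 : weylK m k m p = - weylK m k n k by rewrite wr (ct_mkpm dbl0 tr).
have z2 : weylK m k p k = 0 by rewrite wP (ct_pkmk dbl0 tr).
have z3 : weylK m k n m = 0 by rewrite wr nul oppr0.
have z4 : weylK m p n m = weylK n k n m by rewrite wP (ct_nmmp dbl0 tr) wP.
have z5 : weylK m p k n = 2 * weylK m k p n - weylK n k n k.
  by rewrite wP (ct_knmp dbl0 tr).
rewrite (wP n k m k) (wP m n m k) (wP m p m k) (wP p k m k) nul z4 z5.
rewrite (wr m k n k) (wr m k m k) (wr m k p k) (wr m k p n) (wr n k n k).
rewrite psi0 z3 (ct_mkpm dbl0 tr) z1 z2 !act0 !actN; ring.
Qed.

End Frame.

Section GoldbergSachs.
Context (K : comNzRingType) (V : lmodType K) (L : levi_civita_calculus V).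
Context (P : sym_form V).
Implicit Types (X Y Z U A B : V) (a f h : K).
Local Notation "X ∙ f" := (act L X f) (at level 35, right associativity).
Local Notation "∇" := (nab L).
Local Notation g := (gm L).
Local Notation riem := (riem L).
Local Notation weylK := (weylK L P).
Context (m p n k : V).
Hypothesis fr : null_basis L m p n k.
Hypothesis tr : ct_traceless weylK m p n k.

Local Notation wP := (ct_pair weylK).
Local Notation wr := (ct_anti weylK).
Local Notation wl := (ct_antil weylK).


(* (k, n, p, m) is again a null frame, so this is [cotton_mmk] for that frame. *)
Lemma cotton_kmk : weylK m k m k = 0 ->
  cottonK L P k m k = k ∙ weylK m k n k
    - (4 * g (∇ p m) k + (g (∇ k m) p + g (∇ k k) n)) * weylK m k n k
    - 3 * g (∇ k m) k * weylK m k p n.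
Proof.
move=> psi0; have fr' := null_basis_swap fr.
have tr' : ct_traceless weylK k n p m.
  by move=> X Y; rewrite -(tr X Y); ring.
have := cotton_mmk fr' tr'.
rewrite (wl m k k m) (wr m k m k) psi0 !oppr0 => /(_ erefl) h.
have [_ _ h3 _ _ h6 _ h8 _ _ _] := fr.
have s U : g (∇ U k) m = - g (∇ U m) k.
  by rewrite (skew_nab (A := k)) // formC h8 act0.
have e : cottonK L P k m k = - cottonK L P k k m by rewrite /cottonK; ring.
rewrite e h (wl m k) (wl m k n p) (wr m k p n) (ct_mkpm (double_eq0 L) tr) !s actN; ring.
Qed.

Lemma form_dec X Y : g X Y = g X p * g m Y + g X m * g p Y
  + g X k * g n Y + g X n * g k Y.
Proof. by rewrite {1}(nb_decomp fr X) !formDl !formZl. Qed.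

Lemma nab_decl X A B : g (∇ X A) B = g X p * g (∇ m A) B + g X m * g (∇ p A) B
  + g X k * g (∇ n A) B + g X n * g (∇ k A) B.
Proof. by rewrite {1}(nb_decomp fr X) !nabDl !nabZl !formDl !formZl. Qed.

Lemma form_nab X Y Z : g (∇ X Y) Z = X ∙ g Y Z - g Y (∇ X Z).
Proof. by rewrite act_gm addrK. Qed.

Hypothesis sm : g (∇ m m) k = 0.
Hypothesis sk : g (∇ k m) k = 0.

Let skew_mk U : g (∇ U k) m = - g (∇ U m) k.
Proof. by have [? ? ? ? ? ? ? h8 *] := fr; rewrite skew_nab // formC h8 act0. Qed.

Let skew_pm U : g (∇ U p) m = - g (∇ U m) p.
Proof. by have [h *] := fr; rewrite skew_nab // formC h act1. Qed.

Let skew_nk U : g (∇ U n) k = - g (∇ U k) n.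
Proof. by have [? h *] := fr; rewrite skew_nab // h act1. Qed.

Let skew_nm U : g (∇ U n) m = - g (∇ U m) n.
Proof. by have [? ? ? ? ? ? h *] := fr; rewrite skew_nab // formC h act0. Qed.

Let skew_pk U : g (∇ U p) k = - g (∇ U k) p.
Proof. by have [? ? ? ? ? ? ? ? ? h _] := fr; rewrite skew_nab // h act0. Qed.

Let skew_pn U : g (∇ U n) p = - g (∇ U p) n.
Proof. by have [? ? ? ? ? ? ? ? h ? _] := fr; rewrite skew_nab // formC h act0. Qed.

Let self_mm U : g (∇ U m) m = 0.
Proof. by case: fr => *; rewrite skew_nab0. Qed.
Let self_pp U : g (∇ U p) p = 0.
Proof. by case: fr => *; rewrite skew_nab0. Qed.
Let self_nn U : g (∇ U n) n = 0.
Proof. by case: fr => *; rewrite skew_nab0. Qed.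
Let self_kk U : g (∇ U k) k = 0.
Proof. by case: fr => *; rewrite skew_nab0. Qed.

Let skews := (self_mm, self_pp, self_nn, self_kk, skew_mk, skew_pm, skew_nk,
  skew_nm, skew_pk, skew_pn).

(** The Newman-Penrose form of the curvature: g(∇_X ∇_Y B, A) = X g(∇_Y B, A) - g(∇_Y B, ∇_X A)
    removes second covariant derivatives, and expansion in the frame leaves only the connection
    coefficients and their derivatives. *)
Let riem_dec A B X Y : riem A B X Y = X ∙ g (∇ Y B) A - Y ∙ g (∇ X B) A
  - (g (∇ Y B) p * g (∇ X A) m + g (∇ Y B) m * g (∇ X A) p
     + g (∇ Y B) k * g (∇ X A) n + g (∇ Y B) n * g (∇ X A) k)
  + (g (∇ X B) p * g (∇ Y A) m + g (∇ X B) m * g (∇ Y A) p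
     + g (∇ X B) k * g (∇ Y A) n + g (∇ X B) n * g (∇ Y A) k)
  - (g (∇ X Y) p * g (∇ m B) A + g (∇ X Y) m * g (∇ p B) A
     + g (∇ X Y) k * g (∇ n B) A + g (∇ X Y) n * g (∇ k B) A)
  + (g (∇ Y X) p * g (∇ m B) A + g (∇ Y X) m * g (∇ p B) A
     + g (∇ Y X) k * g (∇ n B) A + g (∇ Y X) n * g (∇ k B) A).
Proof.
rewrite -[riem A B X Y]/(g (curv L X Y B) A) /curv /lie !(nabDl, nabNl, formDl, formNl).
rewrite (form_nab X (∇ Y B)) (form_nab Y (∇ X B)).
rewrite (form_dec (∇ Y B) (∇ X A)) (form_dec (∇ X B) (∇ Y A)).
rewrite (nab_decl (∇ X Y)) (nab_decl (∇ Y X)).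
rewrite !(formC g _ (∇ _ A)) !opprD !opprK !addrA; ring.
Qed.

(** The trace terms carry g(m, m), g(m, k) or g(k, k). Every term of [riem_dec] is a derivative or a
    multiple of a coefficient g(∇_U A, B) with A and B among m, k, and these vanish: by skewness if
    A = B, by [sm] and [sk] otherwise. *)
Lemma weyl_mkmk_eq0 : weylK m k m k = 0.
Proof.
have [h1 h2 h3 h4 h5 h6 h7 h8 h9 h10 _] := fr.
rewrite weylKE riem_dec !skews (formC g k m) h3 h6 h8.
rewrite sm sk !oppr0 !act0; ring.
Qed.

(* The two Cotton components prescribe the derivatives of Psi1 along m and k;
   applying [m, k] to Psi1 gives a compatibility condition, in which the
   curvature enters as 10 Psi1. *)
Lemma weyl_mknk_sqr_eq0 : cottonK L P m m k = 0 -> cottonK L P k m k = 0 ->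
  10 * weylK m k n k ^+ 2 = 0.
Proof.
have psi0 := weyl_mkmk_eq0.
rewrite (cotton_mmk fr tr psi0) (cotton_kmk psi0) sm sk => em ek.
set x := weylK m k n k in em ek *.
set y := weylK m k p n in em ek.
pose a := g (∇ m m) p + g (∇ m k) n - 4 * g (∇ n m) k.
pose b := g (∇ k m) p + g (∇ k k) n + 4 * g (∇ p m) k.
have dm : m ∙ x = a * x by apply: (eq_of_subr_eq em); rewrite /a; ring.
have dk : k ∙ x = b * x by apply: (eq_of_subr_eq ek); rewrite /b; ring.
have lie_mk : lie L m k = (g (∇ m k) p - g (∇ k m) p) *: m
  + (g (∇ m k) n - g (∇ k m) n) *: k.
  rewrite [LHS](nb_decomp fr) /lie !formDl !formNl !skews sm sk.
  by rewrite !oppr0 !addr0 !scale0r !addr0.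
have := act_lie L m k x; rewrite -/(lie L m k) lie_mk actDl !actZl dm dk !actM dm dk => h.
have curvb : m ∙ b - k ∙ a - (g (∇ m k) p - g (∇ k m) p) * a
  - (g (∇ m k) n - g (∇ k m) n) * b = 10 * x.
  rewrite /a /b !actD !actN !actM.
  (* The first two components form the curvature along (m, k) of the connection induced on Λ²N; the
     other two supply the derivatives of 4 g(∇_p m, k) and 4 g(∇_n m, k). Each equals Psi1 up to a
     term P(m, k) of alternating sign, so the Schouten terms cancel and 10 = 1 + 1 + 4 (1 + 1). *)
  have S : riem p m m k + riem n k m k + 4 * (riem k m m p + riem k m k n) = 10 * x.
    have [h1 h2 h3 h4 h5 h6 h7 h8 h9 h10 _] := fr.
    have w1 : weylK p m m k = x by rewrite wP (ct_mkpm (double_eq0 L) tr).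
    have w2 : weylK n k m k = x by rewrite wP.
    have w3 : weylK k m m p = x by rewrite wl wr opprK (ct_mkpm (double_eq0 L) tr).
    have w4 : weylK k m k n = x by rewrite wl wr opprK.
    have -> : 10 * x = weylK p m m k + weylK n k m k
      + 4 * (weylK k m m p + weylK k m k n) by rewrite w1 w2 w3 w4; ring.
    rewrite !weylKE (formC g p m) (formC g k p) (formC g n m) (formC g k m) (formC g k n).
    rewrite h1 h2 h3 h6 h7 h8 h10 (formC P m k); ring.
  have a4 X : X ∙ 4 = 0 by rewrite !actD !act1 !addr0.
  apply: (eq_of_subr_eq S); rewrite !riem_dec !skews !sm !sk !oppr0 !act0 !a4.
  ring.
have {}h : (m ∙ b - k ∙ a - (g (∇ m k) p - g (∇ k m) p) * a
  - (g (∇ m k) n - g (∇ k m) n) * b) * x = 0.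
  by apply: (eq_of_subr_eq (esym h)); ring.
by rewrite -h curvb; ring.
Qed.
End GoldbergSachs.

(** * The Levi-Civita calculus of a coordinate chart *)

Record derivations (K : comNzRingType) n := Derivations {
  der :> 'I_n -> K -> K;
  derD : forall a f h, der a (f + h) = der a f + der a h;
  derM : forall a f h, der a (f * h) = der a f * h + f * der a h;
  der_comm : forall a b f, der a (der b f) = der b (der a f) }.

Section Coordinates.
Context (K : comNzRingType) (n : nat) (D : derivations K n).
Context (G Gi : 'M[K]_n) (half : K).
Hypothesis G_sym : G^T = G.
Hypothesis GGi : G *m Gi = 1%:M.
Hypothesis halfD : half + half = 1.
Local Notation V := 'rV[K]_n.
Implicit Types (X Y Z U : V) (f h : K) (a b c d e : 'I_n).

Lemma der0 a : D a 0 = 0.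
Proof. by apply: (addrI (D a 0)); rewrite -derD !addr0. Qed.

Lemma der1 a : D a 1 = 0.
Proof. by apply: (addrI (D a 1)); rewrite -{3}(mul1r 1) derM mulr1 mul1r addr0. Qed.

Lemma der_nat a (m : nat) : D a m%:R = 0.
Proof. by elim: m => [|m IH]; rewrite ?der0 // -natr1 derD IH der1 addr0. Qed.

Definition cact X f := \sum_a X 0 a * D a f.

Lemma cactDl X Y f : cact (X + Y) f = cact X f + cact Y f.
Proof. by rewrite -big_split; apply: eq_bigr => a _; rewrite mxE mulrDl. Qed.

Lemma cactZl r X f : cact (r *: X) f = r * cact X f.
Proof. by rewrite mulr_sumr; apply: eq_bigr => a _; rewrite mxE mulrA. Qed.

Lemma cactD X f h : cact X (f + h) = cact X f + cact X h.
Proof. by rewrite -big_split; apply: eq_bigr => a _; rewrite derD mulrDr. Qed.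

Lemma cactM X f h : cact X (f * h) = cact X f * h + f * cact X h.
Proof.
rewrite mulr_suml mulr_sumr -big_split; apply: eq_bigr => a _.
rewrite derM /=; ring.
Qed.

Lemma cact0 X : cact X 0 = 0.
Proof. by rewrite /cact big1 // => a _; rewrite der0 mulr0. Qed.

Lemma cactN X f : cact X (- f) = - cact X f.
Proof. by apply: (addrI (cact X f)); rewrite -cactD !subrr cact0. Qed.

Lemma cact_sum X (I : finType) (F : I -> K) :
  cact X (\sum_i F i) = \sum_i cact X (F i).
Proof. by apply: (big_morph _ (cactD X) (cact0 X)). Qed.

Definition mact X p q (A : 'M[K]_(p, q)) := map_mx (cact X) A.

Lemma mactM X p q r (A : 'M[K]_(p, q)) (B : 'M[K]_(q, r)) :
  mact X (A *m B) = mact X A *m B + A *m mact X B.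
Proof.
apply/matrixP => i j; rewrite !mxE cact_sum -big_split.
by apply: eq_bigr => l _; rewrite cactM !mxE.
Qed.

Definition christoffelK c a b := half * \sum_d Gi c d *
  (D a (G d b) + D b (G d a) - D d (G a b)).
Local Notation Γ := christoffelK.

Lemma G_symE a b : G a b = G b a.
Proof. by rewrite -{1}G_sym mxE. Qed.

Lemma christoffelK_sym c a b : Γ c a b = Γ c b a.
Proof.
congr (_ * _); apply: eq_bigr => d _.
by rewrite (G_symE a b) [D a _ + _]addrC.
Qed.

Lemma christoffelK_low e a b : \sum_c G e c * Γ c a b =
  half * (D a (G e b) + D b (G e a) - D e (G a b)).
Proof.
under eq_bigr do rewrite mulrCA mulr_sumr.
rewrite -mulr_sumr exchange_big /=; congr (_ * _).
under eq_bigr => d _ do under eq_bigr => c _ do rewrite mulrA.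
under eq_bigr => d _ do rewrite -mulr_suml.
have e1 d : \sum_c G e c * Gi c d = (e == d)%:R.
  by have /matrixP/(_ e d) := GGi; rewrite !mxE => ->.
under eq_bigr => d _ do rewrite e1.
rewrite (bigD1 e) //= eqxx mul1r big1 ?addr0 // => d /negPf.
by rewrite eq_sym => ->; rewrite mul0r.
Qed.

Definition connection X : 'M[K]_n := \matrix_(b, c) \sum_a X 0 a * Γ c a b.

(** The metric is parallel: adding the lowered Christoffel symbols to their transpose cancels two of
    the three derivatives of G and doubles the third. *)
Lemma connection_metric X :
  mact X G = connection X *m G + G *m (connection X)^T.
Proof.
apply/matrixP => a b.
have e i j : (connection X *m G) i j = \sum_c X 0 c *
    (half * (D c (G j i) + D i (G j c) - D j (G c i))).
  rewrite mxE; under eq_bigr do rewrite mxE mulr_suml.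
  rewrite exchange_big /=; apply: eq_bigr => c _.
  rewrite -christoffelK_low mulr_sumr; apply: eq_bigr => d _.
  rewrite (G_symE d j); ring.
have -> : G *m (connection X)^T = (connection X *m G)^T by rewrite trmx_mul G_sym.
rewrite mxE [RHS]mxE [(_^T) _ _]mxE !e -big_split; apply: eq_bigr => c _ /=.
rewrite -mulrDr (G_symE b a) (G_symE b c) (G_symE a c).
congr (_ * _); rewrite -[LHS]mul1r -halfD; ring.
Qed.

Definition cnab X Y : V := mact X Y + Y *m connection X.

Lemma connectionD X Y : connection (X + Y) = connection X + connection Y.
Proof.
apply/matrixP => i j; rewrite !mxE -big_split; apply: eq_bigr => a _.
by rewrite mxE mulrDl.
Qed.

Lemma connectionZ r X : connection (r *: X) = r *: connection X.
Proof.
apply/matrixP => i j; rewrite !mxE mulr_sumr; apply: eq_bigr => a _.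
by rewrite mxE mulrA.
Qed.

Lemma connectionC X Y : Y *m connection X = X *m connection Y.
Proof.
apply/matrixP => i c; rewrite (ord1 i) !mxE.
under eq_bigr do rewrite mxE mulr_sumr.
under [RHS]eq_bigr do rewrite mxE mulr_sumr.
rewrite exchange_big; apply: eq_bigr => a _; apply: eq_bigr => b _.
by rewrite christoffelK_sym mulrCA.
Qed.

Lemma cnabDl X Y Z : cnab (X + Y) Z = cnab X Z + cnab Y Z.
Proof.
rewrite /cnab connectionD mulmxDr addrACA; congr (_ + _).
by apply/matrixP => i j; rewrite !mxE cactDl.
Qed.

Lemma cnabZl r X Z : cnab (r *: X) Z = r *: cnab X Z.
Proof.
rewrite /cnab connectionZ scalerDr -scalemxAr; congr (_ + _).
by apply/matrixP => i j; rewrite !mxE cactZl.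
Qed.

Lemma cnabDr X Y Z : cnab X (Y + Z) = cnab X Y + cnab X Z.
Proof.
rewrite /cnab mulmxDl addrACA; congr (_ + _).
by apply/matrixP => i j; rewrite !mxE cactD.
Qed.

Lemma cnabZr X r Z : cnab X (r *: Z) = cact X r *: Z + r *: cnab X Z.
Proof.
rewrite /cnab -scalemxAl scalerDr addrA; congr (_ + _).
by apply/matrixP => i j; rewrite !mxE cactM.
Qed.

Definition gram (S : 'M[K]_n) X Y := (X *m S *m Y^T) 0 0.

Lemma gramC (S : 'M[K]_n) : S^T = S -> forall X Y, gram S X Y = gram S Y X.
Proof.
move=> Ss X Y; have -> : gram S X Y = (X *m S *m Y^T)^T 0 0 by rewrite [RHS]mxE.
by rewrite !trmx_mul trmxK Ss mulmxA.
Qed.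

Lemma gramDl S X Y Z : gram S (X + Y) Z = gram S X Z + gram S Y Z.
Proof. by rewrite /gram !mulmxDl mxE. Qed.

Lemma gramZl S r X Z : gram S (r *: X) Z = r * gram S X Z.
Proof. by rewrite /gram -!scalemxAl mxE. Qed.

Definition gram_form S (Ss : S^T = S) : sym_form V :=
  SymForm (gramC Ss) (gramDl S) (gramZl S).

Lemma cact_gram X Y Z :
  cact X (gram G Y Z) = gram G (cnab X Y) Z + gram G Y (cnab X Z).
Proof.
have -> : cact X (gram G Y Z) = mact X (Y *m G *m Z^T) 0 0 by rewrite [RHS]mxE.
have -> : gram G (cnab X Y) Z + gram G Y (cnab X Z) =
  (cnab X Y *m G *m Z^T + Y *m G *m (cnab X Z)^T) 0 0 by rewrite [RHS]mxE.
congr (fun_of_matrix _ 0 0); rewrite !mactM connection_metric /cnab.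
rewrite [(_ + _)^T]linearD /= trmx_mul /mact map_trmx !mulmxDl !mulmxDr.
rewrite !mulmxDl !mulmxA !addrA -!addrA; do 2 congr (_ + _); exact: addrC.
Qed.

Lemma cnab_lie X Y : cnab X Y - cnab Y X = mact X Y - mact Y X.
Proof. by rewrite /cnab (connectionC X Y) opprD addrACA subrr addr0. Qed.

Lemma cact_lie X Y f :
  cact (cnab X Y - cnab Y X) f = cact X (cact Y f) - cact Y (cact X f).
Proof.
rewrite cnab_lie /cact; under eq_bigr do rewrite !mxE mulrBl.
rewrite big_split sumrN /= -!/(cact _ _).
have e U W : cact U (cact W f) =
    \sum_i cact U (W 0 i) * D i f + \sum_i \sum_a W 0 i * (U 0 a * D a (D i f)).
  rewrite cact_sum -big_split; apply: eq_bigr => i _ /=.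
  by rewrite cactM mulr_sumr.
rewrite !e opprD addrACA; have -> : \sum_i \sum_a Y 0 i * (X 0 a * D a (D i f)) =
  \sum_i \sum_a X 0 i * (Y 0 a * D a (D i f)).
  rewrite exchange_big; apply: eq_bigr => a _; apply: eq_bigr => i _.
  by rewrite mulrCA der_comm.
by rewrite subrr addr0.
Qed.

Lemma lieE X Y c : (cnab X Y - cnab Y X) 0 c = cact X (Y 0 c) - cact Y (X 0 c).
Proof. by rewrite cnab_lie !mxE. Qed.

Lemma cnab_jacobi X Y Z : let lie U W := cnab U W - cnab W U in
  lie X (lie Y Z) + lie Y (lie Z X) + lie Z (lie X Y) = 0.
Proof.
move=> lie; apply/rowP => c.
have e U W T : lie U (lie W T) 0 c = cact U (cact W (T 0 c))
    - cact U (cact T (W 0 c)) - (cact W (cact T (U 0 c)) - cact T (cact W (U 0 c))).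
  by rewrite /lie lieE cact_lie lieE cactD cactN.
have addE (U W T : V) : (U + W + T) 0 c = U 0 c + W 0 c + T 0 c by rewrite !mxE.
rewrite [RHS]/= [RHS]mxE; apply: etrans (addE _ _ _) _.
apply: etrans (f_equal2 +%R (f_equal2 +%R (e X Y Z) (e Y Z X)) (e Z X Y)) _.
move: (cact X _) (cact X _) (cact Y _) (cact Y _) (cact Z _) (cact Z _) => *; ring.
Qed.

Lemma half_double_eq0 f : f + f = 0 -> f = 0.
Proof. by move=> ff; rewrite -[f]mul1r -halfD mulrDl -mulrDr ff mulr0. Qed.

Definition coordinate_calculus : levi_civita_calculus V :=
  @LeviCivita K V cact cnab (gram_form G_sym) half_double_eq0
    cactDl cactZl cactD cactM cnabDl cnabZl cnabDr cnabZr cact_gram cact_lie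
    cnab_jacobi.
Local Notation L := coordinate_calculus.

Local Notation "''e_' a" := (delta_mx 0 a : V) (at level 8, a at level 2).

Definition riemannK a b c d := D c (Γ a d b) - D d (Γ a c b)
  + \sum_e (Γ a c e * Γ e d b - Γ a d e * Γ e c b).

Definition riemann_lowK a b c d := \sum_e G a e * riemannK e b c d.

Lemma cact_basis a f : cact 'e_a f = D a f.
Proof.
rewrite /cact (bigD1 a) //= mxE !eqxx mul1r big1 ?addr0 // => b /negPf ba.
by rewrite mxE ba andbF mul0r.
Qed.

Lemma cnab_basis a b c : cnab 'e_a 'e_b 0 c = Γ c a b.
Proof.
rewrite !mxE cact_basis der_nat add0r (bigD1 b) //= big1 ?addr0.
  rewrite !mxE !eqxx mul1r (bigD1 a) //= mxE !eqxx mul1r big1 ?addr0 // => d /negPf.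
  by rewrite mxE => ->; rewrite andbF mul0r.
by move=> d /negPf; rewrite [in X in X * _]mxE => ->; rewrite andbF mul0r.
Qed.

Lemma cnab_basisl a X c : cnab 'e_a X 0 c = D a (X 0 c) + \sum_e Γ c a e * X 0 e.
Proof.
rewrite !mxE cact_basis; congr (_ + _); apply: eq_bigr => e _.
rewrite mxE (bigD1 a) //= mxE !eqxx mul1r big1 ?addr0 1?mulrC // => d /negPf.
by rewrite mxE => ->; rewrite andbF mul0r.
Qed.

Lemma curv_basis a b c d : curv L 'e_c 'e_d 'e_b 0 a = riemannK a b c d.
Proof.
have e U W Z i : (U - W - Z : V) 0 i = U 0 i - W 0 i - Z 0 i by rewrite !mxE.
rewrite /curv e /= !(cnab_basisl _ (cnab _ _)) !cnab_basis.
have -> : lie L 'e_c 'e_d = 0.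
  apply/rowP => i; rewrite /lie lieE !cact_basis !mxE !der_nat subrr; exact.
rewrite -[cnab 0 _]/(nab L 0 _) nab0l mxE subr0 /riemannK opprD addrACA; congr (_ + _).
by rewrite -sumrB; apply: eq_bigr => i _; rewrite !cnab_basis.
Qed.

Lemma gram_basisr S X a : gram S X 'e_a = \sum_b X 0 b * S b a.
Proof.
rewrite /gram trmx_delta mxE (bigD1 a) //= big1 ?addr0.
  by rewrite !mxE !eqxx mulr1.
by move=> b /negPf ba; rewrite [X in _ * X]mxE ba mulr0.
Qed.

Lemma gram_basis S a b : gram S 'e_a 'e_b = S a b.
Proof.
rewrite gram_basisr (bigD1 a) //= mxE !eqxx mul1r big1 ?addr0 // => d /negPf.
by rewrite mxE => ->; rewrite andbF mul0r.
Qed.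

Lemma riem_basis a b c d : riem L 'e_a 'e_b 'e_c 'e_d = riemann_lowK a b c d.
Proof.
rewrite /riem /= gram_basisr; apply: eq_bigr => e _.
by rewrite curv_basis mulrC G_symE.
Qed.
End Coordinates.

(** * Null frames *)

Section NullGram.
Context (K : comNzRingType) (G : 'M[K]_4).
Hypothesis G_sym : G^T = G.
Implicit Types (X Y m p n k : 'rV[K]_4).
Local Notation g := (gram G).

Record null_gram m p n k : Prop := NullGram {
  ng_mp : g m p = 1; ng_nk : g n k = 1;
  ng_mm : g m m = 0; ng_pp : g p p = 0; ng_nn : g n n = 0; ng_kk : g k k = 0;
  ng_mn : g m n = 0; ng_mk : g m k = 0; ng_pn : g p n = 0; ng_pk : g p k = 0 }.

(** The inverse metric written in a null frame, p⊗m + m⊗p + k⊗n + n⊗k. *)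
Definition frame_mx m p n k : 'M[K]_4 :=
  p^T *m m + m^T *m p + k^T *m n + n^T *m k.

Lemma frame_mxE m p n k a b : frame_mx m p n k a b =
  p 0 a * m 0 b + m 0 a * p 0 b + k 0 a * n 0 b + n 0 a * k 0 b.
Proof. by rewrite !mxE !big_ord1 !mxE. Qed.

(** The rows of E are the frame and those of F its dual with respect to G, so E G F^T = 1. For
    square matrices over a commutative ring a one-sided inverse is two-sided, which yields the frame
    expansion of vectors without an argument about independence. *)
Lemma null_gram_frame m p n k : null_gram m p n k -> G *m frame_mx m p n k = 1%:M.
Proof.
move=> [h1 h2 h3 h4 h5 h6 h7 h8 h9 h10].
pose E : 'M[K]_4 := \matrix_(i < 4) tnth [tuple m; p; n; k] i.
pose F : 'M[K]_4 := \matrix_(i < 4) tnth [tuple p; m; k; n] i.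
have EF : E *m (G *m F^T) = 1%:M.
  apply/matrixP => i j; rewrite mulmxA.
  have -> : (E *m G *m F^T) i j = g (tnth [tuple m; p; n; k] i) (tnth [tuple p; m; k; n] j).
    rewrite /gram -[tnth [tuple m; _; _; _] i](rowK (fun i => tnth [tuple m; p; n; k] i)).
    rewrite -[tnth [tuple p; _; _; _] j](rowK (fun j => tnth [tuple p; m; k; n] j)).
    by rewrite -row_mul !mxE; apply: eq_bigr => l _; rewrite !mxE.
  case: i => [[|[|[|[|//]]]] hi]; case: j => [[|[|[|[|//]]]] hj];
    by rewrite mxE /= ?(tnth_nth 0) /= 1?(gramC G_sym) //
      ?(h1, h2, h3, h4, h5, h6, h7, h8, h9, h10) // 1?(gramC G_sym).
have -> : frame_mx m p n k = F^T *m E.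
  apply/matrixP => a b; rewrite frame_mxE !mxE !big_ord_recl big_ord0 !mxE addr0.
  by rewrite !addrA !(tnth_nth 0).
by rewrite mulmxA; exact: mulmx1C.
Qed.

Lemma null_gram_decomp m p n k X : null_gram m p n k ->
  X = g X p *: m + g X m *: p + g X k *: n + g X n *: k.
Proof.
move=> /null_gram_frame GH; rewrite -[LHS]mulmx1 -GH /gram !mulmxDr !mulmxA.
have e (A : 'M[K]_1) (B : 'rV[K]_4) : A 0 0 *: B = A *m B.
  by rewrite {2}[A]mx11_scalar mul_scalar_mx.
by rewrite !e.
Qed.
Context (Gi : 'M[K]_4).
Hypothesis GGi : G *m Gi = 1%:M.
Local Notation V := 'rV[K]_4.
Local Notation "''e_' a" := (delta_mx 0 a : V) (at level 8, a at level 2).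

Lemma linear_basis (F : V -> K) (FD : forall X Y, F (X + Y) = F X + F Y)
  (FZ : forall f X, F (f *: X) = f * F X) X : F X = \sum_a X 0 a * F 'e_a.
Proof.
have F0 : F 0 = 0 by rewrite -(scale0r (0 : V)) FZ mul0r.
rewrite {1}[X]row_sum_delta (big_morph F FD F0).
by apply: eq_bigr => a _; rewrite FZ.
Qed.

Lemma GiG : Gi *m G = 1%:M. Proof. exact: mulmx1C. Qed.

Lemma Gi_sym : Gi^T = Gi.
Proof.
have : G *m Gi^T = 1%:M by rewrite -{1}G_sym -trmx_mul GiG trmx1.
by move=> h; rewrite -[LHS]mul1mx -GiG -mulmxA h mulmx1.
Qed.

Definition form_trace m p q k (F : V -> V -> K) := F m p + F p m + F q k + F k q.

Lemma form_traceD m p q k (F F1 F2 : V -> V -> K) :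
  (forall X Y, F X Y = F1 X Y + F2 X Y) ->
  form_trace m p q k F = form_trace m p q k F1 + form_trace m p q k F2.
Proof. by move=> FE; rewrite /form_trace !FE; ring. Qed.

Lemma form_traceZ m p q k f (F F1 : V -> V -> K) :
  (forall X Y, F X Y = f * F1 X Y) ->
  form_trace m p q k F = f * form_trace m p q k F1.
Proof. by move=> FE; rewrite /form_trace !FE !mulrDr. Qed.

(** G has only one inverse, so the trace taken in any null frame is the trace taken with [Gi]. *)
Lemma frame_trace m p q k (F : V -> V -> K) : null_gram m p q k ->
  (forall X Y Z, F (X + Y) Z = F X Z + F Y Z) ->
  (forall f X Z, F (f *: X) Z = f * F X Z) ->
  (forall X Y Z, F Z (X + Y) = F Z X + F Z Y) ->
  (forall f X Z, F Z (f *: X) = f * F Z X) ->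
  form_trace m p q k F = \sum_a \sum_b Gi a b * F 'e_a 'e_b.
Proof.
move=> fr FDl FZl FDr FZr.
have GiE a b : Gi a b = frame_mx m p q k a b.
  by rewrite -[Gi]mulmx1 -(null_gram_frame fr) mulmxA GiG mul1mx.
have Fe X Y : F X Y = \sum_a \sum_b X 0 a * Y 0 b * F 'e_a 'e_b.
  rewrite (linear_basis (F := F^~ Y)) //; apply: eq_bigr => a _.
  rewrite (linear_basis (F := F 'e_a)) // mulr_sumr; apply: eq_bigr => b _; ring.
rewrite /form_trace !Fe -!big_split; apply: eq_bigr => a _ /=.
rewrite -!big_split; apply: eq_bigr => b _ /=; rewrite GiE frame_mxE; ring.
Qed.
End NullGram.

Section Dimension4.
Context (K : comNzRingType) (D : derivations K 4).
Context (G Gi : 'M[K]_4) (half twelfth : K).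
Hypothesis G_sym : G^T = G.
Hypothesis GGi : G *m Gi = 1%:M.
Hypothesis halfD : half + half = 1.
Hypothesis twelfthE : twelfth * 12 = 1.
Local Notation V := 'rV[K]_4.
Implicit Types (X Y Z U : V) (f h : K) (a b c d e : 'I_4).
Local Notation Γ := (christoffelK D G Gi half).
Local Notation L := (coordinate_calculus D G_sym GGi halfD).
Local Notation "''e_' a" := (delta_mx 0 a : V) (at level 8, a at level 2).
Local Notation riemannK := (riemannK D G Gi half).
Local Notation riemann_lowK := (riemann_lowK D G Gi half).

Definition ricciK a b := \sum_c riemannK c a c b.

Definition scalarK := \sum_a \sum_b Gi a b * ricciK a b.

Definition schoutenK a b := half * ricciK a b - twelfth * scalarK * G a b.

Let GiG : Gi *m G = 1%:M := GiG GGi.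

Lemma Gi_symE a b : Gi a b = Gi b a.
Proof. by rewrite -{1}(Gi_sym G_sym GGi) mxE. Qed.

Lemma ricciK_low a b : ricciK a b = \sum_c \sum_d Gi c d * riemann_lowK c a d b.
Proof.
rewrite exchange_big; apply: eq_bigr => d _.
under eq_bigr => c _ do rewrite mulr_sumr.
rewrite exchange_big (bigD1 d) //= [X in _ = _ + X]big1 ?addr0; last first.
  move=> e /negPf ed; under eq_bigr => c _ do rewrite mulrA.
  rewrite -mulr_suml; have /matrixP/(_ d e) := GiG; rewrite !mxE eq_sym ed => h.
  by under eq_bigr do rewrite Gi_symE; rewrite h mul0r.
under eq_bigr => c _ do rewrite mulrA; rewrite -mulr_suml.
have /matrixP/(_ d d) := GiG; rewrite !mxE eqxx => h.
by under [in RHS]eq_bigr do rewrite Gi_symE; rewrite h mul1r.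
Qed.

Lemma ricciK_sym a b : ricciK a b = ricciK b a.
Proof.
rewrite !ricciK_low exchange_big; apply: eq_bigr => c _; apply: eq_bigr => d _.
by rewrite Gi_symE -!(riem_basis _ G_sym GGi halfD) riem_pair.
Qed.

Definition ricci_mx : 'M[K]_4 := \matrix_(a, b) ricciK a b.
Definition schouten_mx : 'M[K]_4 := \matrix_(a, b) schoutenK a b.

Lemma ricci_mx_sym : ricci_mx^T = ricci_mx.
Proof. by apply/matrixP => a b; rewrite !mxE ricciK_sym. Qed.

Lemma schouten_mx_sym : schouten_mx^T = schouten_mx.
Proof. by apply/matrixP => a b; rewrite !mxE /schoutenK ricciK_sym (G_symE G_sym). Qed.

Local Notation P := (gram_form schouten_mx_sym).

Definition weylK4 a b c d := riemann_lowK a b c d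
  + G a d * schoutenK c b - G a c * schoutenK d b
  + G b c * schoutenK d a - G b d * schoutenK c a.

Lemma weyl_basis a b c d : weylK L P 'e_a 'e_b 'e_c 'e_d = weylK4 a b c d.
Proof. by rewrite weylKE riem_basis /= !gram_basis !mxE. Qed.

Lemma weyl_coord X Y Z U : weylK L P X Y Z U =
  \sum_a \sum_b \sum_c \sum_d weylK4 a b c d * X 0 a * Y 0 b * Z 0 c * U 0 d.
Proof.
rewrite (linear_basis (F := fun X => weylK L P X Y Z U)); first last.
- by move=> *; rewrite ctZl.
- by move=> *; rewrite ctDl.
apply: eq_bigr => a _.
rewrite (linear_basis (F := fun Y => weylK L P 'e_a Y Z U)); first last.
- by move=> *; rewrite ctZ2.
- by move=> *; rewrite ctD2.
rewrite mulr_sumr; apply: eq_bigr => b _.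
rewrite (linear_basis (F := fun Y => weylK L P 'e_a 'e_b Y U)); first last.
- by move=> *; rewrite ctZ3.
- by move=> *; rewrite ctD3.
rewrite !mulr_sumr; apply: eq_bigr => c _.
rewrite (linear_basis (F := fun Y => weylK L P 'e_a 'e_b 'e_c Y)); first last.
- by move=> *; rewrite ctZ4.
- by move=> *; rewrite ctD4.
rewrite !mulr_sumr; apply: eq_bigr => d _; rewrite weyl_basis; ring.
Qed.

Definition nab_schoutenK b c a := D b (schoutenK c a)
  - \sum_e Γ e b c * schoutenK e a - \sum_e Γ e b a * schoutenK c e.

Definition cotton4 a b c := nab_schoutenK b c a - nab_schoutenK c b a.

Lemma nabP_basis b c a : nabP L P 'e_b 'e_c 'e_a = nab_schoutenK b c a.
Proof.
rewrite /nabP /= !gram_basisr (gramC schouten_mx_sym 'e_c) !gram_basisr.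
rewrite cact_basis; congr (_ - _ - _).
- congr (D b _); rewrite (bigD1 c) //= big1 ?addr0; first by rewrite !mxE !eqxx mul1r.
  by move=> i /negPf ci; rewrite mxE ci andbF mul0r.
- by apply: eq_bigr => e _; rewrite cnab_basis mxE.
- apply: eq_bigr => e _; rewrite cnab_basis mxE /schoutenK ricciK_sym.
  by rewrite (G_symE G_sym).
Qed.

Lemma cotton_coord X Y Z : cottonK L P X Y Z =
  \sum_a \sum_b \sum_c cotton4 a b c * X 0 a * Y 0 b * Z 0 c.
Proof.
have e U W T : nabP L P U W T =
    \sum_a \sum_b \sum_c nab_schoutenK b c a * U 0 b * W 0 c * T 0 a.
  rewrite (linear_basis (F := fun T => nabP L P U W T)); first last.
  - by move=> f A; rewrite nabP_C nabP_Z2 (nabP_C _ _ _ A).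
  - by move=> A B; rewrite nabP_C nabP_D2 (nabP_C _ _ _ A) (nabP_C _ _ _ B).
  apply: eq_bigr => a _.
  rewrite (linear_basis (F := fun U => nabP L P U W 'e_a)); first last.
  - by move=> *; rewrite nabP_Zl.
  - by move=> *; rewrite nabP_Dl.
  rewrite !mulr_sumr; apply: eq_bigr => b _.
  rewrite (linear_basis (F := fun W => nabP L P 'e_b W 'e_a)); first last.
  - by move=> *; rewrite nabP_Z2.
  - by move=> *; rewrite nabP_D2.
  rewrite !mulr_sumr; apply: eq_bigr => c _; rewrite nabP_basis; ring.
rewrite /cottonK !e -sumrB; apply: eq_bigr => a _.
rewrite [X in _ - X]exchange_big -sumrB; apply: eq_bigr => b _ /=.
rewrite -sumrB; apply: eq_bigr => c _; rewrite /cotton4; ring.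
Qed.

Lemma null_gram_basis m p q k : null_gram G m p q k -> null_basis L m p q k.
Proof.
move=> fr; have [*] := fr; split=> // X; exact: null_gram_decomp.
Qed.

(** In dimension 4 the Schouten tensor satisfies Ric = 2 P + (tr P) g, and the trace terms of the
    Weyl tensor remove exactly this. *)
Lemma weyl_frame_traceless m p q k : null_gram G m p q k ->
  ct_traceless (weylK L P) m p q k.
Proof.
move=> ng X Y; have fr := null_gram_basis ng; pose Ric := gram ricci_mx.
have PE Z U : P Z U = half * Ric Z U - twelfth * scalarK * gm L Z U.
  have -> : half * Ric Z U - twelfth * scalarK * gm L Z U =
    gram (half *: ricci_mx - (twelfth * scalarK) *: G) Z U.
    by rewrite /Ric /= /gram mulmxBr -!scalemxAr mulmxBl -!scalemxAl !mxE.
  by congr gram; apply/matrixP => a b; rewrite !mxE.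
have trR Z U : form_trace m p q k (fun A B => riem L A Z B U) = Ric Z U.
  have FDl A A' B : form_trace m p q k (fun W T => riem L W (A + A') T B) =
      form_trace m p q k (fun W T => riem L W A T B)
      + form_trace m p q k (fun W T => riem L W A' T B).
    by apply: form_traceD => *; rewrite riemDr.
  have FZl f A B : form_trace m p q k (fun W T => riem L W (f *: A) T B) =
      f * form_trace m p q k (fun W T => riem L W A T B).
    by apply: form_traceZ => *; rewrite riemZr.
  have FDr A B B' : form_trace m p q k (fun W T => riem L W A T (B + B')) =
      form_trace m p q k (fun W T => riem L W A T B)
      + form_trace m p q k (fun W T => riem L W A T B').
    by apply: form_traceD => *; rewrite riemD4.
  have FZr f A B : form_trace m p q k (fun W T => riem L W A T (f *: B)) =
      f * form_trace m p q k (fun W T => riem L W A T B).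
    by apply: form_traceZ => *; rewrite riemZ4.
  rewrite (linear_basis (F := fun A => form_trace m p q k (fun W T => riem L W A T U))) //.
  rewrite (linear_basis (F := fun A => Ric A U)); first last.
  - by move=> *; rewrite /Ric gramZl.
  - by move=> *; rewrite /Ric gramDl.
  apply: eq_bigr => a _; congr (_ * _).
  rewrite (linear_basis (F := fun B => form_trace m p q k (fun W T => riem L W 'e_a T B))) //.
  rewrite (linear_basis (F := fun B => Ric 'e_a B)); first last.
  - by move=> *; rewrite /Ric !(gramC ricci_mx_sym 'e_a) gramZl.
  - by move=> *; rewrite /Ric !(gramC ricci_mx_sym 'e_a) gramDl.
  apply: eq_bigr => b _; congr (_ * _).
  rewrite (frame_trace G_sym GGi ng); first last.
  - by move=> *; rewrite riemZ3.
  - by move=> *; rewrite riemD3.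
  - by move=> *; rewrite riemZl.
  - by move=> *; rewrite riemDl.
  rewrite /Ric gram_basis mxE ricciK_low.
  by apply: eq_bigr => c _; apply: eq_bigr => d _; rewrite riem_basis.
have trRic : form_trace m p q k Ric = scalarK.
  rewrite (frame_trace G_sym GGi ng); first last.
  - by move=> f A B; rewrite /Ric !(gramC ricci_mx_sym B) gramZl.
  - by move=> A A' B; rewrite /Ric !(gramC ricci_mx_sym B) gramDl.
  - by move=> *; rewrite /Ric gramZl.
  - by move=> *; rewrite /Ric gramDl.
  by apply: eq_bigr => c _; apply: eq_bigr => d _; rewrite /Ric gram_basis mxE.
have halfE : half = 6 * twelfth.
  have : half * (twelfth * 12) = 6 * twelfth * (half + half) by ring.
  by rewrite twelfthE halfD !mulr1.
have Pdec Z U : P Z U = gm L Z p * P m U + gm L Z m * P p U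
    + gm L Z k * P q U + gm L Z q * P k U.
  by rewrite {1}(nb_decomp fr Z) !formDl !formZl.
have [h1 h2 _ _ _ _ _ _ _ _ _] := fr.
have dX := Pdec X Y; have dY := Pdec Y X.
(* The left side is tr P, and 1/2 - 4/12 = 1/6 gives tr P = R/6. *)
have trRic' : 2 * (P m p + P q k) = (half - 4 * twelfth) * scalarK.
  have scalE : scalarK = 2 * (Ric m p + Ric q k).
    rewrite -trRic /form_trace /Ric (gramC ricci_mx_sym p m) (gramC ricci_mx_sym k q).
    by move: (gram _ _ _) (gram _ _ _) => *; ring.
  rewrite !PE h1 h2 scalE; move: (Ric m p) (Ric q k) => *; ring.
have R := trR X Y; rewrite /form_trace in R.
(* The four traces are kept apart, in the order of the terms of the Weyl tensor: the -4 is the trace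
   of g, and the first and last single P come from contractions with Y and X, which [key'] expands
   in the frame. *)
have key : Ric X Y + P Y X - 4 * P Y X + P X Y - gm L X Y * (2 * (P m p + P q k)) = 0.
  rewrite trRic' (formC P Y X) PE.
  move: (Ric X Y) (gm L X Y) scalarK => r gxy s.
  have z : 6 * twelfth - half = 0 by rewrite -halfE subrr.
  transitivity ((1 - (half + half)) * r + (6 * twelfth - half) * s * gxy); first by ring.
  by rewrite halfD z subrr !mul0r addr0.
have key' : riem L m X p Y + riem L p X m Y + riem L q X k Y + riem L k X q Y
  + (gm L Y p * P m X + gm L Y m * P p X + gm L Y k * P q X + gm L Y q * P k X)
  - 4 * P Y X
  + (gm L X p * P m Y + gm L X m * P p Y + gm L X k * P q Y + gm L X q * P k Y)
  - gm L X Y * (2 * (P m p + P q k)) = 0 by rewrite R -dY -dX.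
rewrite !weylKE (formC (gm L) p m) (formC (gm L) k q) h1 h2.
rewrite (formC P p m) (formC P k q).
rewrite (formC P Y m) (formC P Y p) (formC P Y q) (formC P Y k).
rewrite -!(formC (gm L) Y m) -!(formC (gm L) Y p) -!(formC (gm L) Y q) -!(formC (gm L) Y k).
move: (riem L m X p Y) (riem L p X m Y) (riem L q X k Y) (riem L k X q Y) key'.
move: (P m X) (P p X) (P q X) (P k X) (P m Y) (P p Y) (P q Y) (P k Y) (P Y X).
move: (P m p) (P q k) (gm L X Y) (gm L Y p) (gm L Y m) (gm L Y k) (gm L Y q).
move: (gm L X p) (gm L X m) (gm L X k) (gm L X q).
move=> ? ? ? ? ? ? ? ? ? ? ? ? ? ? ? ? ? ? ? ? ? ? ? ? key'.
apply: (eq_of_subr_eq key'); ring.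
Qed.
End Dimension4.

(** * The Nijenhuis tensor and hermitian frames *)

Lemma derN1 (K : comNzRingType) n (D : derivations K n) a : D a (-1) = 0.
Proof.
by apply: (addrI (D a 1)); rewrite -derD subrr der0 der1 addr0.
Qed.

Section Nijenhuis.
Context (K : comNzRingType) (n : nat) (D : derivations K n) (J : 'M[K]_n).
Hypothesis JJ : J *m J = - 1%:M.
Local Notation V := 'rV[K]_n.
Implicit Types (X Y Z : V) (f : K).

(* Locked, since otherwise unification unfolds it when comparing components. *)
Definition bracket X Y : V := locked (mact D X Y - mact D Y X).

Lemma bracketE X Y : bracket X Y = mact D X Y - mact D Y X.
Proof. by rewrite /bracket -lock. Qed.

Definition nijK X Y : V :=
  bracket X Y + (bracket (X *m J) Y + bracket X (Y *m J)) *m J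
  - bracket (X *m J) (Y *m J).

Lemma mactDl X Y (Z : V) : mact D (X + Y) Z = mact D X Z + mact D Y Z.
Proof. by apply/rowP => i; rewrite !mxE cactDl. Qed.

Lemma mactZl f X (Z : V) : mact D (f *: X) Z = f *: mact D X Z.
Proof. by apply/rowP => i; rewrite !mxE cactZl. Qed.

Lemma mactDr X Y (Z : V) : mact D X (Y + Z) = mact D X Y + mact D X Z.
Proof. by apply/rowP => i; rewrite !mxE cactD. Qed.

Lemma mactZr f X (Z : V) : mact D X (f *: Z) = cact D X f *: Z + f *: mact D X Z.
Proof. by apply/rowP => i; rewrite !mxE cactM. Qed.

Lemma bracketC X Y : bracket Y X = - bracket X Y.
Proof. by rewrite !bracketE opprB. Qed.

Lemma bracketDl X Y Z : bracket (X + Y) Z = bracket X Z + bracket Y Z.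
Proof. by rewrite !bracketE mactDl mactDr opprD addrACA. Qed.

Lemma bracketZl f X Y : bracket (f *: X) Y = f *: bracket X Y - cact D Y f *: X.
Proof. by rewrite !bracketE mactZl mactZr scalerBr opprD [- _ - _]addrC addrA. Qed.

Lemma rowDE X Y c : (X + Y) 0 c = X 0 c + Y 0 c. Proof. by rewrite mxE. Qed.
Lemma rowNE X c : (- X) 0 c = - X 0 c. Proof. by rewrite mxE. Qed.
Lemma rowZE f X c : (f *: X) 0 c = f * X 0 c. Proof. by rewrite mxE. Qed.
Definition row_entryE := (rowDE, rowNE, rowZE).

Lemma mulmxJJ X : X *m J *m J = - X.
Proof. by rewrite -mulmxA JJ mulmxN mulmx1. Qed.

Lemma nijK_anti X Y : nijK Y X = - nijK X Y.
Proof.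
rewrite /nijK (bracketC X) (bracketC (X *m J)) (bracketC X (Y *m J)).
rewrite (bracketC (X *m J) (Y *m J)) !mulmxDl !mulNmx.
apply/rowP => c; rewrite !row_entryE; ring.
Qed.

Lemma nijKDl X X' Y : nijK (X + X') Y = nijK X Y + nijK X' Y.
Proof.
rewrite /nijK !mulmxDl !bracketDl !mulmxDl.
apply/rowP => c; rewrite !row_entryE; ring.
Qed.

(** The terms with derivatives of f cancel because J^2 = -1. *)
Lemma nijKZl f X Y : nijK (f *: X) Y = f *: nijK X Y.
Proof.
rewrite /nijK -!scalemxAl !bracketZl !(mulmxDl, mulNmx) -!scalemxAl mulmxJJ.
apply/rowP => c; rewrite !row_entryE; ring.
Qed.

Lemma nijKDr X Y Y' : nijK X (Y + Y') = nijK X Y + nijK X Y'.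
Proof.
by rewrite (nijK_anti (Y + Y') X) nijKDl opprD -(nijK_anti Y X) -(nijK_anti Y' X).
Qed.

Lemma nijKZr f X Y : nijK X (f *: Y) = f *: nijK X Y.
Proof. by rewrite (nijK_anti (f *: Y) X) nijKZl -scalerN -(nijK_anti Y X). Qed.

Lemma nijKJl X Y : nijK (X *m J) Y = - (nijK X Y *m J).
Proof.
have c0 B : cact D B (-1) = 0.
  by rewrite /cact big1 // => a _; rewrite derN1 mulr0.
have bN A B : bracket (- A) B = - bracket A B.
  by rewrite -scaleN1r bracketZl c0 scale0r subr0 scaleN1r.
rewrite /nijK !(mulmxDl, mulNmx) !mulmxJJ !bN !mulNmx.
apply/rowP => c; rewrite !row_entryE; ring.
Qed.

Lemma nijKJr X Y : nijK X (Y *m J) = - (nijK X Y *m J).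
Proof.
by rewrite (nijK_anti (Y *m J) X) nijKJl opprK (nijK_anti X Y) mulNmx.
Qed.

Section ComplexPair.
Context (i : K) (i2 : i * i = -1) (Di : forall a, D a i = 0).

Let cacti X : cact D X i = 0.
Proof. by rewrite /cact big1 // => a _; rewrite Di mulr0. Qed.

(** Since (1 + i J)/2 projects onto the -i eigenspace, the right side is four times the (0,1) part
    of the bracket. *)
Lemma nijK_holomorphic Z W : Z *m J = i *: Z -> W *m J = i *: W ->
  nijK Z W = 2 *: (bracket Z W + i *: (bracket Z W *m J)).
Proof.
move=> ZJ WJ; have bi A B : bracket (i *: A) B = i *: bracket A B.
  by rewrite bracketZl cacti scale0r subr0.
have bi' A B : bracket A (i *: B) = i *: bracket A B.
  by rewrite bracketC bi -scalerN -bracketC.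
rewrite /nijK ZJ WJ !bi !bi' !mulmxDl -!scalemxAl.
move: (bracket Z W *m J) (bracket Z W) => A B.
apply/rowP => c; rewrite !row_entryE mulrA i2; ring.
Qed.

Lemma nijK_real_pair v w : nijK (v - i *: (v *m J)) (w - i *: (w *m J)) =
  2 *: (nijK v w + i *: (nijK v w *m J)).
Proof.
rewrite -!scaleNr nijKDl !nijKDr !nijKZl !nijKZr nijKJl nijKJr nijKJl nijKJr.
rewrite mulNmx opprK mulmxJJ.
move: (nijK v w *m J) (nijK v w) => A B.
apply/rowP => c; rewrite !row_entryE.
have -> : - i * (- i * - B 0 c) = i * i * - B 0 c by ring.
rewrite i2; ring.
Qed.
End ComplexPair.
End Nijenhuis.

Section FrameBracket.
Context (K : comNzRingType) (D : derivations K 4) (G Gi : 'M[K]_4) (half : K).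
Hypothesis G_sym : G^T = G.
Hypothesis GGi : G *m Gi = 1%:M.
Hypothesis halfD : half + half = 1.
Local Notation g := (gram G).
Local Notation gf := (gram_form G_sym).
Local Notation L := (coordinate_calculus D G_sym GGi halfD).
Context (m p n k : 'rV[K]_4).
Hypothesis ng : null_gram G m p n k.

(** g(B, m) and g(B, k) are the components of B along p and n, those transverse to N. So s(m) and
    s(k) are, up to sign, what keeps the bracket of m and k from lying in N. *)
Lemma frame_bracket_m : g (bracket D m k) m = - gm L (nab L m m) k.
Proof.
have [_ _ h3 _ _ h6 _ h8 _ _] := ng.
have -> : bracket D m k = nab L m k - nab L k m.
  by rewrite bracketE; symmetry; exact: cnab_lie.
transitivity (gm L (nab L m k) m - gm L (nab L k m) m).
  by rewrite /= gramDl; congr (_ + _); exact: (formNl gf).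
rewrite (@skew_nab0 _ _ L k m h3) subr0 (@skew_nab _ _ L m k m) //.
by rewrite /= (gramC G_sym) h8; exact: (act0 L m).
Qed.

Lemma frame_bracket_k : g (bracket D m k) k = - gm L (nab L k m) k.
Proof.
have [_ _ h3 _ _ h6 _ h8 _ _] := ng.
have -> : bracket D m k = nab L m k - nab L k m.
  by rewrite bracketE; symmetry; exact: cnab_lie.
transitivity (gm L (nab L m k) k - gm L (nab L k m) k).
  by rewrite /= gramDl; congr (_ + _); exact: (formNl gf).
by rewrite (@skew_nab0 _ _ L m k h6) sub0r.
Qed.

End FrameBracket.

Section HermitianFrame.
Context (K : comNzRingType) (G J : 'M[K]_4).
Hypothesis G_sym : G^T = G.
Hypothesis JJ : J *m J = - 1%:M.
Hypothesis JG : J *m G *m J^T = G.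
Hypothesis dbl0 : forall a : K, a + a = 0 -> a = 0.
Context (i : K) (i2 : i * i = -1).
Local Notation V := 'rV[K]_4.
Implicit Types (X Y Z v w : V) (f : K).
Local Notation g := (gram G).
Local Notation gf := (gram_form G_sym).

Lemma gram_J X Y : g (X *m J) (Y *m J) = g X Y.
Proof. by rewrite /gram trmx_mul !mulmxA -(mulmxA X) -(mulmxA X) JG. Qed.

Lemma gramNl X Y : g (- X) Y = - g X Y.
Proof. exact: (formNl gf). Qed.
Lemma gramDr X Y Z : g Z (X + Y) = g Z X + g Z Y.
Proof. exact: (formDr gf). Qed.
Lemma gramZr f X Z : g Z (f *: X) = f * g Z X.
Proof. exact: (formZr gf). Qed.
Lemma gramNr X Y : g X (- Y) = - g X Y.
Proof. exact: (formNr gf). Qed.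

Lemma gram_Jr X Y : g X (Y *m J) = - g (X *m J) Y.
Proof. by rewrite -gram_J (mulmxJJ JJ) gramNr. Qed.

Lemma gram_vJ v : g v (v *m J) = 0.
Proof.
apply: dbl0; rewrite {2}gram_Jr (gramC G_sym (v *m J)) subrr; exact.
Qed.

Lemma gram_holomorphic X Y : X *m J = i *: X -> Y *m J = i *: Y -> g X Y = 0.
Proof.
move=> XJ YJ; apply: dbl0; rewrite -{1}gram_J XJ YJ.
by rewrite gramZl gramZr mulrA i2 mulN1r addNr.
Qed.

Definition hol v : V := v - i *: (v *m J).
Definition antihol v : V := v + i *: (v *m J).

Lemma holJ v : hol v *m J = i *: hol v.
Proof.
rewrite /hol mulmxDl mulNmx -scalemxAl (mulmxJJ JJ) scalerBr scalerA i2.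
by rewrite scalerN scaleN1r !opprK addrC.
Qed.

Context (v w : V) (al be : K).
Hypothesis al_v : 2 * g v v * al = 1.
Hypothesis be_w : 2 * g w w * be = 1.
Hypothesis wv : g w v = 0.
Hypothesis wvJ : g w (v *m J) = 0.

(** The factors [al] and [be] come from g(v - i Jv, v + i Jv) = 2 g(v, v). Vectors in the same
    eigenspace of J are orthogonal because J is an isometry and (±i)^2 = -1; the cross products
    vanish because w is orthogonal to v and Jv. *)
Lemma hermitian_null_gram :
  null_gram G (hol v) (al *: antihol v) (be *: antihol w) (hol w).
Proof.
have antiJ x : antihol x *m J = (- i) *: antihol x.
  rewrite /antihol mulmxDl -scalemxAl (mulmxJJ JJ) scalerDr scalerA mulNr i2 opprK.
  by rewrite scale1r scaleNr scalerN addrC.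
have anti0 X Y : X *m J = (- i) *: X -> Y *m J = (- i) *: Y -> g X Y = 0.
  move=> XJ YJ; apply: dbl0; rewrite -{1}gram_J XJ YJ.
  by rewrite gramZl gramZr mulrA mulrNN i2 mulN1r addNr.
have hh x : g (hol x) (antihol x) = 2 * g x x.
  rewrite /hol /antihol gramDl gramNl gramZl !gramDr !gramZr /=.
  rewrite gram_J (gramC G_sym (x *m J)) gram_vJ.
  have -> : g x x + i * 0 - i * (0 + i * g x x) = g x x - i * i * g x x by ring.
  rewrite i2; ring.
have wvJ' : g (w *m J) v = 0 by rewrite -[LHS]opprK -gram_Jr wvJ oppr0.
have cross : g (hol v) (antihol w) = 0 /\ g (hol w) (antihol v) = 0.
  rewrite /hol /antihol !gramDl !gramNl !gramZl !gramDr !gramZr /=.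
  rewrite !gram_J !(gramC G_sym v) !(gramC G_sym (v *m J)) wv wvJ wvJ'.
  by split; ring.
have antiZ c x : (c *: antihol x) *m J = (- i) *: (c *: antihol x).
  by rewrite -scalemxAl antiJ !scalerA mulrC.
have [c1 c2] := cross.
split.
- by rewrite gramZr /= hh mulrC.
- by rewrite gramZl /= (gramC G_sym) hh mulrC.
- by apply: gram_holomorphic; exact: holJ.
- exact: anti0.
- exact: anti0.
- by apply: gram_holomorphic; exact: holJ.
- by rewrite gramZr /= c1 mulr0.
- by apply: gram_holomorphic; exact: holJ.
- exact: anti0.
- by rewrite gramZl /= (gramC G_sym) c2 mulr0.
Qed.

Section Integrability.
Context (D : derivations K 4) (Gi : 'M[K]_4) (half : K).
Hypothesis GGi : G *m Gi = 1%:M.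
Hypothesis halfD : half + half = 1.
Hypothesis Di : forall a, D a i = 0.
Local Notation L := (coordinate_calculus D G_sym GGi halfD).
Local Notation m := (hol v).
Local Notation k := (hol w).
Local Notation p := (al *: antihol v).
Local Notation n := (be *: antihol w).

Let ng := hermitian_null_gram.

Lemma nijK_eq0_integrable : nijK D J m k = 0 ->
  gm L (nab L m m) k = 0 /\ gm L (nab L k m) k = 0.
Proof.
rewrite (nijK_holomorphic i2 Di (holJ v) (holJ w)) => N0.
set B := bracket D m k in N0.
have N1 : B + i *: (B *m J) = 0.
  by apply/rowP => c; rewrite [RHS]mxE; apply: dbl0; have /rowP/(_ c) := N0;
    rewrite rowZE [RHS]mxE => <-; ring.
have BJ : B *m J = i *: B.
  have /(congr1 (fun X => i *: X)) := N1.
  rewrite scalerDr scalerA i2 scaler0 scaleN1r => /eqP.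
  by rewrite subr_eq0 => /eqP.
split; apply/eqP; rewrite -oppr_eq0; apply/eqP.
  by rewrite -(frame_bracket_m D G_sym GGi halfD ng) gram_holomorphic //; exact: holJ.
by rewrite -(frame_bracket_k D G_sym GGi halfD ng) gram_holomorphic //; exact: holJ.
Qed.
End Integrability.
End HermitianFrame.

(** * Smooth functions *)

(** Differentiability depends on the germ only; this carries smoothness over to functions that agree
    merely on an open set. *)
Lemma near_eq_differentiable (R : numFieldType) (V W : normedModType R)
    (f h : V -> W) x :
  (\near x, f x = h x) -> differentiable f x -> differentiable h x.
Proof.
move=> fh df; have [cd fE] := (diff_locallyP _ _).1 df.
have hE : h \o shift x = cst (h x) + 'd f x +o_ (0 : V) id.
  apply/eqaddoP => e e0; have := (eqaddoP _ _ _ _).1 fE e e0.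
  have nfh : \forall y \near (0 : V), f (y + x) = h (y + x).
    by move: fh; rewrite (near_shift (0 : V)); apply: filterS => y /=; rewrite subr0.
  apply: filterS2 nfh => y fhy.
  have -> // : (h \o shift x - (cst (h x) + 'd f x)) y =
    (f \o shift x - (cst (f x) + 'd f x)) y.
  rewrite -[LHS]/(h (y + x) - (h x + 'd f x y)) -fhy.
  by rewrite -[RHS]/(f (y + x) - (f x + 'd f x y)) (nbhs_singleton fh).
apply/diff_locallyP; rewrite (diff_unique cd hE); by [].
Qed.

Section Smooth.
Context (R : realType) (n : nat).
Implicit Types (U : set 'rV[R]_n) (x : 'rV[R]_n) (a b : 'I_n).

(** [smooth_on] quantifies over all lists of derivatives at once; peeling off the innermost
    derivative instead allows induction on k, as needed for products and inverses, whose derivatives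
    involve the functions themselves. *)
Fixpoint Ck (W : normedModType R) U k (f : 'rV[R]_n -> W) : Prop :=
  (forall x, U x -> differentiable f x) /\
  if k is k'.+1 then forall a, Ck U k' (partial a f) else True.

Lemma Ck_differentiable (W : normedModType R) U k (f : 'rV[R]_n -> W) x :
  Ck U k f -> U x -> differentiable f x.
Proof. by case: k => [|k] [h _]; exact: h. Qed.

Lemma smooth_onP (W : normedModType R) U (f : 'rV[R]_n -> W) :
  smooth_on U f <-> forall k, Ck U k f.
Proof.
split=> [+ k|].
  elim: k f => [|k IH] f sf; split=> //; try exact: (sf [::]).
  by move=> a; apply: IH => s; have := sf (rcons s a); rewrite foldr_rcons.
move=> h s; elim/last_ind: s f h => [|s a IH] f h x Ux.
  by have [/(_ x Ux)] := h 0.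
rewrite foldr_rcons; apply: IH Ux => k; exact: (h k.+1).2.
Qed.

Lemma smooth_differentiable (W : normedModType R) U (f : 'rV[R]_n -> W) x :
  smooth_on U f -> U x -> differentiable f x.
Proof. by move=> sf; exact: (sf [::]). Qed.

Lemma smooth_partial (W : normedModType R) U a (f : 'rV[R]_n -> W) :
  smooth_on U f -> smooth_on U (partial a f).
Proof. by move=> /smooth_onP sf; apply/smooth_onP => k; exact: (sf k.+1).2. Qed.

Lemma smooth_sub (W : normedModType R) U U' (f : 'rV[R]_n -> W) :
  U' `<=` U -> smooth_on U f -> smooth_on U' f.
Proof. by move=> UU sf s x /UU; exact: sf. Qed.

Section Open.
Context (U : set 'rV[R]_n).
Hypothesis oU : open U.

Lemma near_open (P : 'rV[R]_n -> Prop) x : U x -> (forall y, U y -> P y) ->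
  \forall y \near x, P y.
Proof.
move=> Ux UP; apply: (@filterS _ _ _ U) => //; exact: open_nbhs_nbhs.
Qed.

Lemma partial_congr (W : normedModType R) a (f h : 'rV[R]_n -> W) x :
  (forall y, U y -> f y = h y) -> U x -> partial a f x = partial a h x.
Proof. by move=> fh Ux; apply: near_eq_derive; exact: near_open. Qed.

Lemma Ck_congr (W : normedModType R) k (f h : 'rV[R]_n -> W) :
  (forall y, U y -> f y = h y) -> Ck U k f -> Ck U k h.
Proof.
elim: k f h => [|k IH] f h fh [df sf]; split=> //.
- move=> x Ux; by apply: near_eq_differentiable (df x Ux); exact: near_open.
- move=> x Ux; by apply: near_eq_differentiable (df x Ux); exact: near_open.
- move=> a; by apply: IH (sf a) => y; exact: partial_congr.
Qed.

Lemma smooth_congr (W : normedModType R) (f h : 'rV[R]_n -> W) :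
  (forall y, U y -> f y = h y) -> smooth_on U f -> smooth_on U h.
Proof. by move=> fh /smooth_onP sf; apply/smooth_onP => k; apply: Ck_congr (sf k). Qed.

Implicit Types (f h : 'rV[R]_n -> R).

Lemma partialD (W : normedModType R) a (f h : 'rV[R]_n -> W) x :
  differentiable f x -> differentiable h x ->
  partial a (f \+ h) x = partial a f x + partial a h x.
Proof. by move=> df dh; apply: deriveD; exact: diff_derivable. Qed.

Lemma partialN (W : normedModType R) a (f : 'rV[R]_n -> W) x :
  differentiable f x -> partial a (\- f) x = - partial a f x.
Proof. by move=> df; apply: deriveN; exact: diff_derivable. Qed.

Lemma partialM a f h x : differentiable f x -> differentiable h x ->
  partial a (f \* h) x = partial a f x * h x + f x * partial a h x.
Proof.
move=> df dh; rewrite /partial -[_ \* _]/(f * h) deriveM; try exact: diff_derivable.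
by rewrite -![_ *: _]/(_ * _) addrC (mulrC (h x)).
Qed.

Lemma CkD (W : normedModType R) k (f h : 'rV[R]_n -> W) :
  Ck U k f -> Ck U k h -> Ck U k (f \+ h).
Proof.
elim: k f h => [|k IH] f h [df sf] [dh sh]; split=> //.
- move=> x Ux; by apply: differentiableD; [exact: df|exact: dh].
- move=> x Ux; by apply: differentiableD; [exact: df|exact: dh].
- move=> a; apply: Ck_congr (IH _ _ (sf a) (sh a)) => y Uy.
  by rewrite partialD //; [exact: df|exact: dh].
Qed.

Lemma CkN (W : normedModType R) k (f : 'rV[R]_n -> W) : Ck U k f -> Ck U k (\- f).
Proof.
elim: k f => [|k IH] f [df sf]; split=> //.
- move=> x Ux; by apply: differentiableN; exact: df.
- move=> x Ux; by apply: differentiableN; exact: df.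
- move=> a; by apply: Ck_congr (IH _ (sf a)) => y Uy; rewrite partialN //; exact: df.
Qed.

Lemma CkW (W : normedModType R) k (f : 'rV[R]_n -> W) : Ck U k.+1 f -> Ck U k f.
Proof.
elim: k f => [|k IH] f [df sf]; split=> // a; apply: IH; exact: sf.
Qed.

Lemma CkM k f h : Ck U k f -> Ck U k h -> Ck U k (f \* h).
Proof.
elim: k f h => [|k IH] f h Cf Ch.
  split=> // x Ux; apply: differentiableM.
    exact: Ck_differentiable Cf Ux.
  exact: Ck_differentiable Ch Ux.
split=> [x Ux|a].
  apply: differentiableM; first exact: Ck_differentiable Cf Ux.
  exact: Ck_differentiable Ch Ux.
apply: (@Ck_congr _ _ ((partial a f \* h) \+ (f \* partial a h))).
  move=> y Uy; rewrite partialM //; first exact: Ck_differentiable Cf Uy.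
  exact: Ck_differentiable Ch Uy.
by apply: CkD; apply: IH; [exact: Cf.2|exact: CkW|exact: CkW|exact: Ch.2].
Qed.

Lemma Ck_cst (W : normedModType R) k (c : W) : Ck U k (fun=> c : W).
Proof.
elim: k c => [|k IH] c; split=> // a.
by apply: Ck_congr (IH 0) => y _; rewrite /partial derive_cst.
Qed.

Lemma CkV k f : (forall x, U x -> f x != 0) -> Ck U k f -> Ck U k (fun x => (f x)^-1).
Proof.
move=> f0; elim: k => [|k IH] Cf.
  by split=> // x Ux; apply: differentiableV; [exact: Cf.1|exact: f0].
split=> [x Ux|a].
  by apply: differentiableV; [exact: Cf.1|exact: f0].
have CV := IH (CkW Cf).
apply: Ck_congr (CkM (CkN (Cf.2 a)) (CkM CV CV)) => y Uy /=.
rewrite /partial deriveV; [|exact: f0|by apply: diff_derivable; exact: Cf.1].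
by rewrite -[_ *: _]/(_ * _) !mulNr mulrC expr2 invfM.
Qed.

Lemma smoothD (W : normedModType R) (f h : 'rV[R]_n -> W) :
  smooth_on U f -> smooth_on U h -> smooth_on U (f \+ h).
Proof. by rewrite !smooth_onP => sf sh k; exact: CkD. Qed.

Lemma smoothN (W : normedModType R) (f : 'rV[R]_n -> W) :
  smooth_on U f -> smooth_on U (\- f).
Proof. by rewrite !smooth_onP => sf k; exact: CkN. Qed.

Lemma smoothM f h : smooth_on U f -> smooth_on U h -> smooth_on U (f \* h).
Proof. by rewrite !smooth_onP => sf sh k; exact: CkM. Qed.

Lemma smooth_cst (W : normedModType R) (c : W) : smooth_on U (fun=> c : W).
Proof. by rewrite smooth_onP => k; exact: Ck_cst. Qed.

Lemma smoothV f : (forall x, U x -> f x != 0) -> smooth_on U f ->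
  smooth_on U (fun x => (f x)^-1).
Proof. by move=> f0; rewrite !smooth_onP => sf k; exact: CkV. Qed.

Lemma differentiable_entry p q (M : 'rV[R]_n -> 'M[R]_(p.+1, q.+1)) i j x :
  differentiable M x -> differentiable (fun y => M y i j) x.
Proof.
move=> dM; exact: (differentiable_comp dM (differentiable_coord (M x) i j)).
Qed.

Lemma partial_entry p q a (M : 'rV[R]_n -> 'M[R]_(p.+1, q.+1)) i j x :
  differentiable M x -> partial a M x i j = partial a (fun y => M y i j) x.
Proof. by move=> dM; rewrite /partial derive_mx ?mxE //; exact: diff_derivable. Qed.

Lemma smooth_entry p q (M : 'rV[R]_n -> 'M[R]_(p.+1, q.+1)) i j :
  smooth_on U M -> smooth_on U (fun y => M y i j).
Proof.
rewrite !smooth_onP => sM k; elim: k M {sM}(sM k) => [|k IH] M [dM CM].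
  by split=> // x Ux; apply: differentiable_entry; exact: dM.
split=> [x Ux|a]; first by apply: differentiable_entry; exact: dM.
by apply: Ck_congr (IH _ (CM a)) => y Uy; rewrite partial_entry //; exact: dM.
Qed.
End Open.
End Smooth.

(** * Symmetry of second derivatives *)

Section Schwarz.
Context (R : realType) (V : normedModType R).
Implicit Types (f : V -> R) (x y u v : V) (s t : R).

Lemma derive_line f y v s : differentiable f (y + s *: v) ->
  is_derive s 1 (fun r => f (y + r *: v)) ('D_v f (y + s *: v)).
Proof.
move=> df; have dv : derivable f (y + s *: v) v by exact: diff_derivable.
have e : (fun h => h^-1 *: ((f \o shift (y + s *: v)) (h *: v) - f (y + s *: v))) =
  (fun h => h^-1 *: (((fun r => f (y + r *: v)) \o shift s) (h *: 1)
     - f (y + s *: v))).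
  apply/funext => h /=; congr (_ *: (f _ - _)).
  by rewrite -[h *: 1]/(h * 1) mulr1 scalerDl addrCA.
by apply: DeriveDef; rewrite /derivable /derive -e.
Qed.

Lemma MVT_line f y v t : 0 <= t ->
  (forall s, 0 <= s <= t -> differentiable f (y + s *: v)) ->
  exists2 c, 0 <= c <= t & f (y + t *: v) - f y = 'D_v f (y + c *: v) * t.
Proof.
move=> t0 df; have [] := @MVT_segment R (fun r => f (y + r *: v))
    (fun s => 'D_v f (y + s *: v)) 0 t t0.
- move=> s; rewrite in_itv /= => /andP[s0 st]; apply: derive_line; apply: df.
  by rewrite !ltW.
- apply: derivable_within_continuous => s; rewrite in_itv /= => sI.
  by have [] := derive_line (df s sI).
- move=> c; rewrite in_itv /= => cI; rewrite scale0r addr0 subr0 => ->; by exists c.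
Qed.

(** The second difference over a parallelogram is a first difference of y ↦ f(y + t v) - f(y) in the
    direction u; the mean value theorem applies to it, and then once more in the direction v. *)
Lemma MVT_square f x u v t : 0 <= t ->
  (forall r s, 0 <= r <= t -> 0 <= s <= t -> differentiable f (x + r *: u + s *: v)) ->
  (forall r s, 0 <= r <= t -> 0 <= s <= t ->
     differentiable ('D_u f) (x + r *: u + s *: v)) ->
  exists r s, [/\ 0 <= r <= t, 0 <= s <= t &
    f (x + t *: u + t *: v) - f (x + t *: u) - (f (x + t *: v) - f x) =
    'D_v ('D_u f) (x + r *: u + s *: v) * t * t].
Proof.
move=> t0 df dd; have t0t : 0 <= t <= t by rewrite t0 lexx.
have z0t : 0 <= (0 : R) <= t by rewrite lexx.
pose h y := f (y + t *: v) - f y.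
have fs s : 0 <= s <= t -> differentiable f (x + s *: u + t *: v) /\
    differentiable f (x + s *: u).
  by move=> sI; split; [exact: df|have := df s 0 sI z0t; rewrite scale0r addr0].
have dsh s : 0 <= s <= t ->
    differentiable (fun y => f (y + t *: v)) (x + s *: u) /\
    'D_u (fun y => f (y + t *: v)) (x + s *: u) = 'D_u f (x + s *: u + t *: v).
  move=> sI; have [d1 d2] := fs s sI; split.
    by apply: (@differentiable_comp _ _ _ _ (fun y => y + t *: v) f).
  rewrite /derive; set F1 := (fun h0 => _); set F2 := (fun h0 => _).
  suff -> : F1 = F2 by [].
  by apply/funext => r; rewrite /F1 /F2 /= !addrA.
have dh s : 0 <= s <= t -> differentiable h (x + s *: u).
  by move=> sI; apply: (@differentiableB _ _ _ (fun y => f (y + t *: v)) f);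
    [exact: (dsh s sI).1|exact: (fs s sI).2].
have [r rI] := MVT_line t0 dh.
rewrite /h => ->.
have -> : 'D_u h (x + r *: u) = 'D_u f (x + r *: u + t *: v) - 'D_u f (x + r *: u).
  rewrite /h deriveB; last by apply: diff_derivable; exact: (fs r rI).2.
    by rewrite (dsh r rI).2.
  by apply: diff_derivable; exact: (dsh r rI).1.
have [s sI ->] := MVT_line t0 (fun s sI => dd r s rI sI).
by exists r, s.
Qed.

(** The second difference is symmetric in u and v, so by [MVT_square] the two mixed derivatives take
    a common value at points arbitrarily close to x; continuity brings both within e / 2 of it. *)
Lemma derive_comm f x u v :
  (\forall y \near x, differentiable f y) ->
  (\forall y \near x, differentiable ('D_u f) y) ->
  (\forall y \near x, differentiable ('D_v f) y) ->
  {for x, continuous ('D_v ('D_u f))} -> {for x, continuous ('D_u ('D_v f))} ->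
  'D_v ('D_u f) x = 'D_u ('D_v f) x.
Proof.
move=> df du dv cvu cuv; apply/eqP; rewrite -subr_eq0 -normr_le0.
apply/ler_addgt0Pl => e e0; rewrite addr0 ltW //.
have e2 : 0 < e / 2 by rewrite divr_gt0.
have n1 : \forall y \near x, `|'D_v ('D_u f) x - 'D_v ('D_u f) y| < e / 2.
  by have /cvgrPdist_lt/(_ _ e2) := cvu.
have n2 : \forall y \near x, `|'D_u ('D_v f) x - 'D_u ('D_v f) y| < e / 2.
  by have /cvgrPdist_lt/(_ _ e2) := cuv.
have := filterI (filterI df (filterI du dv)) (filterI n1 n2).
move=> /(_ _ _ _ _)/nbhs_ballP[d /= d0 dP].
(* The added 1 keeps c positive when u = v = 0; with t c = d / 2 both parallelograms lie in the ball
   of radius d. *)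
pose c := `|u| + `|v| + 1.
have c0 : 0 < c by rewrite /c; have := normr_ge0 u; have := normr_ge0 v; lra.
pose t := d / 2 / c.
have t0 : 0 < t by rewrite /t !divr_gt0.
have P r s : 0 <= r <= t -> 0 <= s <= t ->
  ball x d (x + r *: u + s *: v).
  move=> /andP[r0 rt] /andP[s0 st]; rewrite -ball_normE /=.
  rewrite opprD opprD addrA addrA subrr sub0r -opprD normrN.
  apply: le_lt_trans (ler_normD _ _) _; rewrite !normrZ !ger0_norm //.
  have h1 : r * `|u| <= t * `|u| by rewrite ler_wpM2r.
  have h2 : s * `|v| <= t * `|v| by rewrite ler_wpM2r.
  have h3 : t * (`|u| + `|v| + 1) = d / 2 by rewrite /t -/c divfK ?gt_eqF.
  nra.
have [r [s [rI sI E1]]] := MVT_square (ltW t0)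
  (fun r s rI sI => (dP _ (P r s rI sI)).1.1) (fun r s rI sI => (dP _ (P r s rI sI)).1.2.1).
have P' r' s' : 0 <= r' <= t -> 0 <= s' <= t -> ball x d (x + r' *: v + s' *: u).
  by move=> rI' sI'; rewrite addrAC; exact: P.
have [r' [s' [rI' sI' E2]]] := MVT_square (ltW t0)
  (fun r s rI sI => (dP _ (P' r s rI sI)).1.1) (fun r s rI sI => (dP _ (P' r s rI sI)).1.2.2).
have /dP[_ [b1 _]] := P r s rI sI.
have /dP[_ [_ b2]] := P' r' s' rI' sI'.
have E : 'D_v ('D_u f) (x + r *: u + s *: v) = 'D_u ('D_v f) (x + r' *: v + s' *: u).
  have tn0 : t != 0 by rewrite gt_eqF.
  apply: (mulIf tn0); apply: (mulIf tn0).
  apply: etrans (esym E1) (etrans _ E2); rewrite (addrAC x (t *: v)).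
  by move: (f _) (f _) (f _) (f _) => *; ring.
rewrite {}E in b1; set w := 'D_u ('D_v f) (x + _ + _) in b1 b2.
move: b1 b2; move: ('D_v _ x) ('D_u _ x) (w) => X Y W b1 b2.
have -> : X - Y = (X - W) - (Y - W) by ring.
by apply: le_lt_trans (ler_normB _ _) _; clear -b1 b2; lra.
Qed.
End Schwarz.

Lemma smooth_partial_comm (R : realType) n (U : set 'rV[R]_n) (oU : open U)
    (f : 'rV[R]_n -> R) a b x : smooth_on U f -> U x ->
  partial a (partial b f) x = partial b (partial a f) x.
Proof.
move=> sf Ux; have sa := smooth_partial a sf; have sb := smooth_partial b sf.
apply: derive_comm.
- by apply: near_open Ux _ => // y; exact: smooth_differentiable sf.
- by apply: near_open Ux _ => // y; exact: smooth_differentiable sb.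
- by apply: near_open Ux _ => // y; exact: smooth_differentiable sa.
- by apply: differentiable_continuous;
    exact: smooth_differentiable (smooth_partial a sb) Ux.
- by apply: differentiable_continuous;
    exact: smooth_differentiable (smooth_partial b sa) Ux.
Qed.

(** * The ring of smooth complex functions *)

(** The point makes the ring of functions nontrivial: 1 and 0 differ there. *)
Record pointed_open (R : realType) n := PointedOpen {
  dset : set 'rV[R]_n;
  dset_open : open dset;
  dpoint : 'rV[R]_n;
  dpointP : dset dpoint }.

Arguments dset_open {R n} p.
Arguments dpointP {R n} p.

Section SmoothRing.
Context (R : realType) (n : nat) (U : pointed_open R n).
Implicit Types (f h : 'rV[R]_n -> R[i]) (r : 'rV[R]_n -> R) (x : 'rV[R]_n).
Local Notation US := (dset U).
Let oU := dset_open U.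

(* Functions on [U] are extended by zero, so that two of them are equal as soon as
   they agree on [U]. *)
Definition smooth_complex f : Prop :=
  [/\ smooth_on US (fun x => complex.Re (f x)),
      smooth_on US (fun x => complex.Im (f x)) & forall x, ~ US x -> f x = 0].

Record smooth_fun := SmoothFun {
  smooth_val :> 'rV[R]_n -> R[i];
  _ : `[< smooth_complex smooth_val >] }.

HB.instance Definition _ := [isSub for smooth_val].
HB.instance Definition _ := [Choice of smooth_fun by <:].

Lemma smooth_valP (F : smooth_fun) : smooth_complex F.
Proof. by case: F => f Ff; move/asboolP: (Ff). Qed.

Definition mk_smooth f (fP : smooth_complex f) : smooth_fun := SmoothFun (asboolT fP).

Lemma smooth_fun_ext (F H : smooth_fun) : (forall x, US x -> F x = H x) -> F = H.
Proof.
move=> FH; apply/val_inj/funext => x /=.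
have [Ux|nUx] := pselect (US x); first exact: FH.
have [_ _ F0] := smooth_valP F; have [_ _ H0] := smooth_valP H.
by rewrite F0 // H0.
Qed.

Lemma complex_congr (a b c d : R) : a = c -> b = d -> (a +i* b = c +i* d)%C.
Proof. by move=> -> ->. Qed.

Lemma ReD (a b : R[i]) : complex.Re (a + b) = complex.Re a + complex.Re b.
Proof. by case: a; case: b. Qed.
Lemma ImD (a b : R[i]) : complex.Im (a + b) = complex.Im a + complex.Im b.
Proof. by case: a; case: b. Qed.
Lemma ReN (a : R[i]) : complex.Re (- a) = - complex.Re a.
Proof. by case: a. Qed.
Lemma ImN (a : R[i]) : complex.Im (- a) = - complex.Im a.
Proof. by case: a. Qed.
Lemma ReM (a b : R[i]) : complex.Re (a * b) =
  complex.Re a * complex.Re b - complex.Im a * complex.Im b.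
Proof. by case: a; case: b. Qed.
Lemma ImM (a b : R[i]) : complex.Im (a * b) =
  complex.Re a * complex.Im b + complex.Im a * complex.Re b.
Proof. by case: a; case: b. Qed.

Lemma smooth_complexD f h : smooth_complex f -> smooth_complex h ->
  smooth_complex (fun x => f x + h x).
Proof.
move=> [f1 f2 f0] [h1 h2 h0]; split.
- by apply: smooth_congr (smoothD oU f1 h1) => // y _; rewrite ReD.
- by apply: smooth_congr (smoothD oU f2 h2) => // y _; rewrite ImD.
- by move=> x nx; rewrite f0 // h0 // addr0.
Qed.

Lemma smooth_complexN f : smooth_complex f -> smooth_complex (fun x => - f x).
Proof.
move=> [f1 f2 f0]; split.
- by apply: smooth_congr (smoothN oU f1) => // y _; rewrite ReN.
- by apply: smooth_congr (smoothN oU f2) => // y _; rewrite ImN.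
- by move=> x nx; rewrite f0 // oppr0.
Qed.

Lemma smooth_complexM f h : smooth_complex f -> smooth_complex h ->
  smooth_complex (fun x => f x * h x).
Proof.
move=> [f1 f2 f0] [h1 h2 h0]; split.
- apply: smooth_congr (smoothD oU (smoothM oU f1 h1) (smoothN oU (smoothM oU f2 h2))) => //.
  by move=> y _; rewrite ReM.
- apply: smooth_congr (smoothD oU (smoothM oU f1 h2) (smoothM oU f2 h1)) => //.
  by move=> y _; rewrite ImM.
- by move=> x nx; rewrite f0 // mul0r.
Qed.

Definition extend r x : R[i] := if `[< US x >] then (r x)%:C%C else 0.

Lemma extendE r x : US x -> extend r x = (r x)%:C%C.
Proof. by rewrite /extend => /asboolT ->. Qed.

Lemma smooth_extend r : smooth_on US r -> smooth_complex (extend r).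
Proof.
move=> sr; split.
- by apply: smooth_congr sr => // y Uy; rewrite extendE.
- by apply: smooth_congr (smooth_cst oU 0) => // y Uy; rewrite extendE.
- by move=> x /asboolF nx; rewrite /extend nx.
Qed.

Definition lift r (sr : smooth_on US r) : smooth_fun := mk_smooth (smooth_extend sr).

Lemma liftE r (sr : smooth_on US r) x : US x -> lift sr x = (r x)%:C%C.
Proof. exact: extendE. Qed.

Definition sf0 := lift (smooth_cst oU (0 : R)).
Definition sf1 := lift (smooth_cst oU (1 : R)).
Definition sfD (F H : smooth_fun) :=
  mk_smooth (smooth_complexD (smooth_valP F) (smooth_valP H)).
Definition sfN (F : smooth_fun) := mk_smooth (smooth_complexN (smooth_valP F)).
Definition sfM (F H : smooth_fun) :=
  mk_smooth (smooth_complexM (smooth_valP F) (smooth_valP H)).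

Lemma sfDA : associative sfD.
Proof. by move=> F H G; apply: smooth_fun_ext => x _ /=; rewrite addrA. Qed.
Lemma sfDC : commutative sfD.
Proof. by move=> F H; apply: smooth_fun_ext => x _ /=; rewrite addrC. Qed.
Lemma sf0D : left_id sf0 sfD.
Proof. by move=> F; apply: smooth_fun_ext => x Ux /=; rewrite extendE // add0r. Qed.
Lemma sfND : left_inverse sf0 sfN sfD.
Proof. by move=> F; apply: smooth_fun_ext => x Ux /=; rewrite extendE // addNr. Qed.
HB.instance Definition _ := GRing.isZmodule.Build smooth_fun sfDA sfDC sf0D sfND.

Lemma sfMA : associative sfM.
Proof. by move=> F H G; apply: smooth_fun_ext => x _ /=; rewrite mulrA. Qed.
Lemma sfMC : commutative sfM.
Proof. by move=> F H; apply: smooth_fun_ext => x _ /=; rewrite mulrC. Qed.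
Lemma sf1M : left_id sf1 sfM.
Proof. by move=> F; apply: smooth_fun_ext => x Ux /=; rewrite extendE // mul1r. Qed.
Lemma sfMD : left_distributive sfM sfD.
Proof. by move=> F H G; apply: smooth_fun_ext => x _ /=; rewrite mulrDl. Qed.
Lemma sf1_neq0 : sf1 != sf0.
Proof.
apply/eqP => /(congr1 (fun F : smooth_fun => F (dpoint U))) /=.
by rewrite !extendE; try exact: dpointP; case=> /eqP; rewrite oner_eq0.
Qed.
HB.instance Definition _ := GRing.Zmodule_isComNzRing.Build smooth_fun
  sfMA sfMC sf1M sfMD sf1_neq0.

(* Evaluation is only a ring morphism at points of [US], so [ev] takes the
   membership proof as an argument. *)
Definition ev x (Ux : US x) (F : smooth_fun) : R[i] := F x.

Section Eval.
Context (x : 'rV[R]_n) (Ux : US x).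
Fact ev_is_zmod_morphism : zmod_morphism (ev Ux).
Proof. by []. Qed.
Fact ev_is_monoid_morphism : monoid_morphism (ev Ux).
Proof. by split=> //; rewrite /ev /= extendE. Qed.
HB.instance Definition _ := GRing.isZmodMorphism.Build smooth_fun R[i] (ev Ux)
  ev_is_zmod_morphism.
HB.instance Definition _ := GRing.isMonoidMorphism.Build smooth_fun R[i] (ev Ux)
  ev_is_monoid_morphism.
End Eval.

Lemma ev_ext (F H : smooth_fun) : (forall x (Ux : US x), ev Ux F = ev Ux H) -> F = H.
Proof. by move=> FH; apply: smooth_fun_ext => x Ux; exact: FH. Qed.

Definition der_fun a (F : 'rV[R]_n -> R[i]) x : R[i] :=
  if `[< US x >] then (partial a (fun y => complex.Re (F y)) x
    +i* partial a (fun y => complex.Im (F y)) x)%C else 0.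

Lemma der_funE a F x : US x -> der_fun a F x =
  (partial a (fun y => complex.Re (F y)) x
    +i* partial a (fun y => complex.Im (F y)) x)%C.
Proof. by rewrite /der_fun => /asboolT ->. Qed.

Lemma smooth_der a F : smooth_complex F -> smooth_complex (der_fun a F).
Proof.
move=> [f1 f2 f0]; split.
- by apply: smooth_congr (smooth_partial a f1) => // y Uy; rewrite der_funE.
- by apply: smooth_congr (smooth_partial a f2) => // y Uy; rewrite der_funE.
- by move=> x /asboolF nx; rewrite /der_fun nx.
Qed.

Definition sf_der a (F : smooth_fun) : smooth_fun := mk_smooth (smooth_der a (smooth_valP F)).

Lemma sf_derD a F H : sf_der a (F + H) = sf_der a F + sf_der a H.
Proof.
have [f1 f2 _] := smooth_valP F; have [h1 h2 _] := smooth_valP H.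
apply: smooth_fun_ext => x Ux; rewrite /= !der_funE //.
apply: complex_congr.
  rewrite -partialD; try exact: smooth_differentiable Ux.
  by apply: partial_congr Ux => // y _; rewrite ReD.
rewrite -partialD; try exact: smooth_differentiable Ux.
by apply: partial_congr Ux => // y _; rewrite ImD.
Qed.

Lemma sf_derM a F H : sf_der a (F * H) = sf_der a F * H + F * sf_der a H.
Proof.
have [f1 f2 _] := smooth_valP F; have [h1 h2 _] := smooth_valP H.
apply: smooth_fun_ext => x Ux; rewrite /= !der_funE //.
have d1 := smooth_differentiable f1 Ux; have d2 := smooth_differentiable f2 Ux.
have e1 := smooth_differentiable h1 Ux; have e2 := smooth_differentiable h2 Ux.
have -> : partial a (fun y => complex.Re ((F * H) y)) x =
    partial a ((fun y => complex.Re (F y)) \* (fun y => complex.Re (H y))) x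
    - partial a ((fun y => complex.Im (F y)) \* (fun y => complex.Im (H y))) x.
  rewrite -partialN; last exact: differentiableM.
  rewrite -partialD; [|exact: differentiableM|by apply: differentiableN; exact: differentiableM].
  by apply: partial_congr Ux => // y _; rewrite ReM.
have -> : partial a (fun y => complex.Im ((F * H) y)) x =
    partial a ((fun y => complex.Re (F y)) \* (fun y => complex.Im (H y))) x
    + partial a ((fun y => complex.Im (F y)) \* (fun y => complex.Re (H y))) x.
  rewrite -partialD; try exact: differentiableM.
  by apply: partial_congr Ux => // y _; rewrite ImM.
rewrite !partialM //; case: (F x) => fr fi; case: (H x) => hr hi /=.
by apply/eqP; rewrite eq_complex /=; apply/andP; split; apply/eqP; ring.
Qed.

Lemma sf_der_comm a b F : sf_der a (sf_der b F) = sf_der b (sf_der a F).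
Proof.
have [f1 f2 _] := smooth_valP F.
apply: smooth_fun_ext => x Ux; rewrite /= !(der_funE _ _ Ux).
have e r c d : smooth_on US r -> forall g, (forall y, US y -> g y = partial d r y) ->
    partial c g x = partial c (partial d r) x.
  by move=> sr g gE; apply: partial_congr Ux.
apply: complex_congr.
  rewrite (e _ a b f1); last by move=> y Uy; rewrite der_funE.
  rewrite (e _ b a f1); last by move=> y Uy; rewrite der_funE.
  exact: smooth_partial_comm f1 Ux.
rewrite (e _ a b f2); last by move=> y Uy; rewrite der_funE.
rewrite (e _ b a f2); last by move=> y Uy; rewrite der_funE.
exact: smooth_partial_comm f2 Ux.
Qed.

Definition smooth_derivations := Derivations sf_derD sf_derM sf_der_comm.

(** A relation, so that the coordinate formulas over K and over the reals are matched operation by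
    operation; smoothness of r then comes for free, by [represents_smooth]. *)
Definition represents (F : smooth_fun) (r : 'rV[R]_n -> R) :=
  forall x (Ux : US x), ev Ux F = (r x)%:C%C.

Lemma represents_lift r (sr : smooth_on US r) : represents (lift sr) r.
Proof. by move=> x Ux; exact: liftE. Qed.

Lemma represents_der a F r : represents F r -> represents (smooth_derivations a F) (partial a r).
Proof.
move=> Fr x Ux; rewrite /ev /= der_funE //.
have -> : partial a (fun y => complex.Re (F y)) x = partial a r x.
  by apply: partial_congr Ux => // y Uy; have := Fr y Uy; rewrite /ev => ->.
have -> : partial a (fun y => complex.Im (F y)) x = partial a (fun=> 0) x.
  by apply: partial_congr Ux => // y Uy; have := Fr y Uy; rewrite /ev => ->.
by rewrite /partial derive_cst.
Qed.
End SmoothRing.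

(** * Arithmetic of represented functions, and the constant i *)

Section Represents.
Context (R : realType) (n : nat) (U : pointed_open R n).
Local Notation K := (smooth_fun U).
Local Notation D := (smooth_derivations U).
Implicit Types (F H : K) (r s : 'rV[R]_n -> R).

Lemma represents_eq F r s : represents F r -> (forall x, dset U x -> r x = s x) ->
  represents F s.
Proof. by move=> Fr rs x Ux; rewrite Fr rs. Qed.

Lemma rcD (a b : R) : ((a + b)%:C = a%:C + b%:C)%C.
Proof. exact: (rmorphD (real_complex R)). Qed.
Lemma rcN (a : R) : ((- a)%:C = - a%:C)%C.
Proof. exact: (rmorphN (real_complex R)). Qed.
Lemma rcM (a b : R) : ((a * b)%:C = a%:C * b%:C)%C.
Proof. exact: (rmorphM (real_complex R)). Qed.
Lemma rc_sum (I : finType) (f : I -> R) :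
  ((\sum_i f i)%:C = \sum_i (f i)%:C)%C.
Proof. exact: (rmorph_sum (real_complex R)). Qed.

Section Ev.
Context (x : 'rV[R]_n) (Ux : dset U x).
Lemma evD F H : ev Ux (F + H) = ev Ux F + ev Ux H.
Proof. exact: (rmorphD (ev Ux)). Qed.
Lemma evN F : ev Ux (- F) = - ev Ux F.
Proof. exact: (rmorphN (ev Ux)). Qed.
Lemma evM F H : ev Ux (F * H) = ev Ux F * ev Ux H.
Proof. exact: (rmorphM (ev Ux)). Qed.
Lemma ev0 : ev Ux 0 = 0.
Proof. exact: (rmorph0 (ev Ux)). Qed.
Lemma ev1 : ev Ux 1 = 1.
Proof. exact: (rmorph1 (ev Ux)). Qed.
Lemma ev_nat m : ev Ux m%:R = m%:R.
Proof. exact: (rmorph_nat (ev Ux)). Qed.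
Lemma ev_sum (I : finType) (f : I -> K) : ev Ux (\sum_i f i) = \sum_i ev Ux (f i).
Proof. exact: (rmorph_sum (ev Ux)). Qed.
End Ev.

Lemma representsD F H r s : represents F r -> represents H s ->
  represents (F + H) (fun x => r x + s x).
Proof.
by move=> Fr Hs x Ux; rewrite evD Fr Hs rcD.
Qed.

Lemma representsN F r : represents F r -> represents (- F) (fun x => - r x).
Proof.
by move=> Fr x Ux; rewrite evN Fr rcN.
Qed.

Lemma representsB F H r s : represents F r -> represents H s ->
  represents (F - H) (fun x => r x - s x).
Proof. by move=> Fr Hs; apply: representsD => //; exact: representsN. Qed.

Lemma representsM F H r s : represents F r -> represents H s ->
  represents (F * H) (fun x => r x * s x).
Proof.
by move=> Fr Hs x Ux; rewrite evM Fr Hs rcM.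
Qed.

Lemma represents_sum (I : finType) (F : I -> K) (r : I -> 'rV[R]_n -> R) :
  (forall i, represents (F i) (r i)) ->
  represents (\sum_i F i) (fun x => \sum_i r i x).
Proof.
move=> Fr x Ux; rewrite ev_sum rc_sum; apply: eq_bigr => i _; exact: Fr.
Qed.

Definition cstK (c : R) : K := lift (smooth_cst (dset_open U) c).

Lemma represents_cst c : represents (cstK c) (fun=> c).
Proof. exact: represents_lift. Qed.

Lemma represents_smooth F r : represents F r -> smooth_on (dset U) r.
Proof.
move=> Fr; have [F1 _ _] := smooth_valP F.
apply: smooth_congr F1; first exact: dset_open.
by move=> y Uy; have := Fr y Uy; rewrite /ev => ->.
Qed.

Lemma represents_inv F r : represents F r -> (forall x, dset U x -> r x != 0) ->
  exists2 H, F * H = 1 & represents H (fun x => (r x)^-1).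
Proof.
move=> Fr r0.
have sV : smooth_on (dset U) (fun x => (r x)^-1).
  by apply: smoothV => //; [exact: dset_open|exact: represents_smooth Fr].
exists (lift sV); last exact: represents_lift.
apply: ev_ext => x Ux; rewrite evM ev1 Fr represents_lift -rcM divff //.
exact: r0.
Qed.

Lemma halfKD : cstK 2^-1 + cstK 2^-1 = 1.
Proof.
apply: ev_ext => x Ux; rewrite evD ev1 represents_cst -rcD.
by rewrite (_ : 2^-1 + 2^-1 = 1 :> R) //; field.
Qed.

Lemma twelfthKE : cstK 12^-1 * 12 = 1.
Proof.
apply: ev_ext => x Ux; rewrite evM ev1 ev_nat represents_cst.
have -> : 12%:R = (12%:R%:C)%C :> R[i] by rewrite (rmorph_nat (real_complex R)).
by rewrite -rcM mulVf // pnatr_eq0.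
Qed.

Fact smooth_i : smooth_complex U (fun x => if `[< dset U x >] then 'i%C else 0).
Proof.
have oU := dset_open U; split.
- by apply: smooth_congr (smooth_cst oU (0 : R)) => // y /asboolT ->.
- by apply: smooth_congr (smooth_cst oU (1 : R)) => // y /asboolT ->.
- by move=> x /asboolF ->.
Qed.

Definition iK : K := mk_smooth smooth_i.

Lemma ev_iK x (Ux : dset U x) : ev Ux iK = 'i%C.
Proof. by rewrite /ev /= asboolT. Qed.

Lemma iK2 : iK * iK = -1.
Proof.
by apply: ev_ext => x Ux; rewrite evM evN ev1 ev_iK -expr2 sqr_i.
Qed.

(** Differentiating i^2 = -1 gives 2 i ∂i = 0, and both 2 and i are invertible in K. *)
Lemma der_iK a : D a iK = 0.
Proof.
have := der_comm D; have i4 : D a (iK * iK) = 0.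
  by rewrite iK2; have := derD D a (-1) 1; rewrite addNr (der1 D) addr0 (der0 D).
move=> _; rewrite derM mulrC -mulr2n in i4.
have : iK * (- iK) = 1 by rewrite mulrN iK2 opprK.
move=> ii; have : (- iK) * ((iK * D a iK) *+ 2) = 0.
  by rewrite i4 mulr0.
rewrite mulrnAr mulrA [- iK * _]mulrC ii mul1r mulr2n => dd.
by rewrite -[LHS]mul1r -halfKD mulrDl -mulrDr dd mulr0.
Qed.

End Represents.

(** * Curvature of the metric over the ring of smooth functions *)

Section LiftGeometry.
Context (R : realType) (U : pointed_open R 4) (g : 'rV[R]_4 -> 'M[R]_4).
Hypothesis g_smooth : smooth_on (dset U) g.
Hypothesis g_sym : forall x, dset U x -> (g x)^T = g x.
Hypothesis g_pos : forall x (v : 'rV[R]_4), dset U x -> v != 0 ->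
  0 < (v *m g x *m v^T) 0 0.
Local Notation K := (smooth_fun U).
Local Notation D := (smooth_derivations U).
Local Notation oU := (dset_open U).
Local Notation half := (cstK U 2^-1).
Local Notation twelfth := (cstK U 12^-1).
Local Notation rc := (real_complex R).

Definition lift_mx (A : 'rV[R]_4 -> 'M[R]_4) (sA : smooth_on (dset U) A) : 'M[K]_4 :=
  \matrix_(a, b) lift (smooth_entry oU a b sA).

Lemma lift_mxE A (sA : smooth_on (dset U) A) a b :
  represents (lift_mx sA a b) (fun x => A x a b).
Proof. by rewrite mxE; exact: represents_lift. Qed.

Lemma ev_lift_mx A (sA : smooth_on (dset U) A) x (Ux : dset U x) :
  map_mx (ev Ux) (lift_mx sA) = map_mx rc (A x).
Proof. by apply/matrixP => a b; rewrite mxE lift_mxE mxE. Qed.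

Lemma ev_mx_inj p q (A B : 'M[K]_(p, q)) :
  (forall x (Ux : dset U x), map_mx (ev Ux) A = map_mx (ev Ux) B) -> A = B.
Proof.
move=> AB; apply/matrixP => i j; apply: ev_ext => x Ux.
by have /matrixP/(_ i j) := AB x Ux; rewrite !mxE.
Qed.

Local Notation G := (lift_mx g_smooth).

Lemma lift_metric_sym : G^T = G.
Proof.
apply: ev_mx_inj => x Ux; rewrite -map_trmx ev_lift_mx map_trmx g_sym //.
Qed.

Lemma metric_unit x : dset U x -> g x \in unitmx.
Proof.
move=> Ux; rewrite -row_free_unit -kermx_eq0; apply/eqP/row_matrixP => i.
rewrite row0; apply/eqP; apply/negPn/negP => v0.
have := g_pos Ux v0; rewrite -row_mul mulmx_ker row0 mul0mx mxE ltxx; exact.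
Qed.

(** The inverse is the adjugate divided by the determinant: its entries are polynomial in those of G
    and one reciprocal function, that of the determinant. *)
Lemma metric_inverse : exists2 Gi : 'M[K]_4, G *m Gi = 1%:M &
  forall a b, represents (Gi a b) (fun x => ginv g x a b).
Proof.
have rdet : represents (\det G) (fun x => \det (g x)).
  move=> x Ux; rewrite -[LHS](det_map_mx (ev Ux)) ev_lift_mx.
  exact: (det_map_mx rc).
have [di dd _] := represents_inv rdet
  (fun x Ux => etrans (esym (unitfE _)) (metric_unit Ux)).
have GGi : G *m (di *: \adj G) = 1%:M.
  by rewrite -scalemxAr mul_mx_adj -mul_scalar_mx -scalar_mxM mulrC dd.
exists (di *: \adj G) => // a b x Ux; rewrite /ginv.
have : map_mx rc (g x) *m map_mx (ev Ux) (di *: \adj G) = 1%:M.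
  by rewrite -ev_lift_mx -map_mxM GGi map_mx1.
have : map_mx rc (invmx (g x)) *m map_mx rc (g x) = 1%:M.
  by rewrite -map_mxM mulVmx ?map_mx1 // metric_unit.
move=> e1 e2; have : map_mx (ev Ux) (di *: \adj G) = map_mx rc (invmx (g x)).
  by rewrite -[LHS]mul1mx -e1 -mulmxA e2 mulmx1.
by move=> /matrixP/(_ a b); rewrite !mxE.
Qed.

Context (Gi : 'M[K]_4).
Hypothesis GGi : G *m Gi = 1%:M.
Hypothesis GiE : forall a b, represents (Gi a b) (fun x => ginv g x a b).

Lemma represents_christoffel c a b :
  represents (christoffelK D G Gi half c a b) (christoffel g c a b).
Proof.
apply: representsM; first exact: represents_cst.
apply: represents_sum => d; apply: representsM; first exact: GiE.
by apply: representsB; [apply: representsD|]; apply: represents_der; exact: lift_mxE.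
Qed.

Lemma represents_riemann a b c d :
  represents (riemannK D G Gi half a b c d) (riemann g a b c d).
Proof.
have rch := represents_christoffel.
apply: representsD; first by apply: representsB; apply: represents_der.
by apply: represents_sum => e; apply: representsB; apply: representsM.
Qed.

Lemma represents_riemann_low a b c d :
  represents (riemann_lowK D G Gi half a b c d) (riemann_low g a b c d).
Proof.
apply: represents_sum => e; apply: representsM; first exact: lift_mxE.
exact: represents_riemann.
Qed.

Lemma represents_ricci a b : represents (ricciK D G Gi half a b) (ricci g a b).
Proof. by apply: represents_sum => c; exact: represents_riemann. Qed.

Lemma represents_scalar : represents (scalarK D G Gi half) (scalar_curvature g).
Proof.
apply: represents_sum => a; apply: represents_sum => b.
by apply: representsM; [exact: GiE|exact: represents_ricci].
Qed.

Lemma represents_schouten a b :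
  represents (schoutenK D G Gi half twelfth a b) (schouten g a b).
Proof.
apply: representsB.
  by apply: representsM; [exact: represents_cst|exact: represents_ricci].
apply: representsM; last exact: lift_mxE.
by apply: representsM; [exact: represents_cst|exact: represents_scalar].
Qed.

Lemma represents_weyl a b c d :
  represents (weylK4 D G Gi half twelfth a b c d) (weyl g a b c d).
Proof.
have rs a' b' := represents_schouten a' b'.
apply: representsB; last by apply: representsM => //; exact: lift_mxE.
apply: representsD; last by apply: representsM => //; exact: lift_mxE.
apply: representsB; last by apply: representsM => //; exact: lift_mxE.
apply: representsD; last by apply: representsM => //; exact: lift_mxE.
exact: represents_riemann_low.
Qed.

Lemma represents_nab_schouten b c a :
  represents (nab_schoutenK D G Gi half twelfth b c a) (nabla_schouten g b c a).
Proof.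
have rs a' b' := represents_schouten a' b'; have rch := represents_christoffel.
apply: representsB.
  apply: representsB; first exact: represents_der.
  by apply: represents_sum => e; apply: representsM.
by apply: represents_sum => e; apply: representsM.
Qed.

Lemma represents_cotton a b c :
  represents (cotton4 D G Gi half twelfth a b c) (cotton g a b c).
Proof. by apply: representsB; exact: represents_nab_schouten. Qed.

Local Notation L := (coordinate_calculus D lift_metric_sym GGi (halfKD U)).
Local Notation P := (gram_form (schouten_mx_sym D twelfth lift_metric_sym GGi (halfKD U))).

Section Eval.
Context (x : 'rV[R]_4) (Ux : dset U x).
Local Notation evv := (map_mx (ev Ux)).

Lemma ev_gram (X Y : 'rV[K]_4) : ev Ux (gram G X Y) = cmetric g x (evv X) (evv Y).
Proof.
rewrite /cmetric -ev_lift_mx /gram map_trmx -!map_mxM.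
by rewrite [RHS]mxE.
Qed.

Lemma ev_weyl (X Y Z W : 'rV[K]_4) :
  ev Ux (weylK L P X Y Z W) = cweyl g x (evv X) (evv Y) (evv Z) (evv W).
Proof.
rewrite weyl_coord ev_sum; apply: eq_bigr => a _.
rewrite ev_sum; apply: eq_bigr => b _; rewrite ev_sum; apply: eq_bigr => c _.
by rewrite ev_sum; apply: eq_bigr => d _; rewrite !evM represents_weyl !mxE.
Qed.

Lemma ev_cotton (X Y Z : 'rV[K]_4) :
  ev Ux (cottonK L P X Y Z) = ccotton g x (evv X) (evv Y) (evv Z).
Proof.
rewrite cotton_coord ev_sum; apply: eq_bigr => a _.
rewrite ev_sum; apply: eq_bigr => b _; rewrite ev_sum; apply: eq_bigr => c _.
by rewrite !evM represents_cotton !mxE.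
Qed.
End Eval.
End LiftGeometry.

(** * Vector fields, Lie brackets and the Nijenhuis tensor over the ring of functions *)

Section RepresentsRow.
Context (R : realType) (n : nat) (U : pointed_open R n.+1).
Local Notation K := (smooth_fun U).
Local Notation D := (smooth_derivations U).
Implicit Types (X Y : 'rV[R]_n.+1 -> 'rV[R]_n.+1) (F H : 'rV[K]_n.+1).

Definition represents_row F X := forall c, represents (F 0 c) (fun y => X y 0 c).

Lemma derive_row X F x v c : represents_row F X -> dset U x ->
  ('D_v X x) 0 c = \sum_a v 0 a * partial a (fun y => X y 0 c) x.
Proof.
move=> FX Ux.
have dX c' : differentiable (fun y => X y 0 c') x.
  exact: smooth_differentiable (represents_smooth (FX c')) Ux.
rewrite derive_mx; last first.
  by apply/derivable_mxP => i j; rewrite (ord1 i); apply: diff_derivable; exact: dX.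
rewrite mxE deriveE; last exact: dX.
rewrite [in LHS](row_sum_delta v) linear_sum; apply: eq_bigr => a _.
by rewrite linearZ /= /partial deriveE.
Qed.

Lemma represents_bracket F H X Y : represents_row F X -> represents_row H Y ->
  represents_row (bracket D F H) (lie_bracket X Y).
Proof.
move=> FX HY c; rewrite bracketE.
have e A B A' B' : represents_row A A' -> represents_row B B' ->
    represents (mact D A B 0 c) (fun x => ('D_(A' x) B' x) 0 c).
  move=> hA hB; rewrite mxE.
  apply: (@represents_eq _ _ _ _ (fun x => \sum_a A' x 0 a * partial a (fun y => B' y 0 c) x)).
    by apply: represents_sum => a; apply: representsM; [exact: hA|apply: represents_der].
  by move=> x Ux; rewrite (derive_row _ _ hB).
have -> : (mact D F H - mact D H F) 0 c = mact D F H 0 c - mact D H F 0 c.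
  by rewrite !mxE.
apply: represents_eq (representsB (e _ _ _ _ FX HY) (e _ _ _ _ HY FX)) _ => x _.
by rewrite /lie_bracket !mxE.
Qed.
End RepresentsRow.

Section LiftNijenhuis.
Context (R : realType) (U : pointed_open R 4) (J : 'rV[R]_4 -> 'M[R]_4).
Hypothesis J_smooth : smooth_on (dset U) J.
Local Notation K := (smooth_fun U).
Local Notation D := (smooth_derivations U).
Local Notation JK := (lift_mx J_smooth).
Implicit Types (X Y : 'rV[R]_4 -> 'rV[R]_4) (F H : 'rV[K]_4).

Lemma represents_mulmx F X (A : 'M[K]_4) (B : 'rV[R]_4 -> 'M[R]_4) :
  represents_row F X -> (forall a b, represents (A a b) (fun x => B x a b)) ->
  represents_row (F *m A) (fun x => X x *m B x).
Proof.
move=> FX AB c; rewrite mxE.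
apply: (@represents_eq _ _ _ _ (fun x => \sum_a X x 0 a * B x a c)).
  by apply: represents_sum => a; apply: representsM.
by move=> x Ux; rewrite mxE.
Qed.

Lemma represents_rowD F H X Y : represents_row F X -> represents_row H Y ->
  represents_row (F + H) (fun x => X x + Y x).
Proof.
move=> FX HY c; rewrite mxE; apply: represents_eq (representsD (FX c) (HY c)) _ => x _.
by rewrite mxE.
Qed.

Lemma represents_rowB F H X Y : represents_row F X -> represents_row H Y ->
  represents_row (F - H) (fun x => X x - Y x).
Proof.
move=> FX HY c; rewrite !mxE; apply: represents_eq (representsB (FX c) (HY c)) _ => x _.
by rewrite !mxE.
Qed.

Lemma represents_nijenhuis F H X Y : represents_row F X -> represents_row H Y ->
  represents_row (nijK D JK F H) (nijenhuis J X Y).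
Proof.
move=> FX HY.
have ap A A' : represents_row A A' -> represents_row (A *m JK) (apply_end J A').
  by move=> hA; apply: represents_mulmx => // a b; exact: lift_mxE.
apply: represents_rowB; last by apply: represents_bracket; exact: ap.
apply: represents_rowD; first exact: represents_bracket.
apply: represents_mulmx; last by move=> a b; exact: lift_mxE.
by apply: represents_rowD; apply: represents_bracket => //; exact: ap.
Qed.
End LiftNijenhuis.

(** * Selfduality *)

Section VolumeForm.
Context (R : realType).
Local Notation C := R[i].
Local Notation V := 'rV[C]_4.
Implicit Types (X Y Z W : V) (a b c d e f : 'I_4).
Local Notation levi := (@levi_civita R).

Definition levi_mx (t : 4.-tuple 'I_4) : 'M[R]_4 :=
  \matrix_(r < 4, s < 4) (tnth t r == s)%:R.

Lemma det_levi_swap (t t' : 4.-tuple 'I_4) (i j : 'I_4) : i != j ->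
  (forall r, tnth t' r = tnth t (tperm i j r)) ->
  \det (levi_mx t') = - \det (levi_mx t).
Proof.
move=> ij tt'; have -> : levi_mx t' = row_perm (tperm i j) (levi_mx t).
  by apply/matrixP => r s; rewrite !mxE tt'.
by rewrite row_permE det_mulmx det_perm odd_tperm ij expr1 mulN1r.
Qed.

Lemma levi12 a b c d : levi b a c d = - levi a b c d.
Proof.
apply: (@det_levi_swap _ _ (inord 0) (inord 1)).
  by rewrite -val_eqE /= !inordK.
move=> r; case: tpermP => [->|->|].
- by rewrite !(tnth_nth a) /= !inordK.
- by rewrite !(tnth_nth a) /= !inordK.
case: r => [[|[|[|[|//]]]] hr] // r0 r1; rewrite ?(tnth_nth a) //.
  by case: r0; apply: val_inj; rewrite /= inordK.
by case: r1; apply: val_inj; rewrite /= inordK.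
Qed.

Lemma levi23 a b c d : levi a c b d = - levi a b c d.
Proof.
apply: (@det_levi_swap _ _ (inord 1) (inord 2)).
  by rewrite -val_eqE /= !inordK.
move=> r; case: tpermP => [->|->|].
- by rewrite !(tnth_nth a) /= !inordK.
- by rewrite !(tnth_nth a) /= !inordK.
case: r => [[|[|[|[|//]]]] hr] // r0 r1; rewrite ?(tnth_nth a) //.
  by case: r0; apply: val_inj; rewrite /= inordK.
by case: r1; apply: val_inj; rewrite /= inordK.
Qed.

Lemma levi34 a b c d : levi a b d c = - levi a b c d.
Proof.
apply: (@det_levi_swap _ _ (inord 2) (inord 3)).
  by rewrite -val_eqE /= !inordK.
move=> r; case: tpermP => [->|->|].
- by rewrite !(tnth_nth a) /= !inordK.
- by rewrite !(tnth_nth a) /= !inordK.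
case: r => [[|[|[|[|//]]]] hr] // r0 r1; rewrite ?(tnth_nth a) //.
  by case: r0; apply: val_inj; rewrite /= inordK.
by case: r1; apply: val_inj; rewrite /= inordK.
Qed.

(** The determinant of the four rows, that is, the volume form without its factor sqrt(det g). *)
Definition alt4 X Y Z W : C :=
  \sum_a \sum_b \sum_c \sum_d (levi a b c d)%:C%C * X 0 a * Y 0 b * Z 0 c * W 0 d.

Lemma alt4D X Y Z W W' : alt4 X Y Z (W + W') = alt4 X Y Z W + alt4 X Y Z W'.
Proof.
do 4! (rewrite -big_split; apply: eq_bigr => ? _ /=).
by rewrite mxE mulrDr.
Qed.

Lemma alt4Z r X Y Z W : alt4 X Y Z (r *: W) = r * alt4 X Y Z W.
Proof.
do 4! (rewrite mulr_sumr; apply: eq_bigr => ? _ /=).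
by rewrite mxE mulrCA.
Qed.

Lemma alt4_12 X Y Z W : alt4 Y X Z W = - alt4 X Y Z W.
Proof.
rewrite /alt4 exchange_big -sumrN; apply: eq_bigr => a _.
rewrite -sumrN; apply: eq_bigr => b _; rewrite -sumrN; apply: eq_bigr => c _.
rewrite -sumrN; apply: eq_bigr => d _; rewrite levi12 rcN; ring.
Qed.

Lemma alt4_23 X Y Z W : alt4 X Z Y W = - alt4 X Y Z W.
Proof.
rewrite /alt4 -sumrN; apply: eq_bigr => a _.
rewrite exchange_big -sumrN; apply: eq_bigr => b _.
rewrite -sumrN; apply: eq_bigr => c _; rewrite -sumrN; apply: eq_bigr => d _.
rewrite levi23 rcN; ring.
Qed.

Lemma alt4_34 X Y Z W : alt4 X Y W Z = - alt4 X Y Z W.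
Proof.
rewrite /alt4 -sumrN; apply: eq_bigr => a _; rewrite -sumrN; apply: eq_bigr => b _.
rewrite exchange_big -sumrN; apply: eq_bigr => c _; rewrite -sumrN.
by apply: eq_bigr => d _; rewrite levi34 rcN; ring.
Qed.
End VolumeForm.

Section PointwiseWeyl.
Context (R : realType) (U : pointed_open R 4) (g : 'rV[R]_4 -> 'M[R]_4).
Hypothesis g_smooth : smooth_on (dset U) g.
Hypothesis g_sym : forall x, dset U x -> (g x)^T = g x.
Local Notation K := (smooth_fun U).
Local Notation C := R[i].
Local Notation D := (smooth_derivations U).
Local Notation twelfth := (cstK U 12^-1).
Local Notation rc := (real_complex R).
Local Notation G := (lift_mx g_smooth).
Local Notation G_sym := (lift_metric_sym g_smooth g_sym).
Context (Gi : 'M[K]_4).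
Hypothesis GGi : G *m Gi = 1%:M.
Hypothesis GiE : forall a b, represents (Gi a b) (fun x => ginv g x a b).
Local Notation L := (coordinate_calculus D G_sym GGi (halfKD U)).
Local Notation P := (gram_form (schouten_mx_sym D twelfth G_sym GGi (halfKD U))).
Context (x : 'rV[R]_4) (Ux : dset U x).
Local Notation evv := (map_mx (ev Ux)).
Local Notation V := 'rV[C]_4.
Implicit Types (u v w t : V).

Definition cplxK (c : C) : K := cstK U (complex.Re c) + iK U * cstK U (complex.Im c).

Lemma ev_cplxK c : ev Ux (cplxK c) = c.
Proof. by rewrite evD evM ev_iK !represents_cst -complexE. Qed.

Lemma ev_cplxK_mx v : evv (map_mx cplxK v) = v.
Proof. by apply/rowP => a; rewrite !mxE ev_cplxK. Qed.

Let evW := @ev_weyl R U g g_smooth g_sym Gi GGi GiE x Ux.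

(** Every complex vector at x is the value of a row over K, one with constant entries, so the
    algebraic identities of the Weyl tensor over K specialise to the point. *)
Lemma ev_lift_elim (Q : V -> Prop) : (forall X : 'rV[K]_4, Q (evv X)) -> forall v, Q v.
Proof. by move=> H v; rewrite -(ev_cplxK_mx v); exact: H. Qed.

Lemma evvD (X Y : 'rV[K]_4) : evv (X + Y) = evv X + evv Y.
Proof. by apply/rowP => a; rewrite !mxE evD. Qed.

Lemma evvN (X : 'rV[K]_4) : evv (- X) = - evv X.
Proof. by apply/rowP => a; rewrite !mxE evN. Qed.

Lemma evvZ (f : K) (X : 'rV[K]_4) : evv (f *: X) = ev Ux f *: evv X.
Proof. by apply/rowP => a; rewrite !mxE evM. Qed.

Lemma cweylDl u u' v w t :
  cweyl g x (u + u') v w t = cweyl g x u v w t + cweyl g x u' v w t.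
Proof.
elim/ev_lift_elim: u => X; elim/ev_lift_elim: u' => X'; elim/ev_lift_elim: v => Y.
elim/ev_lift_elim: w => Z; elim/ev_lift_elim: t => T.
by rewrite -evvD -!evW ctDl evD.
Qed.

Lemma cweylZl (c : C) u v w t : cweyl g x (c *: u) v w t = c * cweyl g x u v w t.
Proof.
rewrite -(ev_cplxK c); elim/ev_lift_elim: u => X; elim/ev_lift_elim: v => Y.
elim/ev_lift_elim: w => Z; elim/ev_lift_elim: t => T.
by rewrite -evvZ -!evW ctZl evM.
Qed.

Lemma cweyl_antil u v w t : cweyl g x v u w t = - cweyl g x u v w t.
Proof.
elim/ev_lift_elim: u => X; elim/ev_lift_elim: v => Y.
elim/ev_lift_elim: w => Z; elim/ev_lift_elim: t => T.
by rewrite -!evW ct_antil evN.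
Qed.

Lemma cweyl_anti u v w t : cweyl g x u v t w = - cweyl g x u v w t.
Proof.
elim/ev_lift_elim: u => X; elim/ev_lift_elim: v => Y.
elim/ev_lift_elim: w => Z; elim/ev_lift_elim: t => T.
by rewrite -!evW ct_anti evN.
Qed.

Lemma cweyl_pair u v w t : cweyl g x u v w t = cweyl g x w t u v.
Proof.
elim/ev_lift_elim: u => X; elim/ev_lift_elim: v => Y.
elim/ev_lift_elim: w => Z; elim/ev_lift_elim: t => T.
by rewrite -!evW ct_pair.
Qed.

Lemma cweyl_bianchi1 u v w t :
  cweyl g x u v w t + cweyl g x u w t v + cweyl g x u t v w = 0.
Proof.
elim/ev_lift_elim: u => X; elim/ev_lift_elim: v => Y.
elim/ev_lift_elim: w => Z; elim/ev_lift_elim: t => T.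
by rewrite -!evW -!evD ct_bianchi1 ev0.
Qed.

Definition cweyl_tensor : curvature_tensor V := CurvatureTensor cweylDl cweylZl
  cweyl_antil cweyl_anti cweyl_pair cweyl_bianchi1.

Let GC_sym : (map_mx rc (g x))^T = map_mx rc (g x).
Proof. by rewrite map_trmx g_sym. Qed.

Let GC_inv : map_mx rc (g x) *m map_mx rc (ginv g x) = 1%:M.
Proof.
have <- : evv Gi = map_mx rc (ginv g x).
  by apply/matrixP => a b; rewrite mxE GiE mxE.
by rewrite -(ev_lift_mx g_smooth Ux) -map_mxM GGi map_mx1.
Qed.

Lemma null_frameP m p n k : null_frame g x m p n k <-> null_gram (map_mx rc (g x)) m p n k.
Proof.
split=> [[[h1 h2] [[h3 h4 h5 h6] [h7 h8 h9 h10]]]|[h1 h2 h3 h4 h5 h6 h7 h8 h9 h10]].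
  exact: NullGram h1 h2 h3 h4 h5 h6 h7 h8 h9 h10.
split; [exact: conj h1 h2|split].
  exact: And4 h3 h4 h5 h6.
exact: And4 h7 h8 h9 h10.
Qed.

(* The trace is computed from [ginv], so one null frame over the ring of smooth
   functions suffices to get tracelessness in all null frames at the point. *)
Lemma cweyl_traceless (M Pf N Kf : 'rV[K]_4) : null_gram G M Pf N Kf ->
  forall m p n k, null_frame g x m p n k -> ct_traceless cweyl_tensor m p n k.
Proof.
move=> ng m p n k /null_frameP fr Z T.
elim/ev_lift_elim: Z => Y; elim/ev_lift_elim: T => Y'.
pose F u v := cweyl_tensor u (evv Y) v (evv Y').
have := frame_trace GC_sym GC_inv fr (F := F); rewrite /form_trace => -> //; first last.
- by move=> *; rewrite /F ctZ3.
- by move=> *; rewrite /F ctD3.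
- by move=> *; rewrite /F ctZl.
- by move=> *; rewrite /F ctDl.
have twK := twelfthKE U.
have := weyl_frame_traceless D G_sym GGi (halfKD U) twK ng Y Y'.
have := frame_trace G_sym GGi ng (F := fun A B => weylK L P A Y B Y').
rewrite /form_trace => -> //; first last.
- by move=> *; rewrite ctZ3.
- by move=> *; rewrite ctD3.
- by move=> *; rewrite ctZl.
- by move=> *; rewrite ctDl.
move=> /(congr1 (ev Ux)); rewrite ev0 => h; apply: etrans h; apply/esym.
rewrite ev_sum; apply: eq_bigr => a _; rewrite ev_sum; apply: eq_bigr => b _.
rewrite evM GiE mxE evW /F /=; congr (_ * cweyl g x _ _ _ _);
  by apply/rowP => c; rewrite !mxE (ev_nat Ux).
Qed.
End PointwiseWeyl.

(** * The Hodge operator in a null frame *)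

Section HodgeFrame.
Context (R : realType) (g : 'rV[R]_4 -> 'M[R]_4) (x : 'rV[R]_4).
Hypothesis g_sym : (g x)^T = g x.
Hypothesis g_unit : g x \in unitmx.
Local Notation C := R[i].
Local Notation V := 'rV[C]_4.
Local Notation rc := (real_complex R).
Local Notation "''e_' a" := (delta_mx 0 a : V) (at level 8, a at level 2).
Local Notation GC := (map_mx rc (g x)).
Local Notation E := (@alt4 R).
Local Notation vol := ((Num.sqrt (\det (g x)))%:C%C).
Context (m p n k : V).
Hypothesis fr : null_frame g x m p n k.
Implicit Types (X Y Z : V) (a b c d e f : 'I_4).

Let ng : null_gram GC m p n k := (null_frameP g x m p n k).1 fr.

Let GC_sym : GC^T = GC. Proof. by rewrite map_trmx g_sym. Qed.

Let dbl0 (a : C) : a + a = 0 -> a = 0.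
Proof. by move/eqP; rewrite -mulr2n mulrn_eq0 => /eqP. Qed.

Lemma complex_ginvE a b : (ginv g x a b)%:C%C = frame_mx m p n k a b.
Proof.
have : map_mx rc (ginv g x) *m GC = 1%:M by rewrite -map_mxM mulVmx ?map_mx1.
move=> h; have : map_mx rc (ginv g x) = frame_mx m p n k.
  by rewrite -[LHS]mulmx1 -(null_gram_frame GC_sym ng) mulmxA h mul1mx.
by move=> /matrixP/(_ a b); rewrite mxE.
Qed.

Lemma ginv_contract (F : V -> C) a :
  (forall X Y, F (X + Y) = F X + F Y) -> (forall r X, F (r *: X) = r * F X) ->
  \sum_e (ginv g x a e)%:C%C * F 'e_e =
    p 0 a * F m + m 0 a * F p + k 0 a * F n + n 0 a * F k.
Proof.
move=> FD FZ; rewrite !(linear_basis FD FZ m) !(linear_basis FD FZ p).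
rewrite !(linear_basis FD FZ n) !(linear_basis FD FZ k) !mulr_sumr -!big_split.
apply: eq_bigr => e _ /=; rewrite complex_ginvE frame_mxE; ring.
Qed.

Lemma alt4_basis a b c d : E 'e_a 'e_b 'e_c 'e_d = (levi_civita R a b c d)%:C%C.
Proof.
have d1 (F : 'I_4 -> C) e : \sum_i F i * ('e_e : V) 0 i = F e.
  rewrite (bigD1 e) //= mxE !eqxx mulr1 big1 ?addr0 // => i /negPf ie.
  by rewrite mxE ie andbF mulr0.
rewrite /alt4; under eq_bigr do under eq_bigr do under eq_bigr do rewrite d1.
under eq_bigr do under eq_bigr do rewrite d1.
by under eq_bigr do rewrite d1; rewrite d1.
Qed.

Let E3D A B X X' Y : E A B (X + X') Y = E A B X Y + E A B X' Y.
Proof. by rewrite alt4_34 alt4D opprD -!alt4_34. Qed.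
Let E3Z r A B X Y : E A B (r *: X) Y = r * E A B X Y.
Proof. by rewrite alt4_34 alt4Z -mulrN -alt4_34. Qed.
Let E2D A B X X' Y : E A (X + X') B Y = E A X B Y + E A X' B Y.
Proof. by rewrite alt4_23 E3D opprD -!alt4_23. Qed.
Let E2Z r A B X Y : E A (r *: X) B Y = r * E A X B Y.
Proof. by rewrite alt4_23 E3Z -mulrN -alt4_23. Qed.
Let E1D A B X X' Y : E (X + X') A B Y = E X A B Y + E X' A B Y.
Proof. by rewrite alt4_12 E2D opprD -!alt4_12. Qed.
Let E1Z r A B X Y : E (r *: X) A B Y = r * E X A B Y.
Proof. by rewrite alt4_12 E2Z -mulrN -alt4_12. Qed.
Let E11 A B X : E X X A B = 0.
Proof. by apply: dbl0; rewrite {1}alt4_12 addNr. Qed.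

Local Notation contract := (alt_contract E m p n k).

(** Raising an index turns a coordinate sum into a sum over the frame in which each vector is paired
    with its dual. Of the 16 pairs, the four with a repeated vector in E drop out, leaving the 12
    terms of [alt_contract]. *)
Lemma hodge_frame e f a b : (hodge g e f a b x)%:C%C =
  2^-1 * vol * contract 'e_a 'e_b (fun A B => A 0 e * B 0 f).
Proof.
have -> : (hodge g e f a b x)%:C%C = 2^-1 * vol *
    \sum_c (ginv g x e c)%:C%C *
      \sum_d (ginv g x f d)%:C%C * E 'e_c 'e_d 'e_a 'e_b.
  rewrite /hodge rcM rc_sum -mulrA; congr (_ * _).
    by rewrite fmorphV (rmorph_nat rc).
  rewrite mulr_sumr; apply: eq_bigr => c _; rewrite rc_sum !mulr_sumr.
  apply: eq_bigr => d _; rewrite /volume_form !rcM alt4_basis; ring.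
congr (_ * _).
under eq_bigr => c _ do rewrite (ginv_contract (F := fun Y => E 'e_c Y 'e_a 'e_b)) //.
rewrite (ginv_contract (F := fun X => p 0 f * E X m 'e_a 'e_b
  + m 0 f * E X p 'e_a 'e_b + k 0 f * E X n 'e_a 'e_b + n 0 f * E X k 'e_a 'e_b)).
- by rewrite !E11 /alt_contract; ring.
- by move=> X Y; rewrite !E1D; ring.
- by move=> r X; rewrite !E1Z; ring.
Qed.

Lemma hodge_contract X Y e f : \sum_a \sum_b (hodge g e f a b x)%:C%C * X 0 a * Y 0 b =
  2^-1 * vol * contract X Y (fun A B => A 0 e * B 0 f).
Proof.
have a34 := @alt4_34 R; have aD := @alt4D R; have aZ := @alt4Z R.
rewrite (linear_basis (F := fun X => contract X Y (fun A B => A 0 e * B 0 f))); first last.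
- by move=> *; rewrite (alt_contractZl aZ a34).
- by move=> *; rewrite (alt_contractDl aD a34).
rewrite mulr_sumr; apply: eq_bigr => a _.
rewrite (linear_basis (F := fun Y => contract 'e_a Y (fun A B => A 0 e * B 0 f))); first last.
- by move=> *; rewrite (alt_contractZr aZ).
- by move=> *; rewrite (alt_contractDr aD).
rewrite !mulr_sumr; apply: eq_bigr => b _; rewrite hodge_frame.
by move: (contract _ _ _) => z; ring.
Qed.

Lemma star_wedge : star g x (wedge m k) = (vol * E p n m k) *: wedge m k.
Proof.
have a34 := @alt4_34 R; have a12 := @alt4_12 R; have a23 := @alt4_23 R.
apply/matrixP => e f; rewrite [LHS]mxE [RHS]mxE.
have we a b : wedge m k a b = m 0 a * k 0 b - k 0 a * m 0 b.
  by rewrite /wedge !mxE !big_ord1 !mxE.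
have -> : \sum_c \sum_d (hodge g e f c d x)%:C%C * wedge m k c d =
  \sum_c \sum_d (hodge g e f c d x)%:C%C * m 0 c * k 0 d
  - \sum_c \sum_d (hodge g e f c d x)%:C%C * k 0 c * m 0 d.
  rewrite -sumrB; apply: eq_bigr => c _; rewrite -sumrB; apply: eq_bigr => d _.
  by rewrite we; ring.
rewrite !hodge_contract.
have -> : contract k m (fun A B => A 0 e * B 0 f) = - contract m k (fun A B => A 0 e * B 0 f).
  by rewrite /alt_contract !(a34 _ _ m k); ring.
have := alt_contract_antisym a12 m p n k m k (fun A B => A 0 e * B 0 f).
rewrite (alt_contract_mk dbl0 a12 a23 a34); last by move=> A B; ring.
move: (contract m k _) => z hz; rewrite we.
transitivity (2^-1 * vol * (2 * z)); first by ring.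
by rewrite -hz; field.
Qed.

(** m∧k is always an eigenvector of the star operator, with eigenvalue vol E(p, n, m, k);
    selfduality of the plane fixes it to 1. This is where the orientation enters. *)
Lemma selfdual_vol : star g x (wedge m k) = wedge m k -> vol * E p n m k = 1.
Proof.
rewrite star_wedge => h; apply/eqP; rewrite -subr_eq0; apply/negPn/negP => ne.
have w0 : wedge m k = 0.
  apply/eqP; move: h => /eqP; rewrite -subr_eq0 -[X in _ - X]scale1r -scalerBl.
  by rewrite scaler_eq0 (negPf ne).
have [mp nk _ _ _ _ mn mk _ _] := ng.
(* Contraction with n recovers m, so m∧k = 0 would force m = 0, against g(m, p) = 1. *)
have z : wedge m k *m (GC *m n^T) = m^T.
  rewrite /wedge mulmxBl -!mulmxA !(mulmxA k) !(mulmxA m).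
  have -> : k *m GC *m n^T = 1%:M.
    by apply/matrixP => i j; rewrite !ord1 -[LHS]/(gram GC k n) (gramC GC_sym) nk mxE.
  have -> : m *m GC *m n^T = 0.
    by apply/matrixP => i j; rewrite !ord1 -[LHS]/(gram GC m n) mn mxE.
  by rewrite mulmx1 mulmx0 subr0.
have m0 : m = 0 by rewrite -[m]trmxK -z w0 mul0mx trmx0.
by move: mp; rewrite m0 /gram !mul0mx mxE => /esym/eqP; rewrite oner_eq0.
Qed.

Section Vanishing.
Context (W : curvature_tensor V).
Hypothesis WE : forall X Y Z T, W X Y Z T = cweyl g x X Y Z T.
Hypothesis tr : ct_traceless W m p n k.
Hypothesis sd : star g x (wedge m k) = wedge m k.
Hypothesis psi0 : W m k m k = 0.
Hypothesis psi1 : W m k n k = 0.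
Hypothesis psi2 : W m k p n = 0.
Hypothesis psi3 : W p n m p = 0.
Hypothesis psi4 : W p n p n = 0.

Lemma weyl_selfdual_eq0 a b c d : weyl_selfdual g a b c d x = 0.
Proof.
have d1 (F : 'I_4 -> C) e : \sum_i F i * ('e_e : V) 0 i = F e.
  rewrite (bigD1 e) //= mxE !eqxx mulr1 big1 ?addr0 // => i /negPf ie.
  by rewrite mxE ie andbF mulr0.
have We e f c' d' : W 'e_e 'e_f 'e_c' 'e_d' = (weyl g e f c' d' x)%:C%C.
  rewrite WE /cweyl; under eq_bigr do under eq_bigr do under eq_bigr do rewrite d1.
  under eq_bigr do under eq_bigr do rewrite d1.
  by under eq_bigr do rewrite d1; rewrite d1.
apply: (@complexI R); rewrite /weyl_selfdual rcM rcD rc_sum.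
have span Z : exists a b c d : C, Z = a *: m + b *: p + c *: n + d *: k.
  by do 4 eexists; exact: (null_gram_decomp GC_sym Z ng).
have := alt_contract_antiselfdual dbl0 (@alt4D R) (@alt4Z R) (@alt4_12 R) (@alt4_23 R)
  (@alt4_34 R) tr span psi0 psi1 psi2 psi3 psi4 (selfdual_vol sd) 'e_a 'e_b 'e_c 'e_d.
have -> : \sum_i (\sum_f weyl g i f c d x * hodge g i f a b x)%:C%C =
  2^-1 * vol * contract 'e_a 'e_b (fun A B => W A B 'e_c 'e_d).
  have WAB A B : W A B 'e_c 'e_d = \sum_e \sum_f A 0 e * B 0 f * (weyl g e f c d x)%:C%C.
    rewrite (linear_basis (F := fun A => W A B 'e_c 'e_d)); first last.
    - by move=> *; rewrite ctZl.
    - by move=> *; rewrite ctDl.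
    apply: eq_bigr => e _; rewrite (linear_basis (F := fun B => W 'e_e B 'e_c 'e_d)); first last.
    - by move=> *; rewrite ctZ2.
    - by move=> *; rewrite ctD2.
    by rewrite mulr_sumr; apply: eq_bigr => f _; rewrite We; ring.
  have cs (I : finType) (F : I -> V -> V -> C) A B :
      contract A B (fun X Y => \sum_i F i X Y) = \sum_i contract A B (F i).
    by rewrite /alt_contract !mulr_sumr -!big_split.
  have -> : contract 'e_a 'e_b (fun A B => W A B 'e_c 'e_d) =
      \sum_e \sum_f (weyl g e f c d x)%:C%C
        * contract 'e_a 'e_b (fun A B => A 0 e * B 0 f).
    transitivity (contract 'e_a 'e_b
      (fun A B => \sum_e \sum_f (weyl g e f c d x)%:C%C * (A 0 e * B 0 f))).
      rewrite /alt_contract !WAB.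
      by do ![congr (_ + _)|congr (_ * _)]; apply: eq_bigr => e _;
        apply: eq_bigr => f _; rewrite mulrC.
    rewrite cs; apply: eq_bigr => e _; rewrite cs; apply: eq_bigr => f _.
    exact: alt_contractZ.
  rewrite mulr_sumr; apply: eq_bigr => e _; rewrite rc_sum mulr_sumr.
  apply: eq_bigr => f _; rewrite rcM hodge_frame.
  by move: (contract _ _ _) => z; ring.
rewrite -We; move: (contract _ _ _) (W _ _ _ _) => z w h.
have -> : ((2^-1)%:C)%C = 2^-1 :> C by rewrite fmorphV (rmorph_nat rc).
(* One factor 1/2 comes from the projection to the selfdual part, the other from the Hodge
   operator. *)
transitivity (2^-1 * 2^-1 * (2 * w + vol * z)); last by rewrite h mulr0.
by field.
Qed.
End Vanishing.

End HodgeFrame.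

(** * Adapted frames *)

Section GramSchmidt.
Context (K : comNzRingType) (G J : 'M[K]_4).
Hypothesis G_sym : G^T = G.
Hypothesis JJ : J *m J = - 1%:M.
Hypothesis JG : J *m G *m J^T = G.
Hypothesis dbl0 : forall a : K, a + a = 0 -> a = 0.
Local Notation g := (gram G).
Implicit Types v u : 'rV[K]_4.

(** Gram-Schmidt against the orthogonal vectors v and Jv, which have the same length; multiplied by
    g(v, v), so that no division occurs over the ring. *)
Definition gs_orth v u := g v v *: u - g u v *: v - g u (v *m J) *: (v *m J).

Let vJ v : g v (v *m J) = 0 := gram_vJ G_sym JJ JG dbl0 v.

Lemma gs_orth_v v u : g (gs_orth v u) v = 0.
Proof.
rewrite /gs_orth !(gramDl, gramNl G_sym, gramZl) (gramC G_sym (v *m J)) vJ; ring.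
Qed.

Lemma gs_orth_vJ v u : g (gs_orth v u) (v *m J) = 0.
Proof.
rewrite /gs_orth !(gramDl, gramNl G_sym, gramZl) (gram_J JG) vJ; ring.
Qed.

End GramSchmidt.

Section RealGramSchmidt.
Context (R : realType) (G J : 'M[R]_4).
Hypothesis G_sym : G^T = G.
Hypothesis G_pos : forall v : 'rV[R]_4, v != 0 -> 0 < (v *m G *m v^T) 0 0.
Hypothesis JJ : J *m J = - 1%:M.
Hypothesis JG : J *m G *m J^T = G.

(** If every coordinate vector were projected to 0, then g(v, v) times the identity would factor
    through the two rows v and Jv, and a matrix of rank 4 would have rank at most 2. *)
Lemma gs_orth_exists (v : 'rV[R]_4) : v != 0 ->
  exists a : 'I_4, gram G (gs_orth G J v (delta_mx 0 a)) (gs_orth G J v (delta_mx 0 a)) != 0.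
Proof.
move=> v0; apply: contrapT => /forallNP h.
have q0 : gram G v v != 0 by rewrite gt_eqF // G_pos.
have w0 a : gs_orth G J v (delta_mx 0 a) = 0.
  by apply/eqP/negPn/negP => /G_pos/gt_eqF/negbT; exact/h.
pose A : 'M[R]_(4, 1 + 1) := row_mx (\col_a gram G (delta_mx 0 a) v)
  (\col_a gram G (delta_mx 0 a) (v *m J)).
have E : (gram G v v)%:M = A *m col_mx v (v *m J).
  apply/row_matrixP => a; rewrite /A mul_row_col linearD /= !row_mul.
  have -> : row a (\col_a gram G (delta_mx 0 a) v) = (gram G (delta_mx 0 a) v)%:M.
    by apply/matrixP => i j; rewrite !ord1 !mxE eqxx mulr1n.
  have -> : row a (\col_a gram G (delta_mx 0 a) (v *m J)) = (gram G (delta_mx 0 a) (v *m J))%:M.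
    by apply/matrixP => i j; rewrite !ord1 !mxE eqxx mulr1n.
  rewrite !mul_scalar_mx rowE mul_mx_scalar.
  by have /eqP := w0 a; rewrite /gs_orth -addrA -opprD subr_eq0 => /eqP.
have := mxrankM_maxl A (col_mx v (v *m J)); rewrite -E.
rewrite mxrank_unit; last by rewrite unitmxE det_scalar unitfE expf_neq0.
by move=> /leq_trans/(_ (rank_leq_col A)).
Qed.
End RealGramSchmidt.

(** * Multiple principal planes *)

Section PrincipalPlanes.
Context (R : realType) (g : 'rV[R]_4 -> 'M[R]_4) (x : 'rV[R]_4).
Hypothesis g_sym : (g x)^T = g x.
Local Notation C := R[i].
Local Notation V := 'rV[C]_4.
Local Notation rc := (real_complex R).
Local Notation GC := (map_mx rc (g x)).
Context (W : curvature_tensor V).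
Hypothesis WE : forall X Y Z T, W X Y Z T = cweyl g x X Y Z T.
Hypothesis tr : forall m p n k, null_frame g x m p n k -> ct_traceless W m p n k.
Implicit Types (m p n k : V) (z : C).

Let GC_sym : GC^T = GC. Proof. by rewrite map_trmx g_sym. Qed.

Let dbl0 (a : C) : a + a = 0 -> a = 0.
Proof. by move/eqP; rewrite -mulr2n mulrn_eq0 => /eqP. Qed.

Lemma span2l (u v : V) : span2 u v u.
Proof. by exists 1, 0; rewrite scale1r scale0r addr0. Qed.

Lemma span2r (u v : V) : span2 u v v.
Proof. by exists 0, 1; rewrite scale1r scale0r add0r. Qed.

(** N_z is the plane at 0 of this frame, so a finite root can be moved to 0; [null_frame_dual] does
    the same for the root at infinity. *)
Lemma null_frame_shift m p n k z : null_frame g x m p n k ->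
  null_frame g x (m + z *: n) p n (k - z *: p).
Proof.
move=> /null_frameP [h1 h2 h3 h4 h5 h6 h7 h8 h9 h10]; apply/null_frameP.
have s := gramC GC_sym.
by split; rewrite ?(gramDl, gramDr GC_sym, gramNl GC_sym, gramNr GC_sym, gramZl, gramZr GC_sym)
  ?(s n m) ?(s n p) ?(s p m) ?(s k p) ?(s k n) ?(s k m)
  ?(h1, h2, h3, h4, h5, h6, h7, h8, h9, h10); ring.
Qed.

Lemma null_frame_dual m p n k : null_frame g x m p n k -> null_frame g x p m k n.
Proof.
move=> /null_frameP [h1 h2 h3 h4 h5 h6 h7 h8 h9 h10]; apply/null_frameP.
by split=> //; rewrite (gramC GC_sym).
Qed.

Lemma weyl_quartic_horner m p n k z : null_frame g x m p n k ->
  (weyl_quartic g x m p n k).[z] = W (m + z *: n) (k - z *: p) (m + z *: n) (k - z *: p).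
Proof.
move=> fr; rewrite (ct_quartic dbl0 (tr fr)) !WE.
rewrite /weyl_quartic /Psi0 /Psi1 /Psi2 /Psi3 /Psi4.
move: (cweyl _ _ p n p n) (cweyl _ _ p n m p) (cweyl _ _ m k p n) (cweyl _ _ m k n k)
  (cweyl _ _ m k m k) => *; rewrite !hornerE; ring.
Qed.

Lemma weyl_quartic_deriv m p n k z : null_frame g x m p n k ->
  (weyl_quartic g x m p n k)^`().[z] = 4 * W (m + z *: n) (k - z *: p) n (k - z *: p).
Proof.
move=> fr; rewrite (ct_quartic_deriv dbl0 (tr fr)) !WE /weyl_quartic.
rewrite /Psi0 /Psi1 /Psi2 /Psi3 /Psi4.
move: (cweyl _ _ p n p n) (cweyl _ _ p n m p) (cweyl _ _ m k p n) (cweyl _ _ m k n k)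
  (cweyl _ _ m k m k) => *.
rewrite !(derivD, derivN, derivB, derivZ, derivXn, derivX, derivC) !hornerE /=.
ring.
Qed.

Lemma weyl_quartic_coef3 m p n k :
  (weyl_quartic g x m p n k)`_3 = - (4 * Psi3 g x m p n k).
Proof. by rewrite /weyl_quartic !coefE /=; ring. Qed.

Lemma weyl_quartic_coef4 m p n k :
  (weyl_quartic g x m p n k)`_4 = Psi4 g x m p n k.
Proof. by rewrite /weyl_quartic !coefE /=; ring. Qed.

(** The frame in the definition of a multiple principal plane is arbitrary. Once the root is moved
    to 0, it says Psi0 = Psi1 = 0 there, and [ct_principal] transfers this to the spanning vectors
    m0, k0 and to any n0. *)
Lemma multiple_principal_psi m0 n0 k0 :
  multiple_principal_plane g x (span2 m0 k0) ->
  W m0 k0 m0 k0 = 0 /\ W m0 k0 n0 k0 = 0.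
Proof.
case=> m [p [n [k [z [fr _ Pz root]]]]].
suff [m' [p' [n' [k' [fr' [mP kP] [psi0 psi1]]]]]] : exists m' p' n' k',
    [/\ null_frame g x m' p' n' k', span2 m' k' m0 /\ span2 m' k' k0
      & W m' k' m' k' = 0 /\ W m' k' n' k' = 0].
  have pr := ct_principal dbl0 (tr fr') psi0 psi1.
  have [a [b ->]] := mP; have [c [d ->]] := kP.
  split; first by have := pr a b c d a 0 0 b c d; rewrite !scale0r !addr0.
  have ng := (null_frameP g x m' p' n' k').1 fr'.
  by rewrite {1}(null_gram_decomp GC_sym n0 ng); exact: pr.
have m0P : selfdual_null_plane m p n k z m0 by rewrite -Pz; exact: span2l.
have k0P : selfdual_null_plane m p n k z k0 by rewrite -Pz; exact: span2r.
case: z root m0P k0P {Pz} => [z|] /= root m0P k0P.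
  exists (m + z *: n), p, n, (k - z *: p); split => //; first exact: null_frame_shift.
  case/dvdpP: root => r qE.
  split.
    by rewrite -weyl_quartic_horner // qE expr2 !hornerM hornerXsubC subrr !mulr0.
  have := weyl_quartic_deriv z fr; rewrite qE.
  have -> : (r * ('X - z%:P) ^+ 2)^`().[z] = 0.
    rewrite derivM expr2 derivM hornerD !hornerM hornerXsubC hornerD !hornerM.
    by rewrite !hornerXsubC subrr !(mul0r, mulr0) addr0 mulr0 addr0.
  by move=> /esym/eqP; rewrite mulf_eq0 pnatr_eq0 /= => /eqP.
(* At infinity a multiple root means that the coefficients Psi4 and -4 Psi3 vanish; Psi4 and Psi3
   are Psi0 and Psi1 of the dual frame. *)
have frd := null_frame_dual fr.
exists p, m, k, n; split => //.
  by split; [case: m0P|case: k0P] => s [t ->]; exists t, s; rewrite addrC.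
split.
  by have := weyl_quartic_coef4 m p n k; rewrite nth_default 1?ltnW // WE => ->.
rewrite -(ct_mkpm dbl0 (tr frd)) WE.
have := weyl_quartic_coef3 m p n k; rewrite nth_default // => /esym/eqP.
by rewrite oppr_eq0 mulf_eq0 pnatr_eq0 /= => /eqP.
Qed.

Lemma psi_multiple_principal m p n k : null_frame g x m p n k ->
  selfdual_plane g x (span2 m k) -> W m k m k = 0 -> W m k n k = 0 ->
  multiple_principal_plane g x (span2 m k).
Proof.
move=> fr sd psi0 psi1; exists m, p, n, k, (Some 0); split=> //=.
  by rewrite !scale0r addr0 subr0.
rewrite /weyl_quartic /Psi0 /Psi1 -!WE psi0 psi1 mulr0 scale0r polyC0 !addr0 subr0.
apply/dvdpP; exists (Psi4 g x m p n k *: 'X^2 - (4 * Psi3 g x m p n k) *: 'X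
  + (6 * Psi2 g x m p n k)%:P).
rewrite !mulrDl mulNr -!scalerAl mul_polyC -exprD -exprS; exact.
Qed.
End PrincipalPlanes.

Section AdaptedFrame.
Context (R : realType) (U : pointed_open R 4) (g J : 'rV[R]_4 -> 'M[R]_4).
Hypothesis g_smooth : smooth_on (dset U) g.
Hypothesis J_smooth : smooth_on (dset U) J.
Hypothesis g_sym : forall x, dset U x -> (g x)^T = g x.
Hypothesis g_pos : forall x (v : 'rV[R]_4), dset U x -> v != 0 ->
  0 < (v *m g x *m v^T) 0 0.
Hypothesis JJ : forall x, dset U x -> J x *m J x = - 1%:M.
Hypothesis Jg : forall x, dset U x -> J x *m g x *m (J x)^T = g x.
Local Notation K := (smooth_fun U).
Local Notation rc := (real_complex R).
Local Notation G := (lift_mx g_smooth).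
Local Notation G_sym := (lift_metric_sym g_smooth g_sym).
Local Notation JK := (lift_mx J_smooth).

Implicit Types (X Y : 'rV[K]_4) (f : K).

Lemma lift_acs_square : JK *m JK = - 1%:M.
Proof.
apply: ev_mx_inj => x Ux; rewrite map_mxM ev_lift_mx -map_mxM JJ //.
by rewrite !map_mxN !map_mx1.
Qed.

Lemma lift_acs_metric : JK *m G *m JK^T = G.
Proof.
apply: ev_mx_inj => x Ux; rewrite !map_mxM -map_trmx !ev_lift_mx map_trmx.
by rewrite -!map_mxM Jg.
Qed.

Lemma smooth_double_eq0 (f : K) : f + f = 0 -> f = 0.
Proof. exact: (half_double_eq0 (halfKD U)). Qed.

Lemma represents_row_ev X (X' : 'rV[R]_4 -> 'rV[R]_4) x (Ux : dset U x) : represents_row X X' ->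
  map_mx (ev Ux) X = map_mx rc (X' x).
Proof. by move=> XX; apply/rowP => c; rewrite !mxE XX. Qed.

Lemma represents_rowZ f r X (X' : 'rV[R]_4 -> 'rV[R]_4) : represents f r -> represents_row X X' ->
  represents_row (f *: X) (fun x => r x *: X' x).
Proof.
move=> fr XX c; rewrite mxE; apply: represents_eq (representsM fr (XX c)) _ => x _.
by rewrite mxE.
Qed.

Lemma represents_gram X (X' : 'rV[R]_4 -> 'rV[R]_4) Y (Y' : 'rV[R]_4 -> 'rV[R]_4) :
  represents_row X X' -> represents_row Y Y' ->
  represents (gram G X Y) (fun x => gram (g x) (X' x) (Y' x)).
Proof.
move=> XX YY x Ux; rewrite (ev_gram g_smooth) /cmetric.
by rewrite (represents_row_ev Ux XX) (represents_row_ev Ux YY) map_trmx -!map_mxM mxE.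
Qed.

Lemma represents_row_cst (v : 'I_4) :
  represents_row (delta_mx 0 v : 'rV[K]_4) (fun=> delta_mx 0 v).
Proof. by move=> c x Ux; rewrite !mxE (ev_nat Ux) (rmorph_nat rc). Qed.

Lemma represents_row_J X (X' : 'rV[R]_4 -> 'rV[R]_4) : represents_row X X' ->
  represents_row (X *m JK) (fun x => X' x *m J x).
Proof. by move=> XX; apply: represents_mulmx => // a b; exact: lift_mxE. Qed.

Lemma represents_gs_orth (v : 'rV[K]_4) (v' : 'rV[R]_4 -> 'rV[R]_4) (u : 'rV[K]_4)
    (u' : 'rV[R]_4 -> 'rV[R]_4) : represents_row v v' -> represents_row u u' ->
  represents_row (gs_orth G JK v u) (fun x => gs_orth (g x) (J x) (v' x) (u' x)).
Proof.
move=> vv uu; apply: represents_rowB; last first.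
  by apply: represents_rowZ; [apply: represents_gram|]; rewrite //; exact: represents_row_J.
apply: represents_rowB; first by apply: represents_rowZ => //; exact: represents_gram.
by apply: represents_rowZ => //; exact: represents_gram.
Qed.

(** Besides orthogonality, v and w are real: this makes [antihol] the complex conjugate of [hol],
    and lets real statements about J be recovered from complex ones. *)
Record adapted (v w : 'rV[K]_4) (al be : K) := Adapted {
  ad_v : 2 * gram G v v * al = 1;
  ad_w : 2 * gram G w w * be = 1;
  ad_wv : gram G w v = 0;
  ad_wvJ : gram G w (v *m JK) = 0;
  ad_vreal : exists v' : 'rV[R]_4 -> 'rV[R]_4, represents_row v v';
  ad_wreal : exists w' : 'rV[R]_4 -> 'rV[R]_4, represents_row w w' }.

Lemma adapted_exists (a : 'I_4) :
  (forall x, dset U x -> let w := gs_orth (g x) (J x) (delta_mx 0 0) (delta_mx 0 a) in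
     gram (g x) w w != 0) ->
  exists v w al be, adapted v w al be.
Proof.
move=> w0; pose v : 'rV[K]_4 := delta_mx 0 0.
pose w := gs_orth G JK v (delta_mx 0 a).
have rv := represents_row_cst 0.
have rw := represents_gs_orth rv (represents_row_cst a).
have r2 X (X' : 'rV[R]_4 -> 'rV[R]_4) : represents_row X X' ->
    represents (2 * gram G X X) (fun x => 2 * gram (g x) (X' x) (X' x)).
  move=> XX; apply: representsM; last exact: represents_gram.
  by move=> x Ux; rewrite (ev_nat Ux) (rmorph_nat rc).
have nz1 x : dset U x -> 2 * gram (g x) (delta_mx 0 0) (delta_mx 0 0) != 0.
  move=> Ux; rewrite mulf_neq0 ?pnatr_eq0 // gt_eqF // g_pos //.
  by apply/eqP => /rowP/(_ 0); rewrite !mxE => /eqP; rewrite oner_eq0.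
have nz2 x : dset U x -> 2 * gram (g x)
    (gs_orth (g x) (J x) (delta_mx 0 0) (delta_mx 0 a))
    (gs_orth (g x) (J x) (delta_mx 0 0) (delta_mx 0 a)) != 0.
  by move=> Ux; rewrite mulf_neq0 ?pnatr_eq0 //; exact: w0.
have [al alE _] := represents_inv (r2 _ _ rv) nz1.
have [be beE _] := represents_inv (r2 _ _ rw) nz2.
exists v, w, al, be; split=> //.
- exact: (gs_orth_v G_sym lift_acs_square lift_acs_metric smooth_double_eq0).
- exact: (gs_orth_vJ G_sym lift_acs_square lift_acs_metric smooth_double_eq0).
- by eexists; exact: rv.
- by eexists; exact: rw.
Qed.
End AdaptedFrame.

(** * Weyl and Cotton tensors in a frame adapted to N *)

Section AdaptedGeometry.
Context (R : realType) (U : pointed_open R 4) (g J : 'rV[R]_4 -> 'M[R]_4).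
Hypothesis g_smooth : smooth_on (dset U) g.
Hypothesis J_smooth : smooth_on (dset U) J.
Hypothesis g_sym : forall x, dset U x -> (g x)^T = g x.
Hypothesis g_pos : forall x (v : 'rV[R]_4), dset U x -> v != 0 ->
  0 < (v *m g x *m v^T) 0 0.
Hypothesis JJ : forall x, dset U x -> J x *m J x = - 1%:M.
Hypothesis Jg : forall x, dset U x -> J x *m g x *m (J x)^T = g x.
Local Notation K := (smooth_fun U).
Local Notation C := R[i].
Local Notation V := 'rV[C]_4.
Local Notation D := (smooth_derivations U).
Local Notation twelfth := (cstK U 12^-1).
Local Notation rc := (real_complex R).
Local Notation G := (lift_mx g_smooth).
Local Notation G_sym := (lift_metric_sym g_smooth g_sym).
Local Notation JK := (lift_mx J_smooth).

Context (Gi : 'M[K]_4).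
Hypothesis GGi : G *m Gi = 1%:M.
Hypothesis GiE : forall a b, represents (Gi a b) (fun x => ginv g x a b).
Local Notation L := (coordinate_calculus D G_sym GGi (halfKD U)).
Local Notation P := (gram_form (schouten_mx_sym D twelfth G_sym GGi (halfKD U))).
Local Notation nab := (nab L).
Local Notation W := (weylK L P).
Context (m p n k : 'rV[K]_4).
Local Notation s_m := (gm L (nab m m) k).
Local Notation s_k := (gm L (nab k m) k).
Hypothesis ng : null_gram G m p n k.
Hypothesis m_J : m *m JK = iK U *: m.
Hypothesis k_J : k *m JK = iK U *: k.
Implicit Types (X Y : 'rV[K]_4) (f : K).

Let fr : null_basis L m p n k := null_gram_basis D G_sym GGi (halfKD U) ng.
Let tr : ct_traceless W m p n k :=
  weyl_frame_traceless D G_sym GGi (halfKD U) (twelfthKE U) ng.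

Section AtPoint.
Context (x : 'rV[R]_4) (Ux : dset U x).
Local Notation evv := (map_mx (ev Ux)).
Local Notation mx := (evv m).
Local Notation px := (evv p).
Local Notation nx := (evv n).
Local Notation kx := (evv k).
Local Notation Wx := (cweyl_tensor g_sym GGi GiE Ux).
Local Notation GC := (map_mx rc (g x)).

Lemma adapted_null_frame : null_frame g x mx px nx kx.
Proof.
have e X Y : gram GC (evv X) (evv Y) = ev Ux (gram G X Y).
  by rewrite (ev_gram g_smooth).
have one X Y : gram G X Y = 1 -> gram GC (evv X) (evv Y) = 1.
  by move=> XY; rewrite e XY (ev1 Ux).
have zero X Y : gram G X Y = 0 -> gram GC (evv X) (evv Y) = 0.
  by move=> XY; rewrite e XY (ev0 Ux).
have [h1 h2 h3 h4 h5 h6 h7 h8 h9 h10] := ng; apply/null_frameP; split.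
- exact: one. - exact: one. - exact: zero. - exact: zero. - exact: zero.
- exact: zero. - exact: zero. - exact: zero. - exact: zero. - exact: zero.
Qed.

Let GC_sym : GC^T = GC. Proof. by rewrite map_trmx g_sym. Qed.

Let Cdbl0 (a : C) : a + a = 0 -> a = 0.
Proof. by move/eqP; rewrite -mulr2n mulrn_eq0 => /eqP. Qed.

Definition hol_set : set V := [set z | z *m map_mx rc (J x) = 'i%C *: z].

(** The components of z along p and n are g(z, m) and g(z, k); they vanish for z in N because N is
    totally null. *)
Lemma hol_setE : hol_set = span2 mx kx.
Proof.
have mJ : mx *m map_mx rc (J x) = 'i%C *: mx.
  by rewrite -(ev_lift_mx J_smooth Ux) -map_mxM m_J evvZ ev_iK.
have kJ : kx *m map_mx rc (J x) = 'i%C *: kx.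
  by rewrite -(ev_lift_mx J_smooth Ux) -map_mxM k_J evvZ ev_iK.
apply/seteqP; split=> z /=; last first.
  by move=> [s [t ->]]; rewrite /hol_set /= mulmxDl -!scalemxAl mJ kJ scalerDr !scalerA
    ![_ * 'i%C]mulrC.
move=> zJ; have JGC : map_mx rc (J x) *m GC *m (map_mx rc (J x))^T = GC.
  by rewrite map_trmx -!map_mxM Jg.
have ii : 'i%C * 'i%C = -1 :> C by rewrite -expr2 sqr_i.
have hh (X Y : V) := gram_holomorphic GC_sym JGC Cdbl0 ii (X := X) (Y := Y).
have ngx := (null_frameP g x mx px nx kx).1 adapted_null_frame.
exists (gram GC z px), (gram GC z nx); rewrite {1}(null_gram_decomp GC_sym z ngx).
by rewrite (hh _ _ zJ mJ) (hh _ _ zJ kJ) !scale0r !addr0.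
Qed.

Lemma ev_weyl_tensor X Y Z T : ev Ux (W X Y Z T) = Wx (evv X) (evv Y) (evv Z) (evv T).
Proof. exact: ev_weyl. Qed.

Lemma Wx_traceless m' p' n' k' : null_frame g x m' p' n' k' ->
  ct_traceless Wx m' p' n' k'.
Proof. exact: (cweyl_traceless g_sym GGi GiE Ux ng). Qed.

Lemma hol_multiple_principal : selfdual_plane g x hol_set ->
  ev Ux (W m k m k) = 0 -> ev Ux (W m k n k) = 0 ->
  multiple_principal_plane g x hol_set.
Proof.
rewrite hol_setE => sd h0 h1.
have psi0 := etrans (esym (ev_weyl_tensor _ _ _ _)) h0.
have psi1 := etrans (esym (ev_weyl_tensor _ _ _ _)) h1.
exact: (psi_multiple_principal (W := Wx) _ adapted_null_frame sd psi0 psi1).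
Qed.

Lemma hol_multiple_principal_psi : multiple_principal_plane g x hol_set ->
  ev Ux (W m k m k) = 0 /\ ev Ux (W m k n k) = 0.
Proof.
rewrite hol_setE => mp.
have [] := multiple_principal_psi (g_sym Ux) (W := Wx) (fun _ _ _ _ => erefl) Wx_traceless nx mp.
by move=> psi0 psi1; split; [apply: etrans (ev_weyl_tensor _ _ _ _) psi0
  |apply: etrans (ev_weyl_tensor _ _ _ _) psi1].
Qed.

Lemma hol_cotton_eq0 :
  ev Ux (cottonK L P m m k) = 0 -> ev Ux (cottonK L P k m k) = 0 ->
  forall Z1 Z2 Z3, hol_set Z1 -> hol_set Z2 -> hol_set Z3 -> ccotton g x Z1 Z2 Z3 = 0.
Proof.
rewrite hol_setE => e1 e2 Z1 Z2 Z3 [a [b ->]] [c [d ->]] [e [f ->]].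
have lft (s t : C) : s *: mx + t *: kx = evv (cplxK U s *: m + cplxK U t *: k).
  by rewrite evvD !evvZ !ev_cplxK.
have aux (t s1 s2 A B : K) : ev Ux A = 0 -> ev Ux B = 0 ->
    ev Ux (t * (s1 * A + s2 * B)) = 0.
  by move=> hA hB; rewrite evM evD !evM hA hB !mulr0 addr0 mulr0.
rewrite !lft; apply: etrans (esym (ev_cotton g_sym GGi GiE Ux _ _ _)) _.
apply: etrans (congr1 (ev Ux) (cottonK_span _ _ _ _ _ _ _ _ _ _)) _.
exact: aux.
Qed.

Lemma hol_cotton_ev : (forall Z1 Z2 Z3, hol_set Z1 -> hol_set Z2 -> hol_set Z3 ->
    ccotton g x Z1 Z2 Z3 = 0) ->
  ev Ux (cottonK L P m m k) = 0 /\ ev Ux (cottonK L P k m k) = 0.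
Proof.
rewrite hol_setE => cot; have hm := span2l mx kx; have hk := span2r mx kx.
by split; rewrite (ev_cotton g_sym GGi GiE); exact: cot.
Qed.

Section Conjugate.
Local Notation conj := (map_mx (@conjc R)).

Lemma cweyl_conj (u1 u2 u3 u4 : V) :
  (cweyl g x u1 u2 u3 u4)^*%C = cweyl g x (conj u1) (conj u2) (conj u3) (conj u4).
Proof.
have cM (c d : C) : (c * d)^*%C = c^*%C * d^*%C by exact: rmorphM.
have cS (f : 'I_4 -> C) : (\sum_i f i)^*%C = \sum_i (f i)^*%C by exact: rmorph_sum.
rewrite /cweyl cS; apply: eq_bigr => a _; rewrite cS; apply: eq_bigr => b _.
rewrite cS; apply: eq_bigr => c _; rewrite cS; apply: eq_bigr => d _.
by rewrite !cM conjc_real !mxE.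
Qed.

Context (a b : C).
Hypothesis a0 : a != 0.
Hypothesis pE : px = a *: conj mx.
Hypothesis nE : nx = b *: conj kx.

(* Complex conjugation exchanges m, k with p, n up to factors, so Psi3 and Psi4
   vanish together with Psi1 and Psi0. *)
Lemma adapted_psi2_neq0 : selfdual_plane g x hol_set ->
  (exists a b c d, weyl_selfdual g a b c d x != 0) ->
  ev Ux (W m k m k) = 0 -> ev Ux (W m k n k) = 0 -> ev Ux (W m k p n) != 0.
Proof.
move=> sd ne h0 h1; apply/negP => /eqP h2.
have psi0 := etrans (esym (ev_weyl_tensor _ _ _ _)) h0.
have psi1 := etrans (esym (ev_weyl_tensor _ _ _ _)) h1.
have psi2 := etrans (esym (ev_weyl_tensor _ _ _ _)) h2.
have trx := Wx_traceless adapted_null_frame.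
have conjK u : conj (conj u) = u :> V by apply/matrixP => i j; rewrite !mxE conjcK.
(* Psi1 is taken in the form W(m, k, p, m): conjugation turns p into a multiple of m, which gives
   W(conj m, conj k, m, conj m) = 0, and Psi3 is a multiple of that. *)
have psi3 : Wx px nx mx px = 0.
  have h : Wx mx kx px mx = 0 by rewrite (ct_mkpm Cdbl0 trx).
  have {h} : (Wx mx kx px mx)^*%C = 0 by rewrite h conjc0.
  rewrite [X in (X^*%C)%C]/= cweyl_conj.
  have -> : conj px = a^*%C *: mx.
    rewrite pE; apply/matrixP => i j; rewrite !mxE -[X in _ = _ * X]conjcK.
    exact: rmorphM.
  rewrite -[cweyl _ _ _ _ _ _]/(Wx _ _ _ _) ctZ3 => /eqP.
  rewrite mulf_eq0 conjc_eq0 (negPf a0) /= => /eqP h.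
  rewrite pE nE -[cweyl _ _ _ _ _ _]/(Wx _ _ _ _) ctZl ctZ2 ctZ4.
  by rewrite (h : Wx (conj mx) (conj kx) mx (conj mx) = 0) !mulr0.
have psi4 : Wx px nx px nx = 0.
  have : (Wx mx kx mx kx)^*%C = 0 by rewrite psi0 conjc0.
  rewrite [X in (X^*%C)%C]/= cweyl_conj -[cweyl _ _ _ _ _ _]/(Wx _ _ _ _) => h.
  rewrite pE nE ctZl ctZ2 ctZ3 ctZ4.
  by rewrite (h : Wx (conj mx) (conj kx) (conj mx) (conj kx) = 0) !mulr0.
have st : star g x (wedge mx kx) = wedge mx kx.
  by apply: sd; rewrite hol_setE; [exact: span2l|exact: span2r].
have gu := metric_unit g_pos Ux.
have [a' [b' [c' [d']]]] := ne.
rewrite (weyl_selfdual_eq0 (g_sym Ux) gu adapted_null_frame (W := Wx) _ trx st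
  psi0 psi1 psi2 psi3 psi4) ?eqxx //.
Qed.
End Conjugate.
End AtPoint.

Lemma adapted_cotton_mmk : W m k m k = 0 ->
  cottonK L P m m k = act L m (W m k n k)
    + (4 * gm L (nab n m) k - (gm L (nab m m) p + gm L (nab m k) n)) * W m k n k
    - 3 * s_m * W m k p n.
Proof. exact: cotton_mmk fr tr. Qed.

Lemma adapted_cotton_kmk : W m k m k = 0 ->
  cottonK L P k m k = act L k (W m k n k)
    - (4 * gm L (nab p m) k + (gm L (nab k m) p + gm L (nab k k) n)) * W m k n k
    - 3 * s_k * W m k p n.
Proof. exact: cotton_kmk fr tr. Qed.

Lemma integrable_special x (Ux : dset U x) : s_m = 0 -> s_k = 0 ->
  cottonK L P m m k = 0 -> cottonK L P k m k = 0 ->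
  ev Ux (W m k m k) = 0 /\ ev Ux (W m k n k) = 0.
Proof.
move=> sm sk c1 c2; rewrite (weyl_mkmk_eq0 P fr sm sk) ev0; split=> //.
have := weyl_mknk_sqr_eq0 fr tr sm sk c1 c2.
move=> /(congr1 (ev Ux)); rewrite expr2 !evM ev0 (ev_nat Ux) => /eqP.
by rewrite !mulf_eq0 pnatr_eq0 /= orbb => /eqP.
Qed.

(** Psi1 vanishes on the whole open set, so its derivatives vanish too and the identities reduce to
    3 s Psi2 = 0; Psi2 is then cancelled at x, in a field. *)
Lemma special_obstruction x (Ux : dset U x) :
  W m k m k = 0 -> W m k n k = 0 -> cottonK L P m m k = 0 -> cottonK L P k m k = 0 ->
  ev Ux (W m k p n) != 0 -> ev Ux s_m = 0 /\ ev Ux s_k = 0.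
Proof.
move=> psi0 psi1 c1 c2 psi2.
have e1 := adapted_cotton_mmk psi0; have e2 := adapted_cotton_kmk psi0.
rewrite psi1 act0 mulr0 addr0 sub0r c1 in e1.
rewrite psi1 act0 mulr0 subr0 sub0r c2 in e2.
have aux (s : K) : 0 = - (3 * s * W m k p n) -> ev Ux s = 0.
  move=> /(congr1 (ev Ux)); rewrite evN !evM ev0 (ev_nat Ux) => /esym/eqP.
  by rewrite oppr_eq0 !mulf_eq0 pnatr_eq0 (negPf psi2) orbF /= => /eqP.
by split; [exact: (aux _ e1)|exact: (aux _ e2)].
Qed.

Lemma integrable_special_cotton : W m k m k = 0 -> W m k n k = 0 ->
  s_m = 0 -> s_k = 0 -> cottonK L P m m k = 0 /\ cottonK L P k m k = 0.
Proof.
move=> psi0 psi1 sm sk.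
have e1 := adapted_cotton_mmk psi0; have e2 := adapted_cotton_kmk psi0.
have aux1 X (t psi s y : K) : psi = 0 -> s = 0 -> act L X psi + t * psi - 3 * s * y = 0.
  by move=> -> ->; rewrite act0 !mulr0 mul0r subr0 addr0.
have aux2 X (t psi s y : K) : psi = 0 -> s = 0 -> act L X psi - t * psi - 3 * s * y = 0.
  by move=> -> ->; rewrite act0 !mulr0 mul0r !subr0.
by split; [exact: etrans e1 (aux1 _ _ _ _ _ psi1 sm)|exact: etrans e2 (aux2 _ _ _ _ _ psi1 sk)].
Qed.
End AdaptedGeometry.

(** * The Nijenhuis tensor at a point *)

Section NijenhuisAtPoint.
Context (R : realType) (U : pointed_open R 4) (g J : 'rV[R]_4 -> 'M[R]_4).
Hypothesis g_smooth : smooth_on (dset U) g.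
Hypothesis J_smooth : smooth_on (dset U) J.
Hypothesis g_sym : forall x, dset U x -> (g x)^T = g x.
Hypothesis g_pos : forall x (v : 'rV[R]_4), dset U x -> v != 0 ->
  0 < (v *m g x *m v^T) 0 0.
Hypothesis JJ : forall x, dset U x -> J x *m J x = - 1%:M.
Hypothesis Jg : forall x, dset U x -> J x *m g x *m (J x)^T = g x.
Local Notation K := (smooth_fun U).
Local Notation C := R[i].
Local Notation D := (smooth_derivations U).
Local Notation rc := (real_complex R).
Local Notation G := (lift_mx g_smooth).
Local Notation G_sym := (lift_metric_sym g_smooth g_sym).
Local Notation JK := (lift_mx J_smooth).

Context (Gi : 'M[K]_4).
Hypothesis GGi : G *m Gi = 1%:M.
Hypothesis GiE : forall a b, represents (Gi a b) (fun x => ginv g x a b).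
Local Notation L := (coordinate_calculus D G_sym GGi (halfKD U)).
Local Notation nab := (nab L).
Local Notation N := (nijK D JK).
Context (v w m p n k : 'rV[K]_4) (v' w' : 'rV[R]_4 -> 'rV[R]_4) (al be : K).
Hypothesis rv : represents_row v v'.
Hypothesis rw : represents_row w w'.
Hypothesis mE : m = hol JK (iK U) v.
Hypothesis kE : k = hol JK (iK U) w.
Hypothesis pE : p = al *: antihol JK (iK U) v.
Hypothesis nE : n = be *: antihol JK (iK U) w.
Hypothesis ng : null_gram G m p n k.
Implicit Types (X Y : 'rV[K]_4) (f : K).

Let JJK := lift_acs_square J_smooth JJ.
Let dbl0 := @smooth_double_eq0 R U.

Let m_J : m *m JK = iK U *: m.
Proof. by rewrite mE; exact: (holJ JJK (iK2 U)). Qed.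
Let k_J : k *m JK = iK U *: k.
Proof. by rewrite kE; exact: (holJ JJK (iK2 U)). Qed.

(** The expansion of X in m, p, n, k, with v ∓ i Jv and w ∓ i Jw multiplied out. *)
Lemma real_span X : exists a b c d : K,
  X = a *: v + b *: (v *m JK) + c *: w + d *: (w *m JK).
Proof.
have := null_gram_decomp G_sym X ng.
move: (gram G X p) (gram G X m) (gram G X k) (gram G X n) => a b c d ->.
exists (a + b * al), (b * al * iK U - a * iK U), (d + c * be), (c * be * iK U - d * iK U).
rewrite mE kE pE nE /hol /antihol; move: (v *m JK) (w *m JK) => vJ wJ.
by apply/rowP => e; rewrite !mxE; ring.
Qed.

Section AtPoint.
Context (x : 'rV[R]_4) (Ux : dset U x).
Local Notation evv := (map_mx (ev Ux)).
Local Notation JC := (map_mx rc (J x)).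

Let evvJ X : evv (X *m JK) = evv X *m JC.
Proof. by rewrite map_mxM ev_lift_mx. Qed.

(* N(v - i Jv, w - i Jw) = 2 (N(v, w) + i J N(v, w)), whose real part vanishes. *)
Lemma nijenhuis_real_pair : evv (N m k) = 0 -> evv (N v w) = 0.
Proof.
rewrite mE kE /hol nijK_real_pair ?iK2 // evvZ evvD evvZ evvJ ev_iK.
rewrite (represents_row_ev Ux (represents_nijenhuis J_smooth rv rw)) -map_mxM.
move: (nijenhuis J v' w' x) => A h; apply/rowP => c.
have /rowP/(_ c) := h; rewrite !mxE (ev_nat Ux) => /eqP.
rewrite mulf_eq0 pnatr_eq0 /= => /eqP.
move: (A 0 c) (\sum_ _ _) => a b /eqP; rewrite eq_complex /= => /andP[/eqP + _].
by rewrite mul0r mulr0 subrr addr0 => ->.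
Qed.

(* N is tensorial and N(X, JY) = - J N(X, Y). *)
Lemma nijenhuis_span : evv (N v w) = 0 -> forall X Y, evv (N X Y) = 0.
Proof.
move=> vw; pose Z A B := evv (N A B) = 0.
have zC A B : Z A B -> Z B A.
  move=> h; apply: etrans (congr1 _ (nijK_anti D JK A B)) _.
  by apply: etrans (evvN _ _) (etrans (congr1 -%R h) _); rewrite oppr0.
have zD A B B' : Z A B -> Z A B' -> Z A (B + B').
  move=> h h'; apply: etrans (congr1 _ (nijKDr D JK A B B')) _.
  by apply: etrans (evvD _ _ _) (etrans (f_equal2 +%R h h') _); rewrite addr0.
have zZ f A B : Z A B -> Z A (f *: B).
  move=> h; apply: etrans (congr1 _ (nijKZr D JJK f A B)) _.
  by apply: etrans (evvZ _ _ _) (etrans (congr1 _ h) _); rewrite scaler0.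
have zJ A B : Z A B -> Z A (B *m JK).
  move=> h; apply: etrans (congr1 _ (nijKJr D JJK A B)) _.
  apply: etrans (evvN _ _) _; apply: etrans (congr1 -%R (evvJ _)) _.
  by apply: etrans (congr1 (fun T => - (T *m JC)) h) _; rewrite mul0mx oppr0.
have zS A : Z A A.
  rewrite /Z; have -> : N A A = 0; last by rewrite map_mx0.
  apply/rowP => c; rewrite [RHS]mxE; apply: dbl0.
  by have /rowP/(_ c) := nijK_anti D JK A A; rewrite [in RHS]mxE => {1}->; rewrite addNr.
have zsp A : Z A v -> Z A w -> forall Y, Z A Y.
  move=> hv hw Y; have [a [b [c [d ->]]]] := real_span Y.
  exact: (zD _ _ _ (zD _ _ _ (zD _ _ _ (zZ _ _ _ hv) (zZ _ _ _ (zJ _ _ hv)))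
    (zZ _ _ _ hw)) (zZ _ _ _ (zJ _ _ hw))).
have zv := zsp v (zS v) vw; have zw := zsp w (zC _ _ vw) (zS w).
by move=> X; exact: (zsp X (zC _ _ (zv X)) (zC _ _ (zw X))).
Qed.

Hypothesis sm : ev Ux (gm L (nab m m) k) = 0.
Hypothesis sk : ev Ux (gm L (nab k m) k) = 0.

(** Vanishing of s(m) and s(k) at x puts the value of the bracket of m and k at x into N, hence N(m,
    k) = 0 at x; tensoriality extends this to all X and Y. *)
Lemma obstruction_nijenhuis X Y : evv (N X Y) = 0.
Proof.
apply: nijenhuis_span; apply: nijenhuis_real_pair.
rewrite (nijK_holomorphic (iK2 U) (@der_iK _ _ U) m_J k_J).
pose B := bracket D m k.
have Bm : ev Ux (gram G B m) = 0.
  by rewrite (frame_bracket_m D G_sym GGi (halfKD U) ng) evN sm oppr0.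
have Bk : ev Ux (gram G B k) = 0.
  by rewrite (frame_bracket_k D G_sym GGi (halfKD U) ng) evN sk oppr0.
have BJ : evv (B *m JK) = 'i%C *: evv B.
  rewrite evvJ (null_gram_decomp G_sym B ng) !(evvD, evvZ) Bm Bk !scale0r !addr0.
  rewrite mulmxDl -!scalemxAl -!evvJ m_J k_J !evvZ ev_iK scalerDr !scalerA.
  by rewrite ![_ * 'i%C]mulrC.
rewrite -/B evvZ evvD evvZ BJ ev_iK scalerA -expr2 sqr_i scaleN1r subrr scaler0.
exact.
Qed.
End AtPoint.
End NijenhuisAtPoint.

(** * The local statements *)

Section LocalTheorem.
Context (R : realType) (U : pointed_open R 4) (g J : 'rV[R]_4 -> 'M[R]_4).
Hypothesis g_smooth : smooth_on (dset U) g.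
Hypothesis J_smooth : smooth_on (dset U) J.
Hypothesis g_sym : forall x, dset U x -> (g x)^T = g x.
Hypothesis g_pos : forall x (v : 'rV[R]_4), dset U x -> v != 0 ->
  0 < (v *m g x *m v^T) 0 0.
Hypothesis JJ : forall x, dset U x -> J x *m J x = - 1%:M.
Hypothesis Jg : forall x, dset U x -> J x *m g x *m (J x)^T = g x.
Local Notation K := (smooth_fun U).
Local Notation C := R[i].
Local Notation V := 'rV[C]_4.
Local Notation D := (smooth_derivations U).
Local Notation twelfth := (cstK U 12^-1).
Local Notation G := (lift_mx g_smooth).
Local Notation G_sym := (lift_metric_sym g_smooth g_sym).
Local Notation JK := (lift_mx J_smooth).

Context (a : 'I_4).
Hypothesis orth_neq0 : forall x, dset U x ->
  let w := gs_orth (g x) (J x) (delta_mx 0 0) (delta_mx 0 a) in gram (g x) w w != 0.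
Local Notation hol_set := (hol_set J).

Definition cotton_null := forall x, dset U x -> forall Z1 Z2 Z3 : V,
  hol_set x Z1 -> hol_set x Z2 -> hol_set x Z3 -> ccotton g x Z1 Z2 Z3 = 0.

(** Constant fields are smooth on the whole chart, so integrability restricts to a smaller open set
    without extending fields; tensoriality gives the remaining, also complex, fields. *)
Definition nijenhuis_basis := forall (b c : 'I_4) x, dset U x ->
  nijenhuis J (fun=> delta_mx 0 b) (fun=> delta_mx 0 c) x = 0.

Definition hol_special := forall x, dset U x ->
  multiple_principal_plane g x (hol_set x).

Local Notation L GGi := (coordinate_calculus D G_sym GGi (halfKD U)).
Local Notation P GGi := (gram_form (schouten_mx_sym D twelfth G_sym GGi (halfKD U))).

Hypothesis sd : forall x, dset U x -> selfdual_plane g x (hol_set x).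

Let JJK := lift_acs_square J_smooth JJ.
Let JGK := lift_acs_metric g_smooth J_smooth Jg.
Let dbl0 := @smooth_double_eq0 R U.

Lemma nijenhuis_basis_eq0 (X Y : 'rV[K]_4) : nijenhuis_basis -> nijK D JK X Y = 0.
Proof.
move=> nb; have bas b c : nijK D JK (delta_mx 0 b) (delta_mx 0 c) = 0.
  apply/rowP => e; apply: ev_ext => x Ux.
  have r := represents_nijenhuis J_smooth (represents_row_cst b) (represents_row_cst c) e.
  by rewrite r nb // !mxE ev0.
have ext (F : 'rV[K]_4 -> 'rV[K]_4) : (forall X Y, F (X + Y) = F X + F Y) ->
    (forall f X, F (f *: X) = f *: F X) -> (forall b, F (delta_mx 0 b) = 0) ->
    forall X, F X = 0.
  move=> FD FZ F0 Z; rewrite [Z]row_sum_delta (big_morph F FD (id1 := 0)).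
    by rewrite big1 // => b _; rewrite FZ F0 scaler0.
  by have := FZ 0 0; rewrite !scale0r.
apply: (ext (fun X => nijK D JK X Y)) => [A B|f A|b].
- exact: nijKDl.
- exact: (nijKZl D JJK).
apply: (ext (fun Y => nijK D JK _ Y)) => [A B|f A|c].
- exact: nijKDr.
- exact: (nijKZr D JJK).
exact: bas.
Qed.

(** Elimination form of the existence of an inverse metric and an adapted frame: the calculus
    depends on the chosen inverse, so all data are handed over together. *)
Lemma local_frame_ind (Q : Prop) :
  (forall (Gi : 'M[K]_4) (GGi : G *m Gi = 1%:M)
     (GiE : forall a b, represents (Gi a b) (fun x => ginv g x a b))
     (v w m p n k : 'rV[K]_4) (v' w' : 'rV[R]_4 -> 'rV[R]_4) (al be : K),
     represents_row v v' -> represents_row w w' ->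
     m = hol JK (iK U) v -> k = hol JK (iK U) w ->
     p = al *: antihol JK (iK U) v -> n = be *: antihol JK (iK U) w ->
     null_gram G m p n k -> m *m JK = iK U *: m -> k *m JK = iK U *: k ->
     (forall x (Ux : dset U x), exists c d : C, [/\ c != 0,
        map_mx (ev Ux) p = c *: map_mx (@conjc R) (map_mx (ev Ux) m) &
        map_mx (ev Ux) n = d *: map_mx (@conjc R) (map_mx (ev Ux) k)]) ->
     (nijenhuis_basis ->
        gm (L GGi) (nab (L GGi) m m) k = 0 /\ gm (L GGi) (nab (L GGi) k m) k = 0) -> Q) -> Q.
Proof.
move=> H; have [Gi GGi GiE] := metric_inverse g_smooth g_pos.
have [v [w [al [be [av aw wv wvJ [v' rv] [w' rw]]]]]] :=
  adapted_exists g_smooth J_smooth g_sym g_pos JJ Jg orth_neq0.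
have ng := hermitian_null_gram G_sym JJK JGK dbl0 (iK2 U) av aw wv wvJ.
have conjE u (u' : 'rV[R]_4 -> 'rV[R]_4) x (Ux : dset U x) : represents_row u u' ->
    map_mx (ev Ux) (antihol JK (iK U) u) =
    map_mx (@conjc R) (map_mx (ev Ux) (hol JK (iK U) u)).
  move=> ru; have ruJ := represents_row_J J_smooth ru.
  rewrite /antihol /hol !(evvD, evvN, evvZ) ev_iK.
  rewrite (represents_row_ev Ux ru) (represents_row_ev Ux ruJ).
  move: (u' x *m J x) (u' x) => B A.
  apply/rowP => e; rewrite !mxE.
  by apply/eqP; rewrite eq_complex /=; apply/andP; split; apply/eqP; ring.
apply: (H Gi GGi GiE v w _ _ _ _ v' w' al be rv rw erefl erefl erefl erefl ng).
- exact: (holJ JJK (iK2 U)).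
- exact: (holJ JJK (iK2 U)).
- move=> x Ux; exists (ev Ux al), (ev Ux be); split.
  + apply/negP => /eqP al0; have /(congr1 (ev Ux)) := av.
    by rewrite evM al0 mulr0 ev1 => /esym/eqP; rewrite oner_eq0.
  + by rewrite evvZ (conjE _ _ _ _ rv).
  + by rewrite evvZ (conjE _ _ _ _ rw).
move=> nb; apply: (nijK_eq0_integrable G_sym JJK JGK dbl0 (iK2 U) av aw wv wvJ GGi
  (halfKD U) (@der_iK _ _ U)).
exact: nijenhuis_basis_eq0.
Qed.

Lemma cotton_null_integrable_special : cotton_null -> nijenhuis_basis -> hol_special.
Proof.
move=> cot nb; apply: local_frame_ind => Gi GGi GiE v w m p n k v' w' al be _ _ _ _ _ _
  ng mJ kJ _ /(_ nb)[sm sk].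
have c0 x (Ux : dset U x) := hol_cotton_ev g_sym Jg GGi GiE ng mJ kJ Ux (cot x Ux).
have c1 : cottonK (L GGi) (P GGi) m m k = 0.
  by apply: ev_ext => x Ux; apply: etrans (c0 x Ux).1 _; rewrite ev0.
have c2 : cottonK (L GGi) (P GGi) k m k = 0.
  by apply: ev_ext => x Ux; apply: etrans (c0 x Ux).2 _; rewrite ev0.
move=> x Ux; have [psi0 psi1] := integrable_special ng Ux sm sk c1 c2.
exact: (hol_multiple_principal Jg GiE ng mJ kJ (sd Ux) psi0 psi1).
Qed.

Lemma cotton_null_special_nijenhuis :
  (forall x, dset U x -> exists a b c d, weyl_selfdual g a b c d x != 0) ->
  cotton_null -> hol_special ->
  forall X Y, smooth_on (dset U) X -> smooth_on (dset U) Y ->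
  forall x, dset U x -> nijenhuis J X Y x = 0.
Proof.
move=> ne cot sp X Y X_smooth Y_smooth x Ux; move: X_smooth Y_smooth.
apply: local_frame_ind => Gi GGi GiE v w m p n k v' w' al be rv rw mE kE pE nE
  ng mJ kJ conjE _ X_smooth Y_smooth.
have c0 y (Uy : dset U y) := hol_cotton_ev g_sym Jg GGi GiE ng mJ kJ Uy (cot y Uy).
have c1 : cottonK (L GGi) (P GGi) m m k = 0.
  by apply: ev_ext => y Uy; apply: etrans (c0 y Uy).1 _; rewrite ev0.
have c2 : cottonK (L GGi) (P GGi) k m k = 0.
  by apply: ev_ext => y Uy; apply: etrans (c0 y Uy).2 _; rewrite ev0.
have p0 y (Uy : dset U y) :=
  hol_multiple_principal_psi g_sym Jg GGi GiE ng mJ kJ Uy (sp y Uy).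
have psi0 : weylK (L GGi) (P GGi) m k m k = 0.
  by apply: ev_ext => y Uy; apply: etrans (p0 y Uy).1 _; rewrite ev0.
have psi1 : weylK (L GGi) (P GGi) m k n k = 0.
  by apply: ev_ext => y Uy; apply: etrans (p0 y Uy).2 _; rewrite ev0.
have [c [d [c_neq0 pc nc]]] := conjE x Ux.
have psi2 := adapted_psi2_neq0 g_pos Jg GiE ng mJ kJ c_neq0 pc nc (sd Ux) (ne x Ux)
  (p0 x Ux).1 (p0 x Ux).2.
have [sm sk] := special_obstruction ng psi0 psi1 c1 c2 psi2.
have lft Z : smooth_on (dset U) Z -> exists Z' : 'rV[K]_4, represents_row Z' Z.
  move=> Z_smooth; exists (\row_e lift (smooth_entry (dset_open U) 0 e Z_smooth)) => e.
  by rewrite mxE; exact: represents_lift.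
have [X' rX] := lft _ X_smooth; have [Y' rY] := lft _ Y_smooth.
have N0 := obstruction_nijenhuis JJ rv rw mE kE pE nE ng sm sk X' Y'.
have := represents_row_ev Ux (represents_nijenhuis J_smooth rX rY).
rewrite N0 => /esym N'0; apply/rowP => c'.
by have /rowP/(_ c') := N'0; rewrite !mxE => /eqP; rewrite eq_complex => /andP[/eqP].
Qed.

Lemma integrable_special_cotton_null : nijenhuis_basis -> hol_special -> cotton_null.
Proof.
move=> nb sp; apply: local_frame_ind => Gi GGi GiE v w m p n k v' w' al be _ _ _ _ _ _
  ng mJ kJ _ /(_ nb)[sm sk].
have p0 y (Uy : dset U y) :=
  hol_multiple_principal_psi g_sym Jg GGi GiE ng mJ kJ Uy (sp y Uy).
have psi0 : weylK (L GGi) (P GGi) m k m k = 0.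
  by apply: ev_ext => y Uy; apply: etrans (p0 y Uy).1 _; rewrite ev0.
have psi1 : weylK (L GGi) (P GGi) m k n k = 0.
  by apply: ev_ext => y Uy; apply: etrans (p0 y Uy).2 _; rewrite ev0.
have [c1 c2] := integrable_special_cotton ng psi0 psi1 sm sk.
move=> x Ux; apply: (hol_cotton_eq0 Jg GiE ng mJ kJ).
  by apply: etrans (congr1 (ev Ux) c1) _; rewrite ev0.
by apply: etrans (congr1 (ev Ux) c2) _; rewrite ev0.
Qed.
End LocalTheorem.

Lemma metric_compatible_mx (R : realType) (M : oriented_manifold R 4)
    (g : riemannian_metric M) (J : almost_complex_structure M) :
  metric_compatible g J -> forall i x, chart_image i x ->
  J i x *m g i x *m (J i x)^T = g i x.
Proof.
move=> gJ i x Ux; apply/matrixP => a b.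
have := gJ i x (delta_mx 0 a) (delta_mx 0 b) Ux.
rewrite trmx_mul trmx_delta !mulmxA -(mulmxA _ (J i x)) -(mulmxA (delta_mx 0 a)).
by rewrite -!rowE -!colE !mxE.
Qed.

(** An index a that works at x0 works nearby, by continuity of g(w, w); this fixes the open set on
    which the frame lives. *)
Lemma orth_nbhs (R : realType) (M : oriented_manifold R 4)
    (g : riemannian_metric M) (J : almost_complex_structure M) i x0 :
  metric_compatible g J -> chart_image i x0 ->
  exists (U : pointed_open R 4) (a : 'I_4), [/\ dset U x0, dset U `<=` chart_image i &
    forall x, dset U x ->
      let w := gs_orth (g i x) (J i x) (delta_mx 0 0) (delta_mx 0 a) in
      gram (g i x) w w != 0].
Proof.
move=> gJ Ux0.
have v0 : (delta_mx 0 0 : 'rV[R]_4) != 0.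
  by apply/eqP => /rowP/(_ 0); rewrite !mxE => /eqP; rewrite oner_eq0.
have [a a0] := gs_orth_exists (J i x0) (fun v => metric_posdef g Ux0) v0.
pose U0 := PointedOpen (@image_open R 4 M i) Ux0.
have s1 : smooth_on (dset U0) (g i) := @metric_smooth _ _ _ g i.
have s2 : smooth_on (dset U0) (J i) := @acs_smooth _ _ _ J i.
pose r x := let w := gs_orth (g i x) (J i x) (delta_mx 0 0) (delta_mx 0 a) in
  gram (g i x) w w.
(* Smoothness is read off from an element of the ring over the full chart image that represents
   r. *)
have sr : smooth_on (dset U0) r.
  have rw := represents_gs_orth s1 s2 (@represents_row_cst _ U0 0) (@represents_row_cst _ U0 a).
  exact: represents_smooth (represents_gram s1 rw rw).
have oU : open [set x | chart_image i x /\ r x != 0].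
  rewrite openE => x [Ux rx]; rewrite /interior.
  have cr : {for x, continuous r}.
    by apply: differentiable_continuous; exact: smooth_differentiable sr Ux.
  apply: filterI; first by apply: open_nbhs_nbhs; split=> //; exact: image_open.
  exact: cvgr_neq0 cr rx.
exists (PointedOpen oU (conj Ux0 a0)), a; split=> //.
- by move=> x [].
- by move=> x [].
Qed.

Theorem theorem2p1 (R : realType) (M : oriented_manifold R 4)
    (g : riemannian_metric M) (J : almost_complex_structure M)
    (weyl_ne0 : weyl_selfdual_nonvanishing g)
    (gJ : metric_compatible g J)
    (sdJ : holomorphic_selfdual g J) :
  (cotton_degenerate g J /\ nijenhuis_vanishes J ->
     weyl_special_along_holomorphic g J) /\
  (cotton_degenerate g J /\ weyl_special_along_holomorphic g J ->
     nijenhuis_vanishes J) /\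
  (nijenhuis_vanishes J /\ weyl_special_along_holomorphic g J ->
     cotton_degenerate g J).
Proof.
have basis i (U : pointed_open R 4) : dset U `<=` chart_image i -> nijenhuis_vanishes J ->
    nijenhuis_basis U (J i).
  move=> UC N0 b c x Ux; apply: N0 (UC _ Ux); apply: smooth_cst; exact: image_open.
split; [|split].
- move=> [cot N0] i x Cx; have [U [a [Ux UC orth]]] := orth_nbhs gJ Cx.
  have mp : multiple_principal_plane (g i) x (hol_set (J i) x).
    apply: (cotton_null_integrable_special (U := U) (a := a) _ _ _ _ _ _ orth) Ux => //.
    + exact: smooth_sub UC (@metric_smooth _ _ _ g i).
    + exact: smooth_sub UC (@acs_smooth _ _ _ J i).
    + by move=> y /UC; exact: Defs.metric_sym.
    + by move=> y v /UC; exact: metric_posdef.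
    + by move=> y /UC; exact: acs_square.
    + by move=> y /UC; exact: metric_compatible_mx.
    + by move=> y /UC; exact: sdJ.
    + by move=> y /UC; exact: cot.
    + exact: basis.
  by split=> //; exists (hol_set (J i) x).
- move=> [cot sp] i X Y X_smooth Y_smooth x Cx.
  have [U [a [Ux UC orth]]] := orth_nbhs gJ Cx.
  apply: (cotton_null_special_nijenhuis (U := U) (a := a) _ _ _ _ _ _ orth) Ux => //.
  + exact: smooth_sub UC (@metric_smooth _ _ _ g i).
  + exact: smooth_sub UC (@acs_smooth _ _ _ J i).
  + by move=> y /UC; exact: Defs.metric_sym.
  + by move=> y v /UC; exact: metric_posdef.
  + by move=> y /UC; exact: acs_square.
  + by move=> y /UC; exact: metric_compatible_mx.
  + by move=> y /UC; exact: sdJ.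
  + by move=> y /UC; exact: weyl_ne0.
  + by move=> y /UC; exact: cot.
  + by move=> y /UC/sp[].
  + exact: smooth_sub UC X_smooth.
  + exact: smooth_sub UC Y_smooth.
- move=> [N0 sp] i x Cx; have [U [a [Ux UC orth]]] := orth_nbhs gJ Cx.
  apply: (integrable_special_cotton_null (U := U) (a := a) _ _ _ _ _ _ orth) Ux => //.
  + exact: smooth_sub UC (@metric_smooth _ _ _ g i).
  + exact: smooth_sub UC (@acs_smooth _ _ _ J i).
  + by move=> y /UC; exact: Defs.metric_sym.
  + by move=> y v /UC; exact: metric_posdef.
  + by move=> y /UC; exact: acs_square.
  + by move=> y /UC; exact: metric_compatible_mx.
  + exact: basis.
  + by move=> y /UC/sp[].
Qed.
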